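(* Let $\mathcal{B}$ be a $C^*$-algebra, $E$ a Hilbert $\mathcal{B}$-module, $K$ a closed ternary ideal in $E$, and let $\mathcal{I}=\begin{pmatrix}\overline{\mathrm{span}}\,\langle K,K\rangle & K^* \\ K & \overline{\mathrm{span}}\,KK^*\end{pmatrix}$ be the corresponding closed ideal in the reduced linking algebra $\mathscr{K}\begin{pmatrix}\mathcal{B}_E \\ E\end{pmatrix}$ of $E$. Then the quotient $E/K$ is a TRO under the inherited ternary product $(x+K,y+K,z+K)\mapsto x\langle y,z\rangle+K$ and the quotient norm, and its (reduced) linking algebra is $\mathscr{K}\begin{pmatrix}\mathcal{B}_E \\ E\end{pmatrix}/\mathcal{I}$, where $E/K$ is identified as the $21$-corner of this quotient $C^*$-algebra.
   Context: Hilbert modules are right modules with inner product linear in the second variable; they need not be full. $\mathcal{B}_E=\overline{\mathrm{span}}\,\langle E,E\rangle$. For $x\in E$, $x^*=\langle x,\cdot\rangle$, $xy^*\colon z\mapsto x\langle y,z\rangle$, $K^*=\{x^*:x\in K\}$, $KK^*=\{xy^*:x,y\in K\}$, $\mathscr{K}(E)=\overline{\mathrm{span}}\,EE^*$. The reduced linking algebra of $E$ is $\mathscr{K}\begin{pmatrix}\mathcal{B}_E \\ E\end{pmatrix}=\begin{pmatrix}\mathcal{B}_E & E^* \\ E & \mathscr{K}(E)\end{pmatrix}$ (compact operators on $\mathcal{B}_E\oplus E$). A linear subspace $K\subset E$ is a ternary ideal if $x\langle k,y\rangle\in K$ for all $x,y\in E,k\in K$. A TRO (ternary ring of operators) is a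 linear subspace $V$ of a $C^*$-algebra with $xy^*z\in V$ for $x,y,z\in V$; giving a normed space with a ternary product a TRO structure means identifying it, via an isometric linear injection that carries the given ternary product to $xy^*z$, with a TRO in a $C^*$-algebra. The quotient norm is $\|x+K\|=\inf_{k\in K}\|x+k\|$. The quotient of the reduced linking algebra by $\mathcal{I}$ has the block form $\begin{pmatrix}\mathcal{B}_E/\mathcal{B}_K & E^*/K^* \\ E/K & \mathscr{K}(E)/\overline{\mathrm{span}}\,KK^*\end{pmatrix}$ with $\mathcal{B}_K=\overline{\mathrm{span}}\,\langle K,K\rangle$. This quotient is the reduced linking algebra of $E/K$ in the sense that $E/K$, with inner product $\langle x+K,y+K\rangle=\langle x,y\rangle+\mathcal{B}_K$, is a full Hilbert $\mathcal{B}_E/\mathcal{B}_K$-module and the quotient $C^*$-algebra $\mathscr{K}\begin{pmatrix}\mathcal{B}_E \\ E\end{pmatrix}/\mathcal{I}$ is canonically its algebra $\mathscr{K}\begin{pmatrix}\mathcal{B}_E/\mathcal{B}_K \\ E/K\end{pmatrix}$. *)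

(* Defs.v *)
(* The complex numbers are R[i] for R : realType; norms of complex normed spaces
   take values in R[i], where they are real and nonnegative. *)
From HB Require Import structures.
From mathcomp Require Import all_boot all_order all_algebra generic_quotient.
From mathcomp Require Import all_classical all_reals.
From mathcomp Require Import topology normedtype.
From mathcomp Require Import complex ring.

Set Implicit Arguments.
Unset Strict Implicit.
Unset Printing Implicit Defensive.

Import Order.TTheory GRing.Theory Num.Theory.
Import numFieldNormedType.Exports.

Local Open Scope classical_set_scope.
Local Open Scope ring_scope.
Local Open Scope quotient_scope.

Record closedSubspace (R : realType) (V : normedModType R[i]) := ClosedSubspace {
  cs_set :> V -> Prop;
  cs_set0 : cs_set 0;
  cs_lin : forall (k : R[i]) x y, cs_set x -> cs_set y -> cs_set (k *: x + y);
  cs_closed : closed (cs_set : set V) }.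

Definition lspan (K : pzRingType) (V : lmodType K) (S : set V) : set V :=
  [set v | exists n (c : 'I_n -> K) (s : 'I_n -> V),
     (forall i, S (s i)) /\ v = \sum_i c i *: s i].

Lemma lspan0 (K : pzRingType) (V : lmodType K) (S : set V) : lspan S 0.
Proof.
exists 0%N, (fun=> 0), (fun=> 0); split; first by case.
by rewrite big_ord0.
Qed.

Lemma lspan_lin (K : pzRingType) (V : lmodType K) (S : set V) (k : K) x y :
  lspan S x -> lspan S y -> lspan S (k *: x + y).
Proof.
move=> [n [c [s [Ss ->]]]] [m [d [t [St ->]]]].
exists (n + m)%N.
exists (fun i => match fintype.split i with inl j => k * c j | inr j => d j end).
exists (fun i => match fintype.split i with inl j => s j | inr j => t j end).
split=> [i|]; first by case: (fintype.split i).
rewrite big_split_ord /= scaler_sumr; congr (_ + _).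
  apply: eq_bigr => i _; rewrite scalerA.
  by rewrite (unsplitK (inl i : 'I_n + 'I_m)%type).
apply: eq_bigr => i _.
by rewrite (unsplitK (inr i : 'I_n + 'I_m)%type).
Qed.

Lemma sub_lspan (K : pzRingType) (V : lmodType K) (S : set V) : S `<=` lspan S.
Proof.
move=> x Sx; exists 1%N, (fun=> 1), (fun=> x); split=> //.
by rewrite big_ord1 scale1r.
Qed.

Section ClosedSpan.
Context {R : realType} {V : normedModType R[i]}.

Lemma closureP (S : set V) x :
  closure S x <-> forall e : R[i], 0 < e -> exists2 y, S y & `|x - y| < e.
Proof.
split=> [clS e e0|H A /nbhs_ballP[e/= e0 eA]].
  have [|y [Sy]] := clS (ball x e); first exact: nbhsx_ballx.
  by rewrite -ball_normE /= => xy; exists y.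
have [y Sy xy] := H _ e0; exists y; split=> //.
by apply: eA; rewrite -ball_normE.
Qed.

Lemma closure_lin (S : set V) :
  (forall (k : R[i]) x y, S x -> S y -> S (k *: x + y)) ->
  forall (k : R[i]) x y, closure S x -> closure S y -> closure S (k *: x + y).
Proof.
move=> Slin k x y /closureP Sx /closureP Sy; apply/closureP => e e0.
have k0 : 0 < `|k| + 1 by rewrite ltr_wpDl.
have e20 : 0 < e / 2 by rewrite divr_gt0.
have [x' Sx' xx'] := Sx _ (divr_gt0 e20 k0).
have [y' Sy' yy'] := Sy _ e20.
exists (k *: x' + y'); first exact: Slin.
rewrite opprD addrACA -scalerBr; apply: le_lt_trans (ler_normD _ _) _.
rewrite (splitr e) ler_ltD// normrZ.
have: `|x - x'| * (`|k| + 1) <= e / 2 by rewrite -ler_pdivlMr// ltW.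
by apply: le_trans; rewrite mulrC ler_wpM2l// lerDl.
Qed.

Definition closed_span (S : set V) : closedSubspace V :=
  ClosedSubspace (@subset_closure _ (lspan S) 0 (lspan0 S))
    (closure_lin (@lspan_lin _ _ S)) (@closed_closure _ _).

End ClosedSpan.

Section SubspaceType.
Context {R : realType} {V : completeNormedModType R[i]} (S : closedSubspace V).

Definition cs_pred : pred V := fun x => `[< S x >].

Lemma cs_predP x : reflect (S x) (x \in cs_pred).
Proof. exact: asboolP. Qed.

Lemma cs_pred_closed : subsemimod_closed cs_pred.
Proof.
split; [split|].
- by apply/cs_predP; exact: cs_set0.
- move=> x y /cs_predP Sx /cs_predP Sy; apply/cs_predP.
  by rewrite -[x]scale1r; exact: cs_lin.
- move=> k x /cs_predP Sx; apply/cs_predP.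
  by rewrite -[_ *: _]addr0; apply: cs_lin => //; exact: cs_set0.
Qed.
HB.instance Definition _ := GRing.isSubmodClosed.Build _ _ cs_pred cs_pred_closed.

Record subspace_type := Subspace { sv : V; _ : sv \in cs_pred }.
HB.instance Definition _ := [isSub for sv].
HB.instance Definition _ := [Choice of subspace_type by <:].
HB.instance Definition _ := [SubChoice_isSubLmodule of subspace_type by <:].

Definition sub_norm (x : subspace_type) : R[i] := `|sv x|.

Lemma sub_normD x y : sub_norm (x + y) <= sub_norm x + sub_norm y.
Proof. exact: ler_normD. Qed.
Lemma sub_normZ (l : R[i]) x : sub_norm (l *: x) = `|l| * sub_norm x.
Proof. exact: normrZ. Qed.
Lemma sub_norm_eq0 x : sub_norm x = 0 -> x = 0.
Proof. by move=> /normr0_eq0 ?; exact: val_inj. Qed.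

HB.instance Definition _ := @Lmodule_isNormed.Build R[i] subspace_type
  sub_norm sub_normD sub_normZ sub_norm_eq0.

Lemma sub_complete (F : set_system subspace_type) :
  ProperFilter F -> cauchy F -> cvg F.
Proof.
move=> FF /cauchyP cF.
have sF : ProperFilter (sv @ F) by apply: fmap_proper_filter.
have /cauchy_cvg svF : cauchy (sv @ F).
  apply/cauchyP => e e0; have [x Fx] := cF e e0; exists (sv x).
  apply: (@filterS _ F _ (ball x e)) => // y; by rewrite /= -!ball_normE.
have Sl : S (lim (sv @ F)).
  apply: (@closed_cvg _ _ F _ sv (cs_set S)) => //; first exact: cs_closed.
  by apply: nearW => x; apply/cs_predP; case: x.
have /cs_predP Sl' := Sl.
apply/cvg_ex; exists (Subspace Sl').
apply/cvgrPdist_lt => e e0.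
by have /cvgrPdist_lt/(_ e e0) := svF.
Qed.
HB.instance Definition _ := Uniform_isComplete.Build subspace_type sub_complete.

End SubspaceType.

Section QuotientType.
Context {R : realType} {V : completeNormedModType R[i]} (S : closedSubspace V).

Definition cs_zmod : zmodClosed V := GRing.ZmodClosed.clone V (cs_pred S) _.

Definition quotient_type := Quotient.quot cs_zmod.
HB.instance Definition _ := GRing.Zmodule.on quotient_type.

Definition qpi (x : V) : quotient_type := \pi_(Quotient.quot cs_zmod) x.
Definition qrepr (x : quotient_type) : V := repr (x : Quotient.quot cs_zmod).

Lemma qreprK : cancel qrepr qpi.
Proof. by move=> x; rewrite /qpi /qrepr; exact: reprK. Qed.

Lemma qpi_eq x y : qpi x = qpi y <-> S (x - y).
Proof.
rewrite /qpi; split=> [/eqP|Sxy].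
  by rewrite -Quotient.idealrBE => /cs_predP.
by apply/eqP; rewrite -Quotient.idealrBE; apply/cs_predP.
Qed.

Lemma qpiB : {morph qpi : x y / x - y}.
Proof. by move=> x y; rewrite /qpi (raddfB (\pi_(Quotient.quot cs_zmod))). Qed.

Lemma qpiD : {morph qpi : x y / x + y}.
Proof. by move=> x y; rewrite /qpi (raddfD (\pi_(Quotient.quot cs_zmod))). Qed.

Definition qscale (k : R[i]) (x : quotient_type) := qpi (k *: qrepr x).

Lemma qpi_scale k x : qscale k (qpi x) = qpi (k *: x).
Proof.
apply/qpi_eq; rewrite -scalerBr -[_ *: _]addr0.
apply: cs_lin; last exact: cs_set0.
by apply/qpi_eq; rewrite qreprK.
Qed.

Lemma qscaleA a b x : qscale a (qscale b x) = qscale (a * b) x.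
Proof. by rewrite -[x]qreprK !qpi_scale scalerA. Qed.
Lemma qscale1 : left_id 1 qscale.
Proof. by move=> x; rewrite -[x]qreprK qpi_scale scale1r. Qed.
Lemma qscaleDr : right_distributive qscale +%R.
Proof.
by move=> k x y; rewrite -[x]qreprK -[y]qreprK -qpiD !qpi_scale scalerDr qpiD.
Qed.
Lemma qscaleDl x : {morph qscale^~ x : a b / a + b}.
Proof. by move=> a b; rewrite -[x]qreprK !qpi_scale scalerDl qpiD. Qed.

HB.instance Definition _ := GRing.Zmodule_isLmodule.Build R[i] quotient_type
  qscaleA qscale1 qscaleDr qscaleDl.

Lemma qpi_linear : linear qpi.
Proof. by move=> k x y; rewrite qpiD -qpi_scale. Qed.
HB.instance Definition _ := GRing.isLinear.Build R[i] V quotient_type _ qpi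
  qpi_linear.

(* `|x| as an element of R *)
Definition rnorm (x : V) : R := complex.Re `|x|.

Lemma rnormE x : (rnorm x)%:C%C = `|x|.
Proof. by apply/RRe_real/ger0_real. Qed.

(* the inf is taken in R *)
Definition quotient_norm (x : quotient_type) : R[i] :=
  (inf [set rnorm (qrepr x + k) | k in [set k | S k]])%:C%C.

Definition qset (x : quotient_type) := [set rnorm v | v in [set v | qpi v = x]].

Lemma qsetE x : [set rnorm (qrepr x + k) | k in [set k | S k]] = qset x.
Proof.
apply/seteqP; split=> [_ /= [k Sk <-]|_ /= [v <- <-]].
  exists (qrepr x + k) => //=.
  by rewrite -[RHS]qreprK; apply/qpi_eq; rewrite addrC addKr.
exists (v - qrepr (qpi v)); last by rewrite addrC subrK.
by apply/qpi_eq; rewrite qreprK.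
Qed.

Lemma rnorm_ge0 x : 0 <= rnorm x.
Proof. by rewrite -ler0c rnormE. Qed.

Lemma qset_inf x : has_inf (qset x).
Proof.
split; first by exists (rnorm (qrepr x)), (qrepr x) => //=; rewrite qreprK.
by exists 0 => _ [v _ <-]; exact: rnorm_ge0.
Qed.

(* ‖x + K‖ = inf_{k ∈ K} ‖x + k‖ for every representative x *)
Lemma quotient_normE v :
  quotient_norm (qpi v) = (inf [set rnorm (v + k) | k in [set k | S k]])%:C%C.
Proof.
rewrite /quotient_norm qsetE; congr ((inf _)%:C%C).
apply/seteqP; split=> [_ /= [w wv <-]|_ /= [k Sk <-]].
  by exists (w - v); [exact/qpi_eq|rewrite addrC subrK].
by exists (v + k) => //=; apply/qpi_eq; rewrite addrC addKr.
Qed.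

Lemma quotient_norm_le v : quotient_norm (qpi v) <= `|v|.
Proof.
rewrite /quotient_norm qsetE -rnormE lecR.
by apply: ge_inf; [case: (qset_inf (qpi v))|exists v].
Qed.

Lemma quotient_norm_lt x (e : R[i]) : quotient_norm x < e ->
  exists2 v, qpi v = x & `|v| < e.
Proof.
rewrite /quotient_norm qsetE ltcE /= => /andP[/eqP Ime].
move=> /(inf_lt (qset_inf x).1)[_ [v vx <-] ve].
by exists v => //; rewrite ltcE Ime (ger0_Im (normr_ge0 _)) eqxx.
Qed.

Lemma quotient_norm_ge x (e : R) : (forall v, qpi v = x -> e <= rnorm v) ->
  e%:C%C <= quotient_norm x.
Proof.
move=> H; rewrite /quotient_norm qsetE lecR.
apply: lb_le_inf; first by case: (qset_inf x).
by move=> _ [v vx <-]; exact: H.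
Qed.

Lemma quotient_norm_ge0 x : 0 <= quotient_norm x.
Proof. by apply: quotient_norm_ge => v _; exact: rnorm_ge0. Qed.

Lemma quotient_normD x y :
  quotient_norm (x + y) <= quotient_norm x + quotient_norm y.
Proof.
have [a ax] : exists a, quotient_norm x = a%:C%C by eexists.
have [b bx] : exists b, quotient_norm y = b%:C%C by eexists.
have [c cx] : exists c, quotient_norm (x + y) = c%:C%C by eexists.
rewrite ax bx cx -rmorphD lecR; apply/ler_addgt0Pr => e e0.
have e20 : 0 < e / 2 by rewrite divr_gt0.
have [v vx av] : exists2 v, qpi v = x & `|v| < (a + e / 2)%:C%C.
  by apply: quotient_norm_lt; rewrite ax ltcR ltrDl.
have [w wy bw] : exists2 w, qpi w = y & `|w| < (b + e / 2)%:C%C.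
  by apply: quotient_norm_lt; rewrite bx ltcR ltrDl.
rewrite -lecR -cx -vx -wy -qpiD; apply: le_trans (quotient_norm_le _) _.
apply: le_trans (ler_normD _ _) _; rewrite (splitr e) addrACA rmorphD.
by rewrite ltW// ltrD.
Qed.

Lemma quotient_normZ (l : R[i]) x : quotient_norm (l *: x) = `|l| * quotient_norm x.
Proof.
have le k z : quotient_norm (k *: z) <= `|k| * quotient_norm z.
  have [->|k0] := eqVneq k 0.
    rewrite scale0r normr0 mul0r -(qreprK 0).
    have -> : (0 : quotient_type) = qpi 0 by rewrite linear0.
    by rewrite qreprK; apply: le_trans (quotient_norm_le _) _; rewrite normr0.
  have nk : 0 < `|k| by rewrite normr_gt0.
  rewrite mulrC -ler_pdivrMr//.
  have [a az] : exists a, quotient_norm (k *: z) / `|k| = a%:C%C.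
    exists (complex.Re (quotient_norm (k *: z) / `|k|)).
    by rewrite RRe_real// ger0_real// divr_ge0// quotient_norm_ge0.
  rewrite az; apply: quotient_norm_ge => v vz.
  rewrite -lecR rnormE -az ler_pdivrMr// mulrC -normrZ.
  have -> : k *: z = qpi (k *: v) by rewrite linearZ/= vz.
  exact: quotient_norm_le.
apply/eqP; rewrite eq_le le/=.
have [->|l0] := eqVneq l 0; first by rewrite normr0 mul0r quotient_norm_ge0.
have := le l^-1 (l *: x); rewrite scalerA mulVf// scale1r normfV mulrC.
by rewrite ler_pdivlMr ?normr_gt0// mulrC.
Qed.

Lemma quotient_norm_eq0 x : quotient_norm x = 0 -> x = 0.
Proof.
move=> x0; rewrite -[x]qreprK -(linear0 qpi); apply/qpi_eq; rewrite subr0.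
have : closure (cs_set S) (qrepr x).
  apply/closureP => e e0.
  have [|v vx ve] := @quotient_norm_lt x e; first by rewrite x0.
  exists (qrepr x - v); last by rewrite opprB addrC subrK.
  by apply/qpi_eq; rewrite qreprK.
exact: cs_closed.
Qed.

HB.instance Definition _ := @Lmodule_isNormed.Build R[i] quotient_type
  quotient_norm quotient_normD quotient_normZ quotient_norm_eq0.

Lemma quotient_complete (F : set_system quotient_type) :
  ProperFilter F -> cauchy F -> cvg F.
Proof.
move=> FF /cauchyP cF; pose d n : R[i] := 2^-1 ^+ n.
have d0 n : 0 < d n by rewrite exprn_gt0// invr_gt0 ltr0n.
have dlim (e : R[i]) : 0 < e -> exists N, forall n, (N <= n)%N -> d n < e.
  move=> e0; have eE : e = (complex.Re e)%:C%C.
    by rewrite RRe_real// ger0_real// ltW.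
  have r0 : 0 < complex.Re e by rewrite -ltcR -eE.
  exists (Num.bound (complex.Re e)^-1) => n Nn.
  rewrite /d exprVn invf_plt ?posrE ?exprn_gt0//.
  rewrite eE -fmorphV -natrX.
  have -> : ((2 ^ n)%:R : R[i]) = ((2 ^ n)%:R)%:C%C by rewrite rmorph_nat.
  rewrite ltcR.
  apply: lt_le_trans (archi_boundP _) _; first by rewrite invr_ge0 ltW.
  by rewrite ler_nat (leq_trans Nn)// ltnW// ltn_expl.
have [x Fx] := choice (fun n => cF (d n) (d0 n)).
have dS n : d n.+1 = d n / 2 by rewrite /d exprSr.
have xx n : `|x n.+1 - x n| < 2 * d n.
  have [y []] := filter_ex (@filterI _ F _ _ _ (Fx n) (Fx n.+1)).
  rewrite -!ball_normE /= => xy xy'.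
  rewrite -(subrKA y).
  apply: le_lt_trans (ler_normD _ _) _.
  rewrite -[2%:R]/(1 + 1) mulrDl mul1r; apply: ltrD; last by rewrite distrC.
  by apply: lt_trans xy' _; rewrite dS ltr_pdivrMr// ltr_pMr// ltr1n.
have /choice[f fP] : forall p : nat * V, exists w, qpi w = x p.1.+1 /\
    (qpi p.2 = x p.1 -> `|p.2 - w| < 2 * d p.1).
  move=> [n v] /=; have [vx|vx] := pselect (qpi v = x n).
    have [u ux ud] := quotient_norm_lt (xx n).
    exists (v + u); split; first by rewrite qpiD ux vx addrC subrK.
    by move=> _ /=; rewrite opprD addrA subrr add0r normrN.
  by exists (qrepr (x n.+1)); rewrite qreprK.
pose v := fix v n := if n is m.+1 then f (m, v m) else qrepr (x 0%N).
have vx n : qpi (v n) = x n.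
  by case: n => [|n] /=; [exact: qreprK|exact: (fP (n, v n)).1].
have vd n : `|v n - v n.+1| < 2 * d n by exact: (fP (n, v n)).2 (vx n).
have vdk n k : `|v n - v (n + k)%N| <= 4 * (d n - d (n + k)%N).
  elim: k => [|k IH]; first by rewrite addn0 !subrr normr0 mulr0.
  rewrite addnS -(subrKA (v (n + k)%N)).
  apply: le_trans (ler_normD _ _) _.
  apply: le_trans (lerD IH (ltW (vd _))) _.
  rewrite dS.
  have -> : 4 * (d n - d (n + k)%N) + 2 * d (n + k)%N =
    4 * (d n - d (n + k)%N / 2) by field.
  by [].
have vdn n m : (n <= m)%N -> `|v n - v m| <= 4 * d n.
  move=> nm; rewrite -(subnKC nm); apply: le_trans (vdk _ _) _.
  by rewrite ler_pM2l// gerBl ltW.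
have cv : cauchy (v @ \oo).
  apply/cauchy_exP => e e0.
  have [|N Nd] := dlim (e / 4); first by rewrite divr_gt0.
  exists (v N), N => // m /= Nm; rewrite -ball_normE /=.
  apply: le_lt_trans (vdn _ _ Nm) _.
  by rewrite mulrC -ltr_pdivlMr//; exact: Nd.
have /cvgrPdist_lt vl : v @ \oo --> lim (v @ \oo) by exact: cauchy_cvg cv.
apply/cvg_ex; exists (qpi (lim (v @ \oo))); apply/cvgrPdist_lt => e e0.
have e20 : 0 < e / 2 by rewrite divr_gt0.
have [N1 _ N1d] := vl _ e20; have [N2 N2d] := dlim _ e20.
pose n := maxn N1 N2.
apply: (@filterS _ F _ (ball (x n) (d n))) => // y.
rewrite -ball_normE /= => xy; rewrite -(subrKA (x n)).
apply: le_lt_trans (ler_normD _ _) _; rewrite (splitr e) ltrD//.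
  rewrite -vx -qpiB; apply: le_lt_trans (quotient_norm_le _) _.
  by apply: N1d; rewrite /= leq_maxl.
by apply: lt_trans xy _; apply: N2d; rewrite leq_maxr.
Qed.

HB.instance Definition _ := Uniform_isComplete.Build quotient_type
  quotient_complete.

End QuotientType.

(* a C*-algebra structure, not necessarily unital, on a complex Banach space *)
Record cstar (R : realType) (A : completeNormedModType R[i]) := CStar {
  cmul : A -> A -> A;
  cadj : A -> A;
  cmulA : forall a b c, cmul a (cmul b c) = cmul (cmul a b) c;
  cmul_linl : forall k a b c, cmul (k *: a + b) c = k *: cmul a c + cmul b c;
  cmul_linr : forall k a b c, cmul a (k *: b + c) = k *: cmul a b + cmul a c;
  cadj_lin : forall k a b, cadj (k *: a + b) = k^* *: cadj a + cadj b;
  cadjM : forall a b, cadj (cmul a b) = cmul (cadj b) (cadj a);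
  cadjK : involutive cadj;
  cnormM : forall a b, `|cmul a b| <= `|a| * `|b|;
  cnorm_adjM : forall a, `|cmul (cadj a) a| = `|a| ^+ 2 }.

Definition star_morphism (R : realType) (A A' : completeNormedModType R[i])
    (cA : cstar A) (cA' : cstar A') (f : A -> A') : Prop :=
  [/\ linear f, (forall a b, f (cmul cA a b) = cmul cA' (f a) (f b))
    & forall a, f (cadj cA a) = cadj cA' (f a)].

(* raw data only, so that A (+) X and the compact operators on it can be formed
   before knowing that A (+) X is a Hilbert module *)
Record moduleData (R : realType) (A : completeNormedModType R[i])
    (X : lmodType R[i]) := ModuleData {
  act : X -> A -> X;
  inner : X -> X -> A }.

Record hilbertModule (R : realType) (A : completeNormedModType R[i])
    (cA : cstar A) (E : completeNormedModType R[i]) := HilbertModule {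
  hdata :> moduleData A E;
  act_cmul : forall x a b, act hdata x (cmul cA a b) = act hdata (act hdata x a) b;
  act_linl : forall k x y a,
    act hdata (k *: x + y) a = k *: act hdata x a + act hdata y a;
  act_linr : forall k x a b,
    act hdata x (k *: a + b) = k *: act hdata x a + act hdata x b;
  inner_linr : forall k x y z,
    inner hdata x (k *: y + z) = k *: inner hdata x y + inner hdata x z;
  inner_act : forall x y a,
    inner hdata x (act hdata y a) = cmul cA (inner hdata x y) a;
  inner_adj : forall x y, cadj cA (inner hdata x y) = inner hdata y x;
  inner_pos : forall x, exists a, inner hdata x x = cmul cA (cadj cA a) a;
  (* definiteness of the inner product follows from the norm being a norm *)
  inner_norm : forall x, `|x| ^+ 2 = `|inner hdata x x| }.

(* V, with the ternary product t, is identified with a TRO in a C*-algebra *)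
Definition is_TRO (R : realType) (V : normedModType R[i])
    (t : V -> V -> V -> V) : Prop :=
  exists (A : completeNormedModType R[i]) (cA : cstar A) (j : V -> A),
    [/\ linear j, injective j, (forall v, `|j v| = `|v|) &
      forall x y z, j (t x y z) = cmul cA (cmul cA (j x) (cadj cA (j y))) (j z)].

Section ModuleData.
Context {R : realType} {A : completeNormedModType R[i]} {X : lmodType R[i]}.
Variable D : moduleData A X.

(* B_K, the closed span of <K, K> *)
Definition inner_span (K : set X) : closedSubspace A :=
  closed_span [set inner D x y | x in K & y in K].

Definition full : Prop := forall a, inner_span setT a.

Definition mnorm (x : X) : R := Num.sqrt (complex.Re `|inner D x x|).

Definition op_bound (T : X -> X) (M : R) : Prop :=
  forall x, mnorm (T x) <= M * mnorm x.

(* only meaningful for bounded operators: inf is 0 on the empty set *)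
Definition opnorm (T : X -> X) : R := inf [set M | 0 <= M /\ op_bound T M].

(* the operator x y^* *)
Definition rank1 (x y : X) : X -> X := fun z => act D x (inner D y z).

(* closed span of K K^* for the operator norm; K(X) is the case K = setT *)
Definition compact_span (K : set X) : set (X -> X) :=
  [set T | forall e : R, 0 < e ->
     exists2 S, lspan [set rank1 x y | x in K & y in K] S & op_bound (T - S) e].

(* L, acting on X through lam, is the C*-algebra K(X) of compact operators *)
Record is_compacts (L : completeNormedModType R[i]) (cL : cstar L)
    (lam : L -> X -> X) : Prop := IsCompacts {
  compacts_lin : linear lam;
  compacts_inj : injective lam;
  compacts_mul : forall S T, lam (cmul cL S T) = lam S \o lam T;
  compacts_adj : forall T x y,
    inner D (lam (cadj cL T) x) y = inner D x (lam T y);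
  compacts_norm : forall T, `|T| = (opnorm (lam T))%:C%C;
  compacts_range : range lam = compact_span setT }.

End ModuleData.

Section DirectSum.
Context {R : realType} {A : completeNormedModType R[i]} {X : lmodType R[i]}.
Variables (cA : cstar A) (D : moduleData A X).

(* the Hilbert A-module A (+) X; its norm is mnorm, not the max norm *)
Definition dirsum : moduleData A (A * X)%type := ModuleData
  (fun u a => (cmul cA u.1 a, act D u.2 a))
  (fun u v => cmul cA (cadj cA u.1) v.1 + inner D u.2 v.2).

(* the operator ((b, x^* ), (y, t)) on A (+) X *)
Definition block (b : A) (x y : X) (t : X -> X) : A * X -> A * X :=
  fun u => (cmul cA b u.1 + inner D x u.2, act D y u.1 + t u.2).

Definition block_ideal (K : set X) : set (A * X -> A * X) :=
  [set f | exists b x y t,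
    [/\ inner_span D K b, K x, K y, compact_span D K t & f = block b x y t]].

Definition op21 (x : X) : A * X -> A * X := fun u => (0, act D x u.1).

(* T vanishes on 0 (+) X and takes values in 0 (+) X *)
Definition in_corner21 (T : A * X -> A * X) : Prop :=
  forall a x, T (a, x) = (0, (T (a, 0)).2).

End DirectSum.

Definition two_sided_ideal (R : realType) (L : completeNormedModType R[i])
    (cL : cstar L) (I : closedSubspace L) : Prop :=
  forall S T, I T -> I (cmul cL S T) /\ I (cmul cL T S).

Definition ternary_ideal (R : realType) (A E : completeNormedModType R[i])
    (D : moduleData A E) (K : closedSubspace E) : Prop :=
  forall x y k, K k -> K (act D x (inner D k y)).

Section CStarTheory.
Context {R : realType} {A : completeNormedModType R[i]} (cA : cstar A).

Lemma cmulBl a b c : cmul cA (a - b) c = cmul cA a c - cmul cA b c.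
Proof. by rewrite -scaleN1r addrC cmul_linl scaleN1r addrC. Qed.

Lemma cmul0l a : cmul cA 0 a = 0.
Proof. by rewrite -(subrr a) cmulBl !subrr. Qed.

Lemma cadjB a b : cadj cA (a - b) = cadj cA a - cadj cA b.
Proof. by rewrite -scaleN1r addrC cadj_lin rmorphN1 scaleN1r addrC. Qed.

Lemma cadj0 : cadj cA 0 = 0.
Proof. by rewrite -{1}(subrr 0) cadjB subrr. Qed.

Lemma cnorm_adj a : `|cadj cA a| = `|a|.
Proof.
have le b : `|b| <= `|cadj cA b|.
  have [->|b0] := eqVneq b 0; first by rewrite normr0.
  have nb : 0 < `|b| by rewrite normr_gt0.
  by rewrite -(ler_pM2r nb) -expr2 -(cnorm_adjM cA) cnormM.
by apply/eqP; rewrite eq_le le -{2}(cadjK cA a) le.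
Qed.

Lemma closed_span_ind (S P : set A) :
  (forall k x y, P x -> P y -> P (k *: x + y)) -> P 0 -> closed P ->
  S `<=` P -> closed_span S `<=` P.
Proof.
move=> Plin P0 Pc SP; apply: subset_trans (closureS _) Pc.
move=> _ [n [c [s [Ss ->]]]].
by elim/big_rec: _ => // i x _ Px; apply: Plin => //; exact: SP.
Qed.
End CStarTheory.

Section Reduced.
Context {R : realType} {B : completeNormedModType R[i]} {cB : cstar B}.
Context {E : completeNormedModType R[i]} (H : hilbertModule cB E).

Definition innerE : closedSubspace B := inner_span H setT.
Definition BE := subspace_type innerE.
HB.instance Definition _ := CompleteNormedModule.on BE.

Lemma innerE_mul a b : innerE a -> innerE (cmul cB a b).
Proof.
move: a; apply: closed_span_ind.
- by move=> k x y Sx Sy; rewrite cmul_linl; exact: cs_lin.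
- by rewrite cmul0l; exact: cs_set0.
- move=> a /closureP Pa; apply: (cs_closed (c := innerE)); apply/closureP => e e0.
  have b0 : 0 < `|b| + 1 by rewrite ltr_wpDl.
  have [a' Sa' aa'] := Pa _ (divr_gt0 e0 b0).
  exists (cmul cB a' b) => //; rewrite -cmulBl.
  apply: le_lt_trans (cnormM _ _ _) _.
  move: aa'; rewrite ltr_pdivlMr//; apply: le_lt_trans.
  by rewrite ler_wpM2l// lerDl.
- move=> _ [x _ [y _ <-]]; rewrite -inner_act.
  by apply/subset_closure/sub_lspan; exists x => //; exists (act H y b).
Qed.

Lemma innerE_adj a : innerE a -> innerE (cadj cB a).
Proof.
move: a; apply: closed_span_ind.
- by move=> k x y Sx Sy; rewrite cadj_lin; exact: cs_lin.
- by rewrite cadj0; exact: cs_set0.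
- move=> a /closureP Pa; apply: (cs_closed (c := innerE)); apply/closureP => e e0.
  have [a' Sa' aa'] := Pa _ e0.
  by exists (cadj cB a') => //; rewrite -cadjB cnorm_adj.
- move=> _ [x _ [y _ <-]]; rewrite inner_adj.
  by apply/subset_closure/sub_lspan; exists y => //; exists x.
Qed.

Lemma innerE_inner x y : innerE (inner H x y).
Proof. by apply/subset_closure/sub_lspan; exists x => //; exists y. Qed.

Definition toBE (a : B) (aE : innerE a) : BE :=
  Subspace (introT (cs_predP innerE a) aE).

Lemma svP (a : BE) : innerE (sv a).
Proof. by apply/cs_predP; case: a. Qed.

Definition BE_mul (a b : BE) : BE := toBE (innerE_mul (b := sv b) (svP (a := a))).
Definition BE_adj (a : BE) : BE := toBE (innerE_adj (svP (a := a))).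

Definition BE_cstar : cstar BE.
Proof.
refine (@CStar R BE BE_mul BE_adj _ _ _ _ _ _ _ _).
- by move=> a b c; apply/val_inj; exact: cmulA.
- by move=> k a b c; apply/val_inj; exact: cmul_linl.
- by move=> k a b c; apply/val_inj; exact: cmul_linr.
- by move=> k a b; apply/val_inj; exact: cadj_lin.
- by move=> a b; apply/val_inj; exact: cadjM.
- by move=> a; apply/val_inj; exact: cadjK.
- by move=> a b; exact: (cnormM cB).
- by move=> a; exact: (cnorm_adjM cB).
Defined.

Definition reduced : moduleData BE E := ModuleData
  (fun x (b : BE) => act H x (sv b)) (fun x y => toBE (@innerE_inner x y)).

End Reduced.

(* Main.v *)
(* Positivity is treated without spectral theory. If |x| <= 1 and x = x^*, the iteration
   y' = (x + y^2) / 2 converges to 1 - sqrt (1 - x); for a self-adjoint contraction k the element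
   k + i sqrt (1 - k^2) is unitary, whence |2 k^2 - 1| <= 1, so that squares of self-adjoint
   elements are characterized by the inequality |t - h| <= t. Kaplansky's argument shows that
   a^* a is such a square. A possibly nonunital algebra A is embedded in the C*-algebra of
   adjointable operators on A, and the bound |h (1 - h)^m| <= 1 / m for 0 <= h <= 1 replaces an
   approximate unit: for i = i^*, x can be moved by an element of X i to a vector x' with
   |x'|^2 <= |<x,x> + i| + e. This makes quotients by closed ideals C*-algebras, and E/K a
   Hilbert module over B_E/B_K.

   The ideal I consists of the compact operators on F = B_E (+) E that map F into F B_K. The
   quotient by I acts injectively on F / F B_K, and this representation is isometric: if T acts
   with norm c, then c^2 - T^* T = r^2 for an adjointable operator r; for S of finite rank r S is
   the image of some W, so that (T S)^* (T S) + W^* W = c^2 S^* S already holds in the quotient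
   and |T S| <= c |S|; letting S tend to T^* gives |T| <= c. *)
Require Import Defs.
From HB Require Import structures.
From mathcomp Require Import all_boot all_order all_algebra.
From mathcomp Require Import all_classical all_reals.
From mathcomp Require Import topology normedtype.
From mathcomp Require Import complex.
From mathcomp Require Import ring lra.
Import Order.TTheory GRing.Theory Num.Theory.
Import numFieldNormedType.Exports.
Local Open Scope classical_set_scope.
Local Open Scope ring_scope.

Set Implicit Arguments.
Unset Strict Implicit.
Unset Printing Implicit Defensive.

(** The usual argument that L/I acts as the compact operators of the quotient module quotes that an
    injective *-homomorphism is isometric, which rests on the spectrum. Working with norm
    inequalities instead is what gives positivity the form |t - h| <= t: the inequality survives
    restriction from B to B_E and so yields a root of <x,x> inside B_E, although the root supplied
    by the module lies in B.

    Exact formulas fail in three places: an infimum in a quotient norm need not be attained, x = y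
    <x,x> is in general solvable only up to e, and the norm of a quotient of A (+) X is not computed
    coordinate by coordinate. One estimate, [quot_approx], serves all three: i = - <x,x> gives the
    approximate factorization, i in the ideal gives nearly minimal representatives.

    As a type A (+) X carries the maximum norm, while its module norm comes from the inner product;
    hence the module theory is set up for [mnorm] on a bare vector space. The embedding that makes
    E/K a TRO is the 21-corner of L/I, and its isometry comes from that of the representation. *)

Section RealNorm.
Context {R : realType}.

(** One small term suffices, without monotonicity: [d n] always bounds all differences from index n
    on. *)
Definition null_seq (d : nat -> R) := forall e : R, 0 < e -> exists n, d n < e.

Section Space.
Context {V : completeNormedModType R[i]}.
Implicit Types x y : V.

Lemma rnormD x y : rnorm (x + y) <= rnorm x + rnorm y.
Proof. by rewrite -lecR rmorphD /= !rnormE ler_normD. Qed.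

Lemma rnormN x : rnorm (- x) = rnorm x.
Proof. by rewrite /rnorm normrN. Qed.

Lemma rnormB x y : rnorm (x - y) <= rnorm x + rnorm y.
Proof. by rewrite -(rnormN y) rnormD. Qed.

Lemma rdistC x y : rnorm (x - y) = rnorm (y - x).
Proof. by rewrite -rnormN opprB. Qed.

Lemma rnorm0 : rnorm (0 : V) = 0.
Proof. by rewrite /rnorm normr0. Qed.

Lemma rnorm_eq0 x : rnorm x = 0 -> x = 0.
Proof. by move=> x0; apply: normr0_eq0; rewrite -rnormE x0. Qed.

Lemma rnormZ (k : R[i]) x : rnorm (k *: x) = complex.Re `|k| * rnorm x.
Proof.
by apply: complexI; rewrite rmorphM /= !rnormE normrZ.
Qed.

Lemma rnormZr (r : R) x : 0 <= r -> rnorm (r%:C%C *: x) = r * rnorm x.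
Proof. by move=> r0; rewrite rnormZ ger0_norm ?ler0c. Qed.

Lemma rnorm_small x : (forall e : R, 0 < e -> rnorm x <= e) -> x = 0.
Proof.
move=> H; apply: rnorm_eq0; apply/eqP; rewrite eq_le rnorm_ge0 andbT.
by apply/ler_addgt0Pr => e e0; rewrite add0r H.
Qed.

Lemma rnorm_dist3 x y z : rnorm (x - z) <= rnorm (x - y) + rnorm (y - z).
Proof. by rewrite -(subrKA y) rnormD. Qed.

Lemma cs_limit (S : closedSubspace V) x :
  (forall e : R, 0 < e -> exists2 y, S y & rnorm (x - y) <= e) -> S x.
Proof.
move=> H; apply: (cs_closed (c := S)); apply/closureP => e e0.
have er : e = (complex.Re e)%:C%C by rewrite RRe_real// ger0_real// ltW.
(* Halving turns the weak inequality of the hypothesis into the strict one of a ball. *)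
have r0 : 0 < complex.Re e / 2 by rewrite divr_gt0// -ltcR -er.
have [y Sy xy] := H _ r0; exists y => //.
rewrite -rnormE er ltcR; apply: le_lt_trans xy _.
by rewrite ltr_pdivrMr// ltr_pMr ?ltr1n// -ltcR -er.
Qed.

Lemma limit_closed (S : set V) :
  (forall x, (forall e : R, 0 < e -> exists2 y, S y & rnorm (x - y) <= e) -> S x) ->
  closed S.
Proof.
move=> H x /closureP cx; apply: H => e e0.
have [|y Sy xy] := cx e%:C%C; first by rewrite ltcR.
by exists y => //; rewrite ltW// -ltcR rnormE.
Qed.

Lemma csD (S : closedSubspace V) x y : S x -> S y -> S (x + y).
Proof. by move=> Sx Sy; rewrite -[x]scale1r; exact: cs_lin. Qed.
Lemma csZ (S : closedSubspace V) k x : S x -> S (k *: x).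
Proof. by move=> Sx; rewrite -[_ *: _]addr0; apply: cs_lin => //; exact: cs_set0. Qed.
Lemma csN (S : closedSubspace V) x : S x -> S (- x).
Proof. by move=> Sx; rewrite -scaleN1r; exact: csZ. Qed.
Lemma csB (S : closedSubspace V) x y : S x -> S y -> S (x - y).
Proof. by move=> Sx Sy; apply: csD => //; exact: csN. Qed.

Lemma span_approx (S : set V) x (e : R) : closed_span S x -> 0 < e ->
  exists2 y, lspan S y & rnorm (x - y) <= e.
Proof.
move=> /closureP cx e0; have [|y Sy xy] := cx e%:C%C; first by rewrite ltcR.
by exists y => //; rewrite ltW// -ltcR rnormE.
Qed.

Lemma sub_closed_span (S : set V) x : S x -> closed_span S x.
Proof. by move=> Sx; apply/subset_closure/sub_lspan. Qed.

Lemma lspan_ind (K : pzRingType) (W : lmodType K) (S P : set W) :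
  P 0 -> (forall k (x y : W), P x -> P y -> P (k *: x + y)) -> S `<=` P ->
  lspan S `<=` P.
Proof.
move=> P0 Pl SP _ [n [c [s [Ss ->]]]].
by elim/big_rec: _ => // i x _ Px; apply: Pl => //; exact: SP.
Qed.

Lemma exp2_small (e : R) : 0 < e -> exists n, (2^-1 : R) ^+ n < e.
Proof.
move=> e0; exists (Num.bound e^-1); rewrite exprVn invf_plt ?posrE ?exprn_gt0//.
apply: lt_le_trans (archi_boundP _) _; first by rewrite invr_ge0 ltW.
by rewrite -natrX ler_nat ltnW// ltn_expl.
Qed.

End Space.

Lemma exp2_le (n m : nat) : (n <= m)%N -> (2^-1 : R) ^+ m <= 2^-1 ^+ n.
Proof.
by move=> nm; rewrite ler_wiXn2l ?invr_ge0 ?ler0n// invf_le1// ler1n.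
Qed.

(** Centres of balls of radius 2^-n that belong to the Cauchy filter form a sequence with an
    explicit modulus, so filters reduce to sequences. *)
Lemma complete_of_seq (V : normedModType R[i]) :
  (forall (u : nat -> V) (d : nat -> R), null_seq d ->
     (forall n m, (n <= m)%N -> complex.Re `|u n - u m| <= d n) ->
     exists l, forall n, complex.Re `|u n - l| <= d n) ->
  forall F : set_system V, ProperFilter F -> cauchy F -> cvg F.
Proof.
move=> H F FF /cauchyP cF; pose d n : R := 2^-1 ^+ n.
have nE (v : V) : `|v| = (complex.Re `|v|)%:C%C by rewrite RRe_real// ger0_real.
have d0 n : 0 < d n by rewrite exprn_gt0// invr_gt0 ltr0n.
have dc n : 0 < (d n)%:C%C by rewrite ltcR.
have [x Fx] := choice (fun n => cF _ (dc n)).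
have xx n m : (n <= m)%N -> complex.Re `|x n - x m| <= 2 * d n.
  (* Two members of a proper filter meet. *)
  move=> nm; have [y []] := filter_ex (@filterI _ F _ _ _ (Fx n) (Fx m)).
  rewrite -!ball_normE /= => xy xy'; rewrite -lecR -nE -(subrKA y).
  apply: le_trans (ler_normD _ _) _; rewrite mulrDl mul1r rmorphD lerD// ?ltW//.
  rewrite distrC; apply: lt_le_trans xy' _.
  by rewrite lecR exp2_le.
have [|l xl] := H x (fun n => 2 * d n) _ xx.
  move=> e e0; have [|n dn] := @exp2_small (e / 2); first by rewrite divr_gt0.
  by exists n; rewrite mulrC -ltr_pdivlMr.
apply/cvg_ex; exists l; apply/cvgrPdist_lt => e e0.
have er : e = (complex.Re e)%:C%C by rewrite RRe_real// ger0_real// ltW.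
(* A third: [2 * d n] from the centre to the limit, [d n] for the radius. *)
have r0 : 0 < complex.Re e / 3 by rewrite divr_gt0// -ltcR -er.
have [n dn] := exp2_small r0.
apply: (@filterS _ F _ (ball (x n) (d n)%:C%C)) => // y.
rewrite -ball_normE /= => xy; rewrite -(subrKA (x n)).
apply: le_lt_trans (ler_normD _ _) _; rewrite er distrC nE.
have := xl n; rewrite -lecR => h; apply: le_lt_trans (lerD h (ltW xy)) _.
rewrite -rmorphD ltcR; move: dn; rewrite -/(d n); lra.
Qed.

Lemma rnorm_complete (V : completeNormedModType R[i]) (u : nat -> V)
    (d : nat -> R) : null_seq d ->
  (forall n m, (n <= m)%N -> rnorm (u n - u m) <= d n) ->
  exists l, forall n, rnorm (u n - l) <= d n.
Proof.
move=> d0 ud.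
have cu : cauchy (u @ \oo).
  apply/cauchy_exP => e e0.
  have er : e = (complex.Re e)%:C%C by rewrite RRe_real// ger0_real// ltW.
  have r0 : 0 < complex.Re e by rewrite -ltcR -er.
  have [N dN] := d0 _ r0; exists (u N), N => // m /= Nm.
  rewrite -ball_normE /= -rnormE er ltcR; exact: le_lt_trans (ud _ _ Nm) dN.
have /cvgrPdist_lt ul : u @ \oo --> lim (u @ \oo) by exact: cauchy_cvg cu.
exists (lim (u @ \oo)) => n; apply/ler_addgt0Pr => e e0.
have ec : 0 < e%:C%C by rewrite ltcR.
have [N _ uN] := ul _ ec.
apply: le_trans (rnorm_dist3 _ (u (maxn N n)) _) _; apply: lerD.
  by apply: ud; rewrite leq_maxr.
rewrite rdistC ltW// -ltcR rnormE; apply: uN; by rewrite /= leq_maxl.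
Qed.

End RealNorm.
(* Linear arithmetic in an abelian group: an expression equals the sum of its atoms weighted by
   integer coefficients, so an identity is decided by comparing coefficients. *)
Inductive zexpr := ZAtom of nat | ZZero | ZAdd of zexpr & zexpr | ZOpp of zexpr
  | ZMuln of zexpr & nat.

Section Zmod.
Variable V : zmodType.

Fixpoint zeval (env : seq V) (t : zexpr) : V := match t with
  | ZAtom i => nth 0 env i
  | ZZero => 0
  | ZAdd t1 t2 => zeval env t1 + zeval env t2
  | ZOpp t1 => - zeval env t1
  | ZMuln t1 n => zeval env t1 *+ n end.

Fixpoint zcoef (t : zexpr) (j : nat) : int := match t with
  | ZAtom i => Posz (i == j)
  | ZZero => 0
  | ZAdd t1 t2 => zcoef t1 j + zcoef t2 j
  | ZOpp t1 => - zcoef t1 j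
  | ZMuln t1 n => zcoef t1 j * Posz n end.

Lemma zeval_coef env t :
  zeval env t = \sum_(j < size env) nth 0 env j *~ zcoef t j.
Proof.
elim: t => [i||t1 IH1 t2 IH2|t1 IH1|t1 IH1 n] /=.
- have [ilt|ige] := ltnP i (size env).
    rewrite (bigD1 (Ordinal ilt))//= eqxx mulr1z big1 ?addr0// => j /eqP ji.
    case: eqP => [ij|]; last by rewrite mulr0z.
    by case: ji; apply: val_inj.
  (* An index outside the environment evaluates to the default 0 and meets no j of the sum. *)
  rewrite nth_default// big1// => j _; case: eqP => [ij|]; last by rewrite mulr0z.
  by move: (ltn_ord j); rewrite -ij ltnNge ige.
- by rewrite big1// => j _; rewrite mulr0z.
- by rewrite IH1 IH2 -big_split /=; apply: eq_bigr => j _; rewrite mulrzDr.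
- by rewrite IH1 -sumrN; apply: eq_bigr => j _; rewrite mulrNz.
- by rewrite IH1 -sumrMnl; apply: eq_bigr => j _; rewrite mulrzA.
Qed.

Lemma zmod_eq env t1 t2 :
  all (fun j => zcoef t1 j == zcoef t2 j) (iota 0 (size env)) ->
  zeval env t1 = zeval env t2.
Proof.
move=> /allP H; rewrite !zeval_coef; apply: eq_bigr => j _.
by rewrite (eqP (H _ _))// mem_iota add0n ltn_ord.
Qed.

End Zmod.

(* Atoms are compared without looking at the algebraic structures they mention, since
   convertible structures may differ syntactically. *)
Ltac zsame x y := lazymatch x with
  | @GRing.mul _ ?a ?b => lazymatch y with @GRing.mul _ ?c ?d => zsame a c; zsame b d end
  | @GRing.scale _ _ ?a ?b =>
      lazymatch y with @GRing.scale _ _ ?c ?d => zsame a c; zsame b d end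
  | @real_complex_def _ _ ?a =>
      lazymatch y with @real_complex_def _ _ ?c => first [constr_eq a c | unify a c] end
  | @GRing.exp _ ?a ?n =>
      lazymatch y with @GRing.exp _ ?c ?m => constr_eq n m; zsame a c end
  | @GRing.one _ => lazymatch y with @GRing.one _ => idtac end
  | @Algebra.add _ ?a ?b => lazymatch y with @Algebra.add _ ?c ?d => zsame a c; zsame b d end
  | @Algebra.opp _ ?a => lazymatch y with @Algebra.opp _ ?c => zsame a c end
  | _ => constr_eq x y end.
Ltac zidx x env := lazymatch env with
  | cons ?y ?e => match constr:(tt) with
    | _ => let _ := match constr:(tt) with _ => zsame x y end in constr:(O)
    | _ => let n := zidx x e in constr:(S n) end end.
Ltac zatom x env := match constr:(tt) with
  | _ => let _ := zidx x env in env
  | _ => constr:(cons x env) end.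
Ltac zatoms t env := lazymatch t with
  | @Algebra.add _ ?a ?b => let env := zatoms a env in zatoms b env
  | @Algebra.opp _ ?a => zatoms a env
  | @Algebra.zero _ => env
  | @Algebra.natmul _ ?a _ => zatoms a env
  | _ => zatom t env end.
Ltac zreify t env := lazymatch t with
  | @Algebra.add _ ?a ?b => let a := zreify a env in let b := zreify b env in constr:(ZAdd a b)
  | @Algebra.opp _ ?a => let a := zreify a env in constr:(ZOpp a)
  | @Algebra.zero _ => constr:(ZZero)
  | @Algebra.natmul _ ?a ?n => let a := zreify a env in constr:(ZMuln a n)
  | _ => let n := zidx t env in constr:(ZAtom n) end.
Ltac zmod := lazymatch goal with |- @eq ?T ?a ?b =>
  let env := zatoms a (@nil T) in let env := zatoms b env in
  let ra := zreify a env in let rb := zreify b env in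
  exact: (@zmod_eq _ env ra rb isT) end.

Lemma null_seq_small (R : realType) (V : completeNormedModType R[i]) (x : V)
    (C : R) (d : nat -> R) :
  null_seq d -> 0 <= C -> (forall n, rnorm x <= C * d n) -> x = 0.
Proof.
move=> d0 C0 H; apply: rnorm_small => e e0.
have C1 : 0 < C + 1 by rewrite ltr_wpDl.
have [n dn] := d0 _ (divr_gt0 e0 C1).
apply: le_trans (H n) _; apply: (@le_trans _ _ (C * (e / (C + 1)))).
  by rewrite ler_wpM2l// ltW.
by rewrite mulrCA ler_piMr ?(ltW e0)// ler_pdivrMr// mul1r lerDl.
Qed.

(** * Norm and arithmetic of C*-algebras *)

Section CStarNorm.
Context {R : realType} {A : completeNormedModType R[i]} (cA : cstar A).
Implicit Types a b c : A.

Lemma rnormM a b : rnorm (cmul cA a b) <= rnorm a * rnorm b.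
Proof. by rewrite -lecR rmorphM /= !rnormE cnormM. Qed.

Lemma rnorm_adjM a : rnorm (cmul cA (cadj cA a) a) = rnorm a ^+ 2.
Proof. by apply: complexI; rewrite rmorphXn /= !rnormE cnorm_adjM. Qed.

Lemma rnorm_adj a : rnorm (cadj cA a) = rnorm a.
Proof. by rewrite /rnorm cnorm_adj. Qed.

Lemma cmulDl a b c : cmul cA (a + b) c = cmul cA a c + cmul cA b c.
Proof. by rewrite -[a]scale1r cmul_linl !scale1r. Qed.

Lemma cmulDr a b c : cmul cA a (b + c) = cmul cA a b + cmul cA a c.
Proof. by rewrite -[b]scale1r cmul_linr !scale1r. Qed.

Lemma cmulBr a b c : cmul cA a (b - c) = cmul cA a b - cmul cA a c.
Proof. by rewrite -scaleN1r addrC cmul_linr scaleN1r addrC. Qed.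

Lemma cmul0r a : cmul cA a 0 = 0.
Proof. by rewrite -(subrr a) cmulBr !subrr. Qed.

Lemma cmulZl k a b : cmul cA (k *: a) b = k *: cmul cA a b.
Proof. by rewrite -[k *: a]addr0 cmul_linl cmul0l addr0. Qed.

Lemma cmulZr k a b : cmul cA a (k *: b) = k *: cmul cA a b.
Proof. by rewrite -[k *: b]addr0 cmul_linr cmul0r addr0. Qed.

Lemma cmulNl a b : cmul cA (- a) b = - cmul cA a b.
Proof. by rewrite -[- a]sub0r cmulBl cmul0l sub0r. Qed.

Lemma cadjD a b : cadj cA (a + b) = cadj cA a + cadj cA b.
Proof. by rewrite -[a]scale1r cadj_lin rmorph1 !scale1r. Qed.

Lemma cadjZ k a : cadj cA (k *: a) = k^* *: cadj cA a.
Proof. by rewrite -[k *: a]addr0 cadj_lin cadj0 addr0. Qed.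

Lemma cadjN a : cadj cA (- a) = - cadj cA a.
Proof. by rewrite -[- a]sub0r cadjB cadj0 sub0r. Qed.

Lemma conj_real (r : R) : (r%:C%C)^* = r%:C%C.
Proof. by rewrite conj_Creal// complex_real. Qed.

Lemma cadjZr (r : R) a : cadj cA (r%:C%C *: a) = r%:C%C *: cadj cA a.
Proof. by rewrite cadjZ conj_real. Qed.

Definition cunit (e : A) := (forall a, cmul cA e a = a) /\ (forall a, cmul cA a e = a).

(** An alias whose phantom argument [eP] lets the product of [cA] be a canonical ring structure. *)
Definition ualg (e : A) (eP : cunit e) : Type := A.

End CStarNorm.

Section Unital.
Context {R : realType} {A : completeNormedModType R[i]} {cA : cstar A}.
Context {e : A} (eP : cunit cA e).
Notation U := (ualg eP).

HB.instance Definition _ := CompleteNormedModule.on U.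
HB.instance Definition _ := GRing.Zmodule_isPzRing.Build U
  (@cmulA _ _ cA) (proj1 eP) (proj2 eP) (@cmulDl _ _ cA) (fun a b c => @cmulDr _ _ cA a b c).

End Unital.

(** * Square roots and positivity *)

Section SqrtSequence.
Variable R : realType.

(* The iteration y' = (x + y^2) / 2 started at 0 for x = 1; for |x| <= 1 it dominates the steps of
   the same iteration in a C*-algebra, whose limit is y = 1 - sqrt (1 - x). *)
Fixpoint sqrt_mod (n : nat) : R := if n is m.+1 then (1 + sqrt_mod m ^+ 2) / 2 else 0.

Lemma sqrt_mod_ge0 n : 0 <= sqrt_mod n.
Proof. by case: n => //= n; rewrite divr_ge0// addr_ge0// sqr_ge0. Qed.

(** The defect D = 1 - r satisfies D' = D - D^2 / 2, a recursion whose solutions decay like 2 /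
    n. *)
Lemma sqrt_mod_le n : 1 - sqrt_mod n <= 2 / (n%:R + 2) /\ sqrt_mod n <= 1.
Proof.
elim: n => [|n [IH1 IH2]] /=; first by rewrite add0r divff ?pnatr_eq0 ?subr0.
have r0 := sqrt_mod_ge0 n; set r := sqrt_mod n in r0 IH1 IH2 *.
split; last by nra.
have -> : 1 - (1 + r ^+ 2) / 2 = (1 - r) - (1 - r) ^+ 2 / 2 by field.
have n0 : 0 <= n%:R :> R by rewrite ler0n.
set D := 2 / (n%:R + 2) in IH1.
have D1 : D <= 1 by rewrite ler_pdivrMr; lra.
have D0 : 0 <= D by apply: divr_ge0; lra.
(* Since D - D^2 / 2 increases on [0, 1], it is enough to treat D = 2 / (n + 2), where the claim is
   (n + 1)(n + 3) <= (n + 2)^2. *)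
have h : D - D ^+ 2 / 2 <= 2 / (n.+1%:R + 2).
  have -> : D - D ^+ 2 / 2 = 2 * (n%:R + 1) / (n%:R + 2) ^+ 2.
    by rewrite /D; field; lra.
  rewrite -natr1 ler_pdivrMr; last by apply: exprn_gt0; lra.
  rewrite mulrAC ler_pdivlMr; last lra.
  nra.
apply: le_trans h; nra.
Qed.

Lemma sqrt_mod_lim : null_seq (fun n => 1 - sqrt_mod n).
Proof.
move=> e e0; exists (2 * Num.bound e^-1)%N.
apply: le_lt_trans (sqrt_mod_le _).1 _.
have b : e^-1 < (Num.bound e^-1)%:R by apply: archi_boundP; rewrite invr_ge0 ltW.
have : 1 < e * (Num.bound e^-1)%:R by rewrite mulrC -ltr_pdivrMr// div1r.
rewrite natrM => h; have b0 : 0 <= (Num.bound e^-1)%:R :> R by rewrite ler0n.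
rewrite ltr_pdivrMr; nra.
Qed.

(** If a = 1 + d with d > 0, two Bernoulli bounds make a^(2n) at least (1 + n d)^2, which outgrows
    any linear bound. *)
Lemma expr2_growth_le1 (a C : R) : 0 <= a ->
  (forall k, a ^+ (2 ^ k) <= 1 + (2 ^ k)%:R * C) -> a <= 1.
Proof.
move=> a0 H; rewrite leNgt; apply/negP => a1.
pose d := a - 1; have d0 : 0 < d by rewrite /d; lra.
have bern n : 1 + n%:R * d <= a ^+ n.
  elim: n => [|n IH]; first by rewrite mul0r addr0 expr0.
  rewrite exprS -natr1; have n0 : 0 <= n%:R :> R by rewrite ler0n.
  have -> : a = 1 + d by rewrite /d; lra.
  move: IH; have -> : a = 1 + d by rewrite /d; lra.
  move=> IH; apply: le_trans (ler_wpM2l _ IH); last lra.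
  have : 0 <= n%:R * d * d by rewrite !mulr_ge0// ltW.
  nra.
pose k := Num.bound ((1 + 2 * `|C|) / d ^+ 2); pose n := (2 ^ k)%N.
have n0 : 0 < n%:R :> R by rewrite ltr0n expn_gt0.
have nb : (1 + 2 * `|C|) / d ^+ 2 < n%:R.
  apply: lt_trans (archi_boundP _) _; last by rewrite ltr_nat ltn_expl.
  by rewrite divr_ge0 ?sqr_ge0// addr_ge0// mulr_ge0.
have n1 : 1 <= n%:R :> R by rewrite ler1n expn_gt0.
move: nb; rewrite ltr_pdivrMr ?exprn_gt0// => nb.
(* The exponent 2^(k+1) = n + n provides the square of a^n. *)
have := H k.+1; rewrite expnS mul2n -addnn -/n exprD natrD => h.
have := bern n => b; have C0 := ler_norm C.
have nd : 0 < n%:R * d by rewrite mulr_gt0.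
have h2 : (1 + n%:R * d) ^+ 2 <= 1 + (n%:R + n%:R) * C.
  apply: le_trans h; rewrite expr2; apply: ler_pM => //; lra.
have h3 : n%:R * (1 + 2 * `|C|) < n%:R * (n%:R * d ^+ 2) by rewrite ltr_pM2l.
have h4 : n%:R * C <= n%:R * `|C| by rewrite ler_pM2l.
have e1 : n%:R * (n%:R * d ^+ 2) = (n%:R * d) ^+ 2 by ring.
rewrite e1 in h3; nra.
Qed.

Lemma ler_of_sqr (a b : R) : 0 <= b -> a ^+ 2 <= b ^+ 2 -> a <= b.
Proof. by move=> b0 h; rewrite leNgt; apply/negP => ba; nra. Qed.

End SqrtSequence.

Section UnitalSqrt.
Context {R : realType} {A : completeNormedModType R[i]} {cA : cstar A}.
Context {e : A} (eP : cunit cA e).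
Notation U := (ualg eP).
Implicit Types x y a b c h k : U.

Definition st x : U := cadj cA x.

Lemma stD x y : st (x + y) = st x + st y. Proof. exact: (@cadjD _ _ cA x y). Qed.
Lemma stN x : st (- x) = - st x. Proof. exact: (@cadjN _ _ cA x). Qed.
Lemma stB x y : st (x - y) = st x - st y. Proof. by rewrite stD stN. Qed.
Lemma stM x y : st (x * y) = st y * st x. Proof. exact: (@cadjM _ _ cA x y). Qed.
Lemma stK x : st (st x) = x. Proof. exact: (@cadjK _ _ cA x). Qed.
Lemma stZ (k : R[i]) x : st (k *: x) = k^* *: st x. Proof. exact: (@cadjZ _ _ cA k x). Qed.
Lemma stZr (r : R) x : st (r%:C%C *: x) = r%:C%C *: st x.
Proof. exact: (@cadjZr _ _ cA r x). Qed.
Lemma st1 : st 1 = 1.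
Proof. by rewrite -[LHS]mulr1 -[X in _ * X]stK -stM mulr1 stK. Qed.
Lemma stX x n : st (x ^+ n) = st x ^+ n.
Proof. by elim: n => [|n IH]; rewrite ?st1// exprS stM IH -exprSr. Qed.

Lemma scalAl (k : R[i]) x y : (k *: x) * y = k *: (x * y). Proof. exact: (@cmulZl _ _ cA k x y). Qed.
Lemma scalAr (k : R[i]) x y : x * (k *: y) = k *: (x * y). Proof. exact: (@cmulZr _ _ cA k x y). Qed.

Lemma normUM x y : rnorm (x * y) <= rnorm x * rnorm y. Proof. exact: (@rnormM _ _ cA x y). Qed.
Lemma normU_st x : rnorm (st x) = rnorm x. Proof. exact: (@rnorm_adj _ _ cA x). Qed.
Lemma normU_stM x : rnorm (st x * x) = rnorm x ^+ 2. Proof. exact: (@rnorm_adjM _ _ cA x). Qed.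
Lemma normU_sq x : st x = x -> rnorm (x * x) = rnorm x ^+ 2.
Proof. by move=> {1}<-; exact: normU_stM. Qed.

Lemma normU1 : rnorm (1 : U) <= 1.
Proof.
have := normU_sq st1; rewrite mulr1 => h; have := rnorm_ge0 (1 : U); nra.
Qed.

Lemma normUX x n (r : R) : 0 <= r -> rnorm x <= r -> rnorm (x ^+ n) <= r ^+ n.
Proof.
move=> r0 xr; elim: n => [|n IH]; first exact: normU1.
rewrite !exprS; apply: le_trans (normUM _ _) _.
by apply: ler_pM => //; exact: rnorm_ge0.
Qed.

Lemma normUX1 x n : rnorm x <= 1 -> rnorm (x ^+ n) <= 1.
Proof. by move=> x1; have := normUX n ler01 x1; rewrite expr1n. Qed.

Lemma normUM1 x y : rnorm x <= 1 -> rnorm y <= 1 -> rnorm (x * y) <= 1.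
Proof.
move=> x1 y1; apply: le_trans (normUM _ _) _.
have := rnorm_ge0 x; have := rnorm_ge0 y; nra.
Qed.

Lemma normUMn x n : rnorm (x *+ n) = n%:R * rnorm x.
Proof.
rewrite -scaler_nat; have -> : (n%:R : R[i]) = (n%:R)%:C%C by rewrite rmorph_nat.
by rewrite rnormZr// ler0n.
Qed.

Fixpoint sqrt_iter x (n : nat) : U :=
  if n is m.+1 then (2^-1)%:C%C *: (x + sqrt_iter x m * sqrt_iter x m) else 0.

Section Iter.
Variable x : U.
Hypothesis x1 : rnorm x <= 1.
Notation y := (sqrt_iter x).
Notation r := (@sqrt_mod R).

Lemma sqrt_iter_norm n : rnorm (y n) <= r n.
Proof.
elim: n => [|n IH] /=; first by rewrite rnorm0.
rewrite rnormZr ?invr_ge0// mulrC ler_wpM2r ?invr_ge0//.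
apply: le_trans (rnormD _ _) _; apply: lerD => //.
apply: le_trans (normUM _ _) _; rewrite expr2.
by apply: ler_pM => //; exact: rnorm_ge0.
Qed.

Lemma sqrt_iter_comm c n : c * x = x * c -> c * y n = y n * c.
Proof.
move=> cx; elim: n => [|n IH] /=; first by rewrite mulr0 mul0r.
rewrite scalAl scalAr; congr (_ *: _).
by rewrite mulrDr mulrDl cx mulrA IH -mulrA IH mulrA.
Qed.

(** Since the iterates commute, each step is half the product of the previous step and the sum of
    the two iterates; the scalar iteration obeys the same identity, with equality. *)
Lemma sqrt_iter_step n : rnorm (y n.+1 - y n) <= r n.+1 - r n.
Proof.
elim: n => [|n IH].
  rewrite /= mulr0 addr0 !subr0 expr0n /= addr0 rnormZr ?invr_ge0// mulrC.
  by rewrite ler_wpM2r ?invr_ge0.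
have -> : y n.+2 - y n.+1 = (2^-1)%:C%C *: ((y n.+1 - y n) * (y n.+1 + y n)).
  have yS m : y m.+1 = (2^-1)%:C%C *: (x + y m * y m) by [].
  rewrite (yS n.+1) [X in _ - X = _](yS n) -scalerBr; congr (_ *: _).
  have yc : y n.+1 * y n = y n * y n.+1.
    by apply: sqrt_iter_comm; symmetry; apply: sqrt_iter_comm.
  by rewrite mulrDr !mulrDl !mulNr yc; zmod.
rewrite rnormZr ?invr_ge0//.
have -> : r n.+2 - r n.+1 = 2^-1 * ((r n.+1 - r n) * (r n.+1 + r n)).
  have rS m : r m.+1 = (1 + r m ^+ 2) / 2 by [].
  by rewrite (rS n.+1) [X in _ - X = _](rS n); field.
rewrite ler_wpM2l ?invr_ge0//.
apply: le_trans (normUM _ _) _; apply: ler_pM => //; rewrite ?rnorm_ge0//.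
apply: le_trans (rnormD _ _) _; apply: lerD; exact: sqrt_iter_norm.
Qed.

Lemma sqrt_iter_diff n m : (n <= m)%N -> rnorm (y n - y m) <= 1 - r n.
Proof.
move=> nm; apply: (@le_trans _ _ (r m - r n)); last first.
  by rewrite lerD2r; have [] := sqrt_mod_le R m.
rewrite -(subnKC nm); elim: (m - n)%N => [|k IH].
  by rewrite addn0 !subrr rnorm0.
rewrite addnS; apply: le_trans (rnorm_dist3 _ (y (n + k)%N) _) _.
have := sqrt_iter_step (n + k); rewrite (rdistC (y (n + k).+1)); lra.
Qed.

Lemma sqrt_one_sub : st x = x -> exists s : U,
  [/\ st s = s, s * s = 1 - x, rnorm (1 - s) <= 1
    & forall c, c * x = x * c -> c * s = s * c].
Proof.
move=> xs.
have [l ly] := rnorm_complete (@sqrt_mod_lim R) sqrt_iter_diff.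
pose d n : R := 1 - r n; have d0 : null_seq d by exact: sqrt_mod_lim.
have dge n : 0 <= d n by rewrite subr_ge0; have [] := sqrt_mod_le R n.
have yst n : st (y n) = y n.
  elim: n => [|n IH] /=; first by rewrite /st cadj0.
  by rewrite stZr stD stM IH xs.
have yn1 n : rnorm (y n) <= 1.
  by apply: le_trans (sqrt_iter_norm n) _; have [] := sqrt_mod_le R n.
have ls : st l = l.
  apply/eqP; rewrite -subr_eq0; apply/eqP.
  apply: (null_seq_small (C := 2) d0) => // n.
  rewrite -(subrKA (y n)) -{1}(yst n) -stB.
  apply: le_trans (rnormD _ _) _; rewrite normU_st rdistC.
  have := ly n; rewrite -/(d n); lra.
have lc c : c * x = x * c -> c * l = l * c.
  move=> cx; apply/eqP; rewrite -subr_eq0; apply/eqP.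
  apply: (null_seq_small (C := 2 * rnorm c) d0) => [|n].
    by rewrite mulr_ge0// rnorm_ge0.
  have -> : c * l - l * c = (y n - l) * c - c * (y n - l).
    by rewrite mulrBr mulrBl sqrt_iter_comm//; zmod.
  apply: le_trans (rnormB _ _) _.
  have h1 := normUM (y n - l) c; have h2 := normUM c (y n - l).
  have := ler_wpM2r (rnorm_ge0 c) (ly n); rewrite -/(d n); lra.
(* The fixed point equation of the limit; it makes s = 1 - l a root of 1 - x. *)
have le1 : 2%:C%C *: l = x + l * l.
  apply/eqP; rewrite -subr_eq0; apply/eqP.
  apply: (null_seq_small (C := 2 + (1 + rnorm l)) d0) => [|n].
    by have := rnorm_ge0 l; lra.
  have -> : 2%:C%C *: l - (x + l * l) =
     (l - y n) * (- y n - l) - 2%:C%C *: (y n.+1 - l).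
    have -> : 2%:C%C *: (y n.+1 - l) = x + y n * y n - 2%:C%C *: l.
      by rewrite scalerBr /= scalerA -rmorphM /= divff ?pnatr_eq0// scale1r.
    have yl : y n * l = l * y n by apply/lc; rewrite sqrt_iter_comm.
    by rewrite mulrBl !mulrBr !mulrN yl; zmod.
  apply: le_trans (rnormB _ _) _; rewrite rnormZr//.
  have h1 := normUM (l - y n) (- y n - l).
  have h2 : rnorm (- y n - l) <= 1 + rnorm l.
    by apply: le_trans (rnormB _ _) _; rewrite rnormN lerD2r.
  have h3 := ly n.+1; rewrite -/(d _) in h3.
  have dd : d n.+1 <= d n.
    by rewrite lerD2l lerN2; have := sqrt_iter_step n; have := rnorm_ge0 (y n.+1 - y n); lra.
  have h4 := ly n; rewrite rdistC -/(d _) in h4.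
  have := ler_pM (rnorm_ge0 _) (rnorm_ge0 _) h4 h2; lra.
exists (1 - l); split; first by rewrite stB st1 ls.
  rewrite mulrBl !mulrBr !mul1r !mulr1.
  move: le1; rewrite (_ : 2%:C%C = 1 + 1); last by rewrite rmorphD.
  rewrite scalerDl scale1r => /(congr1 (fun z => z - l * l)); rewrite addrK => <-.
  by zmod.
  (* The iteration starts at 0, so its modulus at n = 0 bounds the norm of the limit by 1. *)
  have := ly 0%N; rewrite /= subr0 sub0r rnormN; by have -> : 1 - (1 - l) = l by zmod.
by move=> c cx; rewrite mulrBr mulrBl mulr1 mul1r lc.
Qed.

End Iter.
End UnitalSqrt.

Section Positive.
Context {R : realType} {A : completeNormedModType R[i]} {cA : cstar A}.
Context {e : A} (eP : cunit cA e).
Notation U := (ualg eP).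
Notation st := (@st R A cA e eP).
Notation "r %:U" := (r%:C%C *: (1 : U)) (at level 2, format "r %:U").
Implicit Types x y a b c h k : U.

(* [u = k + i sqrt (1 - k^2)] is unitary, and [2 k^2 - 1] is the real part of [u^2]. *)
Lemma norm_one_sub_sq2 k : st k = k -> rnorm k <= 1 -> rnorm (1 - (k * k) *+ 2) <= 1.
Proof.
move=> ks k1.
have [||s [ss s2 s1 sc]] := @sqrt_one_sub _ _ _ _ eP (k * k).
- exact: normUM1.
- by rewrite stM ks.
have ksc : k * s = s * k by apply: sc; rewrite mulrA.
pose u : U := k + 'i *: s; pose v : U := k - 'i *: s.
have uv : st u = v by rewrite /u /v stD stZ conjCi ks ss scaleNr.
have ii : ('i : R[i]) * 'i = -1 by rewrite -expr2 sqrCi.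
have vu1 : v * u = 1.
  rewrite /u /v mulrDr !mulrBl !scalAl !scalAr scalerA ii scaleN1r ksc s2.
  by zmod.
have nu : rnorm u <= 1.
  have := normU_stM u; rewrite uv vu1 => h; have := normU1 eP; have := rnorm_ge0 u; nra.
have nv : rnorm v <= 1 by rewrite -uv normU_st.
have h : (1 - (k * k) *+ 2) *+ 2 = - (u * u + v * v).
  rewrite /u /v !mulrDr !mulrDl !(mulNr, mulrN) !scalAl !scalAr !scalerA ii !scaleN1r ksc s2.
  by zmod.
have := normUMn (1 - (k * k) *+ 2) 2; rewrite h rnormN => h2.
have := rnormD (u * u) (v * v); have := normUM1 nu nu; have := normUM1 nv nv; lra.
Qed.

Definition pos h := exists2 k : U, st k = k & h = k * k.

Lemma pos_st h : pos h -> st h = h.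
Proof. by move=> [k ks ->]; rewrite stM ks. Qed.

Lemma pos_sq k : st k = k -> pos (k * k).
Proof. by exists k. Qed.

Lemma scal_real (V : lmodType R[i]) (r s : R) (x : V) : r%:C%C *: (s%:C%C *: x) = (r * s)%:C%C *: x.
Proof. by rewrite scalerA -rmorphM. Qed.

Lemma mul_sqrtr (r : R) : 0 <= r -> Num.sqrt r * Num.sqrt r = r.
Proof. by move=> r0; rewrite -expr2 sqr_sqrtr. Qed.

Lemma posZ (r : R) h : 0 <= r -> pos h -> pos (r%:C%C *: h).
Proof.
move=> r0 [k ks ->]; exists ((Num.sqrt r)%:C%C *: k); first by rewrite stZr ks.
by rewrite scalAl scalAr scal_real mul_sqrtr.
Qed.

(** The root of h divided by sqrt t is a contraction, to which [norm_one_sub_sq2] applies. The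
    factor 2 is sharp and is what [pos_norm_le] uses. *)
Lemma norm_of_pos2 h (t : R) : pos h -> rnorm h <= t -> rnorm (t%:U - h *+ 2) <= t.
Proof.
move=> [k ks ->]; rewrite normU_sq// => kt.
have [t0|t0] := leP t 0.
  have k0 : k = 0 by apply: rnorm_eq0; have := rnorm_ge0 k; nra.
  have t00 : t = 0 by have := rnorm_ge0 k; nra.
  by rewrite k0 t00 mul0r mul0rn subr0 scale0r rnorm0.
pose q := Num.sqrt t; have q0 : 0 < q by rewrite sqrtr_gt0.
have qq : q * q = t by rewrite -expr2 sqr_sqrtr// ltW.
pose l : U := (q^-1)%:C%C *: k.
have ls : st l = l by rewrite /l stZr ks.
have l1 : rnorm l <= 1.
  rewrite rnormZr ?invr_ge0 ?(ltW q0)// mulrC ler_pdivrMr// mul1r.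
  have := rnorm_ge0 k; nra.
have kl : k = q%:C%C *: l by rewrite /l scal_real divff ?gt_eqF// scale1r.
have -> : t%:U - (k * k) *+ 2 = t%:C%C *: (1 - (l * l) *+ 2).
  by rewrite kl scalAl scalAr scal_real qq scalerBr -scalerMnr.
rewrite rnormZr ?(ltW t0)// ler_piMr ?(ltW t0)//; exact: norm_one_sub_sq2.
Qed.

Lemma rnorm_realU (t : R) : 0 <= t -> rnorm (t%:U) <= t.
Proof. by move=> t0; rewrite rnormZr// ler_piMr// normU1. Qed.

Lemma norm_of_pos h (t : R) : pos h -> rnorm h <= t -> rnorm (t%:U - h) <= t.
Proof.
move=> ph ht; have t0 : 0 <= t by apply: le_trans ht; exact: rnorm_ge0.
have := normUMn (t%:U - h) 2.
(* t - h is the mean of t - 2 h and t. *)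
have -> : (t%:U - h) *+ 2 = (t%:U - h *+ 2) + t%:U by zmod.
have := rnormD (t%:U - h *+ 2) t%:U; have := norm_of_pos2 ph ht.
have := rnorm_realU t0; lra.
Qed.

(** Write h = t (1 - x) with x = 1 - h / t a contraction. The bound on k is the positivity criterion
    at sqrt t, so the root is itself positive. *)
Lemma pos_of_norm_comm h (t : R) : st h = h -> 0 <= t -> rnorm (t%:U - h) <= t ->
  exists k : U, [/\ st k = k, h = k * k, rnorm ((Num.sqrt t)%:U - k) <= Num.sqrt t
    & forall c, c * h = h * c -> c * k = k * c].
Proof.
rewrite le_eqVlt => hs /predU1P[<-|t0].
  rewrite scale0r sub0r rnormN => h0; exists 0; split.
  - by rewrite /st cadj0.
  - by rewrite mulr0; apply: rnorm_eq0; apply/eqP; rewrite eq_le h0 rnorm_ge0.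
  - by rewrite sqrtr0 scale0r subrr rnorm0.
  - by move=> c _; rewrite mulr0 mul0r.
pose x : U := (t^-1)%:C%C *: (t%:U - h).
move=> ht; have [||s [ss s2 s1 sc]] := @sqrt_one_sub _ _ _ _ eP x.
- by rewrite rnormZr ?invr_ge0 ?(ltW t0)// mulrC ler_pdivrMr// mul1r.
- by rewrite /x stZr stB stZr st1 hs.
have hx : h = t%:C%C *: (1 - x).
  by rewrite /x scalerBr scal_real divff ?gt_eqF// scale1r; zmod.
exists ((Num.sqrt t)%:C%C *: s); split.
- by rewrite stZr ss.
- by rewrite scalAl scalAr scal_real mul_sqrtr ?(ltW t0)// s2.
- by rewrite -scalerBr rnormZr ?sqrtr_ge0// ler_piMr ?sqrtr_ge0.
move=> c ch; rewrite scalAr scalAl sc// /x scalAr scalAl mulrBr mulrBl ch.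
by rewrite scalAr scalAl mulr1 mul1r.
Qed.

Lemma pos_of_norm h (t : R) : st h = h -> 0 <= t -> rnorm (t%:U - h) <= t -> pos h.
Proof. by move=> hs t0 ht; have [k [ks hk _ _]] := pos_of_norm_comm hs t0 ht; exists k. Qed.

Lemma pos_sqrt_comm h : pos h ->
  exists k : U, [/\ pos k, h = k * k & forall c, c * h = h * c -> c * k = k * c].
Proof.
move=> ph; have := norm_of_pos ph (lexx _).
move=> /(pos_of_norm_comm (pos_st ph) (rnorm_ge0 h))[k [ks hk kn kc]].
by exists k; split => //; exact: pos_of_norm (sqrtr_ge0 _) kn.
Qed.

Lemma posD x y : pos x -> pos y -> pos (x + y).
Proof.
move=> px py; apply: (@pos_of_norm _ (rnorm x + rnorm y)).
- by rewrite stD !pos_st.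
- by rewrite addr_ge0 ?rnorm_ge0.
(* The criterion is additive in h and t together, so the triangle inequality suffices. *)
have -> : (rnorm x + rnorm y)%:U - (x + y) = ((rnorm x)%:U - x) + ((rnorm y)%:U - y).
  by rewrite rmorphD /= scalerDl; zmod.
apply: le_trans (rnormD _ _) _; apply: lerD; exact: norm_of_pos.
Qed.

(** With t = |h|, both t + h and t - h have norm at most t, and the difference of their squares is 4
    t h; hence 4 t^2 <= 2 t^2. *)
Lemma pos_anti h : pos h -> pos (- h) -> h = 0.
Proof.
move=> ph pn; apply: rnorm_eq0; pose t := rnorm h.
have t0 : 0 <= t := rnorm_ge0 h.
have h1 := norm_of_pos ph (lexx t).
have h2 : rnorm (t%:U - - h) <= t by apply: norm_of_pos => //; rewrite rnormN.
set a : U := t%:U - - h in h2; set b : U := t%:U - h in h1.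
have e1 : a * a - b * b = (t%:C%C *: h) *+ 4.
  rewrite /a /b !mulrBr !mulrBl !scalAl !scalAr !mul1r !mulr1 !mulNr !mulrN !scalerN.
  by zmod.
have := normUMn (t%:C%C *: h) 4; rewrite -e1 rnormZr// -/t => e2.
have := rnormB (a * a) (b * b); have := normUM a a; have := normUM b b.
have := rnorm_ge0 a; have := rnorm_ge0 b; nra.
Qed.

(** With s = |x|, r = |t - x| and T = r + t, the criterion gives |x + r| <= T and |s - 2 x| <= s.
    The combination s (x + r) - r (s - 2 x) = (2 r + s) x then forces s <= t. *)
Lemma pos_norm_le x (t : R) : 0 <= t -> pos x -> pos (t%:U - x) -> rnorm x <= t.
Proof.
move=> t0 px py; pose s := rnorm x.
have s0 : 0 <= s := rnorm_ge0 x.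
have h1 := norm_of_pos2 px (lexx s).
pose T := rnorm (t%:U - x) + t; pose r := T - t.
have r0 : 0 <= r by rewrite /r /T addrK rnorm_ge0.
have T0 : 0 <= T by rewrite /T addr_ge0 ?rnorm_ge0.
have h2 : rnorm (x + r%:U) <= T.
  have -> : x + r%:U = T%:U - (t%:U - x).
    by rewrite /r rmorphB /= scalerBl; zmod.
  by apply: norm_of_pos => //; rewrite /T lerDl.
rewrite leNgt; apply/negP; rewrite -/s => ts.
have h3 : (2 * (r * s) + s * s) <= r * s + s * T.
  have <- : rnorm ((2 * r + s)%:C%C *: x) = 2 * (r * s) + s * s.
    rewrite rnormZr; last lra.
    by rewrite -/s; ring.
  have -> : (2 * r + s)%:C%C *: x = s%:C%C *: (x + r%:U) - r%:C%C *: (s%:U - x *+ 2).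
    have -> : 2 * r + s = r + r + s by ring.
    rewrite scalerDr scalerBr !scal_real [s * r]mulrC -scalerMnr !rmorphD /= !scalerDl.
    by zmod.
  apply: le_trans (rnormB _ _) _; rewrite !rnormZr// addrC; apply: lerD.
    by rewrite ler_wpM2l.
  by rewrite ler_wpM2l.
rewrite /r in h3; nra.
Qed.

Lemma pos_sub_norm y : pos y -> pos ((rnorm y)%:U - y).
Proof.
move=> py; apply: (@pos_of_norm _ (rnorm y)); first by rewrite stB stZr st1 pos_st.
  exact: rnorm_ge0.
by have -> : (rnorm y)%:U - ((rnorm y)%:U - y) = y by zmod.
Qed.

Lemma pos_mono x y : pos x -> pos (y - x) -> rnorm x <= rnorm y.
Proof.
move=> px pyx; have py : pos y by rewrite -[y](subrK x); exact: posD.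
apply: pos_norm_le => //; first exact: rnorm_ge0.
have -> : (rnorm y)%:U - x = ((rnorm y)%:U - y) + (y - x) by zmod.
by apply: posD => //; exact: pos_sub_norm.
Qed.

(** This stands in for the equality of the nonzero spectra of c^* c and c c^*. By q c = c p the
    powers of q grow at most linearly, while |q|^(2^k) = |q^(2^k)| for self-adjoint q. *)
Lemma norm_one_add_swap c : rnorm (1 + st c * c) <= 1 -> rnorm (1 + c * st c) <= 1.
Proof.
set p : U := 1 + st c * c; set q : U := 1 + c * st c => p1.
have qs : st q = q by rewrite /q stD st1 stM stK.
have qc n : q ^+ n * c = c * p ^+ n.
  elim: n => [|n IH]; first by rewrite !expr0 mul1r mulr1.
  rewrite exprSr -mulrA (_ : q * c = c * p).
    by rewrite mulrA IH -mulrA -exprSr.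
  by rewrite /q /p mulrDl mulrDr mul1r mulr1 mulrA.
have qn n : rnorm (q ^+ n) <= 1 + n%:R * rnorm c ^+ 2.
  elim: n => [|n IH]; first by rewrite expr0 mul0r addr0 normU1.
  have -> : q ^+ n.+1 = q ^+ n + c * p ^+ n * st c.
    by rewrite exprSr {2}/q mulrDr mulr1 mulrA qc.
  apply: le_trans (rnormD _ _) _; rewrite -natr1.
  have h1 := normUM (c * p ^+ n) (st c); have h2 := normUM c (p ^+ n).
  have h3 := normUX1 n p1; rewrite normU_st in h1; have c0 := rnorm_ge0 c.
  have : rnorm (c * p ^+ n) * rnorm c <= rnorm c * 1 * rnorm c.
    by rewrite ler_wpM2r//; apply: le_trans h2 _; rewrite ler_wpM2l.
  by rewrite mulr1 => h4; rewrite mulrDl mul1r expr2; lra.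
have q2 (k : nat) : rnorm q ^+ (2 ^ k) = rnorm (q ^+ (2 ^ k)).
  elim: k => [|k IH]; first by rewrite expr1.
  rewrite expnS mul2n -addnn !exprD IH normU_sq ?expr2// stX qs//.
apply: (@expr2_growth_le1 _ _ (rnorm c ^+ 2)); first exact: rnorm_ge0.
by move=> k; rewrite q2.
Qed.

Lemma posMn h n : pos h -> pos (h *+ n).
Proof.
move=> ph; elim: n => [|n IH]; last by rewrite mulrS; exact: posD.
by rewrite mulr0n; exists 0; rewrite ?mulr0// /st cadj0.
Qed.

Lemma sq_eq0 k : st k = k -> k * k = 0 -> k = 0.
Proof.
move=> ks kk; apply: rnorm_eq0; have := normU_sq ks; rewrite kk rnorm0.
by move/esym/eqP; rewrite expf_eq0 => /eqP.
Qed.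

(** For d = c / sqrt T, positivity of - c^* c amounts to |1 + d^* d| <= 1, which [norm_one_add_swap]
    transfers to d d^*. *)
Lemma pos_opp_swap c : pos (- (st c * c)) -> pos (- (c * st c)).
Proof.
move=> pc; pose T := rnorm (st c * c) + 1.
have T0 : 0 < T by rewrite ltr_wpDl// rnorm_ge0.
pose q := Num.sqrt T; have q0 : 0 < q by rewrite sqrtr_gt0.
have qq : q * q = T by rewrite mul_sqrtr// ltW.
pose d : U := (q^-1)%:C%C *: c.
have cd : c = q%:C%C *: d by rewrite /d scal_real divff ?gt_eqF// scale1r.
have e1 : T%:U + st c * c = T%:C%C *: (1 + st d * d).
  by rewrite cd stZr scalAl scalAr scal_real qq scalerDr.
have e2 : T%:U - - (c * st c) = T%:C%C *: (1 + d * st d).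
  by rewrite opprK cd stZr scalAl scalAr scal_real qq scalerDr.
apply: (@pos_of_norm _ T); rewrite ?(ltW T0)//; first by rewrite stN stM stK.
rewrite e2 rnormZr ?(ltW T0)// ler_piMr ?(ltW T0)//; apply: norm_one_add_swap.
have : rnorm (T%:U - - (st c * c)) <= T.
  by apply: norm_of_pos => //; rewrite rnormN lerDl.
by rewrite opprK e1 rnormZr ?(ltW T0)// -[X in _ <= X]mulr1 ler_pM2l.
Qed.

(* By [2 (c c^* + c^* c) = (c + c^* )^2 + (i (c - c^* ))^2], also [c c^* ] is positive. *)
Lemma pos_opp_stM_eq0 c : pos (- (st c * c)) -> c = 0.
Proof.
move=> pc; have pc' := pos_opp_swap pc.
pose z : U := 'i *: (c - st c).
have zs : st z = z by rewrite stZ conjCi stB stK scaleNr -scalerN opprB.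
have ii : ('i : R[i]) * 'i = -1 by rewrite -expr2 sqrCi.
have psum : pos ((c * st c) *+ 2).
  have -> : (c * st c) *+ 2 = ((c + st c) * (c + st c) + z * z) + (- (st c * c)) *+ 2.
    rewrite /z scalAl scalAr scalerA ii scaleN1r !mulrDr !mulrDl !(mulrN, mulNr).
    by zmod.
  apply: posD; last exact: posMn.
  by apply: posD; apply: pos_sq => //; rewrite stD stK addrC.
have : (c * st c) *+ 2 = 0 by apply: pos_anti => //; rewrite -mulNrn; exact: posMn.
move=> /(congr1 rnorm); rewrite normUMn rnorm0 => /eqP.
rewrite mulf_eq0 pnatr_eq0 /= => /eqP /rnorm_eq0 cc0.
have := normU_stM (st c); rewrite stK cc0 rnorm0 normU_st => /esym/eqP.
by rewrite expf_eq0 /= => /eqP /rnorm_eq0.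
Qed.

(* With [w = |h|] and [n = w - h], the element [c = a n] satisfies [c^* c = - w n^2], so it vanishes. *)
Lemma pos_stM a : pos (st a * a).
Proof.
set h : U := st a * a; have hs : st h = h by rewrite stM stK.
have [w [pw hw wc]] := pos_sqrt_comm (pos_sq hs).
(* The root l of w turns w n^2 into (l n)^2, visibly a square. *)
have [l [pl wl lc]] := pos_sqrt_comm pw.
have ws := pos_st pw; have hwc : h * w = w * h by apply: wc; rewrite mulrA.
pose n : U := w - h; have ns : st n = n by rewrite stB ws hs.
have nw : n * w = w * n by rewrite mulrBl mulrBr hwc.
have nl := lc _ nw.
have hn : h * n = - (w * n) by rewrite mulrBr mulrBr hw hwc; zmod.
have ds : st (l * n) = l * n by rewrite stM ns (pos_st pl).
have e1 : st (a * n) * (a * n) = - ((l * n) * (l * n)).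
  rewrite stM ns -mulrA (mulrA (st a)) -/h mulrA; have -> : n * h = h * n.
    by rewrite mulrBr mulrBl hwc.
  by rewrite hn -mulrA (mulrA n) nl !mulrA -wl mulNr.
have an0 : a * n = 0.
  by apply: pos_opp_stM_eq0; rewrite e1 opprK; exact: pos_sq.
have ln0 : l * n = 0.
  apply: sq_eq0 ds _; move: e1; rewrite an0 mulr0 => /esym/eqP.
  by rewrite oppr_eq0 => /eqP.
have wn0 : w * n = 0 by rewrite wl -mulrA ln0 mulr0.
(* n^2 = w n - h n and h n = - w n both vanish, so h equals the positive w. *)
have nn0 : n * n = 0 by rewrite {1}/n mulrBl hn wn0 oppr0 subr0.
by have /eqP := sq_eq0 ns nn0; rewrite subr_eq0 => /eqP <-.
Qed.

(* By the Bernoulli inequality [(1 + m h) (1 - h)^m <= 1]. *)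
Lemma norm_mul_pow_le h m : pos h -> rnorm h <= 1 -> m%:R * rnorm (h * (1 - h) ^+ m) <= 1.
Proof.
move=> ph h1; have [k [pk hk kc]] := pos_sqrt_comm ph.
have [s [ss s2 s1 sc]] := sqrt_one_sub h1 (pos_st ph).
set r : U := 1 - h in s2 *.
have ks : k * s = s * k by apply: sc; rewrite hk mulrA.
have hs : h * s = s * h by apply: sc.
have possq (x : U) n : st x = x -> x * s = s * x -> pos (x * x * r ^+ n).
  move=> xs xc; have xn : x * s ^+ n = s ^+ n * x by apply: commrX.
  have -> : x * x * r ^+ n = (x * s ^+ n) * (x * s ^+ n).
    by rewrite -s2 exprMn_comm// !mulrA; congr (_ * _); rewrite -!mulrA xn.
  by apply: pos_sq; rewrite stM stX ss xs xn.
have pr n : pos (r ^+ n).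
  by have := possq 1 n (st1 eP); rewrite !mul1r mulr1; apply.
(* Consecutive terms differ by (n + 1) h^2 (1 - h)^n, which is positive. *)
have pD n : pos (1 - (1 + h *+ n) * r ^+ n).
  elim: n => [|n IH].
    rewrite expr0 mulr0n addr0 mulr1 subrr; exact: (posMn 0 ph).
  have -> : 1 - (1 + h *+ n.+1) * r ^+ n.+1 =
      (1 - (1 + h *+ n) * r ^+ n) + (h * h * r ^+ n) *+ n.+1.
    rewrite exprS mulrA; have -> : (1 + h *+ n.+1) * r = 1 + h *+ n - (h * h) *+ n.+1.
      rewrite /r mulrBr mulr1 mulrDl mul1r mulrnAl mulrSr.
      by set X := h *+ n; set Y := _ *+ n.+1; zmod.
    by rewrite mulrBl mulrnAl; set X := _ *+ n.+1; zmod.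
  apply: posD => //; apply: posMn; exact: possq (pos_st ph) hs.
rewrite -normUMn; apply: pos_norm_le => //.
  by apply: posMn; rewrite hk; apply: possq => //; exact: pos_st.
have -> : 1%:U - (h * r ^+ m) *+ m = (1 - (1 + h *+ m) * r ^+ m) + r ^+ m.
  by rewrite scale1r mulrDl mul1r mulrnAl; set X := _ *+ m; zmod.
exact: posD.
Qed.

End Positive.

(** * Adjointable operators and multipliers *)

(* A Hilbert module on a type without topology, for the norm [mnorm]; completeness is kept apart. *)
Record hmod (R : realType) (A : completeNormedModType R[i]) (cA : cstar A)
    (X : lmodType R[i]) (D : moduleData A X) : Prop := Hmod {
  hact_cmul : forall x a b, act D x (cmul cA a b) = act D (act D x a) b;
  hact_linl : forall k x y a, act D (k *: x + y) a = k *: act D x a + act D y a;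
  hact_linr : forall k x a b, act D x (k *: a + b) = k *: act D x a + act D x b;
  hinner_linr : forall k x y z, inner D x (k *: y + z) = k *: inner D x y + inner D x z;
  hinner_act : forall x y a, inner D x (act D y a) = cmul cA (inner D x y) a;
  hinner_adj : forall x y, cadj cA (inner D x y) = inner D y x;
  hinner_pos : forall x, exists a, inner D x x = cmul cA (cadj cA a) a;
  hinner_def : forall x, inner D x x = 0 -> x = 0 }.

Definition mcomplete (R : realType) (A : completeNormedModType R[i])
    (X : lmodType R[i]) (D : moduleData A X) : Prop :=
  forall (u : nat -> X) (d : nat -> R), null_seq d ->
    (forall n m, (n <= m)%N -> mnorm D (u n - u m) <= d n) ->
    exists l, forall n, mnorm D (u n - l) <= d n.

(** A separate hypothesis to avoid a circle: the proof for all Hilbert modules ([hmod_CS]) uses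
    multipliers, which are adjointable operators on A over itself, where the inequality is
    elementary. *)
Definition cauchy_schwarz (R : realType) (A : completeNormedModType R[i])
    (X : lmodType R[i]) (D : moduleData A X) : Prop :=
  forall x y, rnorm (inner D x y) <= mnorm D x * mnorm D y.

Section HmodTheory.
Context {R : realType} {A : completeNormedModType R[i]} {cA : cstar A}.
Context {X : lmodType R[i]} {D : moduleData A X}.
Hypothesis H : hmod cA D.
Notation "<| x , y |>" := (inner D x y) (format "<| x ,  y |>").
Notation "x · a" := (act D x a) (at level 40, left associativity).

Lemma actDl x y a : (x + y) · a = x · a + y · a.
Proof. by rewrite -[x]scale1r (hact_linl H) !scale1r. Qed.
Lemma act0l a : 0 · a = 0.
Proof. by apply: (addrI (0 · a)); rewrite -actDl !addr0. Qed.
Lemma actZl k x a : (k *: x) · a = k *: (x · a).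
Proof. by rewrite -[k *: x]addr0 (hact_linl H) act0l addr0. Qed.
Lemma actNl x a : (- x) · a = - (x · a).
Proof. by rewrite -(scaleN1r x) actZl scaleN1r. Qed.
Lemma actBl x y a : (x - y) · a = x · a - y · a.
Proof. by rewrite actDl actNl. Qed.
Lemma actDr x a b : x · (a + b) = x · a + x · b.
Proof. by rewrite -[a]scale1r (hact_linr H) !scale1r. Qed.
Lemma act0r x : x · 0 = 0.
Proof. by apply: (addrI (x · 0)); rewrite -actDr !addr0. Qed.
Lemma actZr k x a : x · (k *: a) = k *: (x · a).
Proof. by rewrite -[k *: a]addr0 (hact_linr H) act0r addr0. Qed.
Lemma actNr x a : x · (- a) = - (x · a).
Proof. by rewrite -(scaleN1r a) actZr scaleN1r. Qed.
Lemma actBr x a b : x · (a - b) = x · a - x · b.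
Proof. by rewrite actDr actNr. Qed.

Lemma innerDr x y z : <|x, y + z|> = <|x, y|> + <|x, z|>.
Proof. by rewrite -[y]scale1r (hinner_linr H) !scale1r. Qed.
Lemma inner0r x : <|x, 0|> = 0.
Proof. by apply: (addrI <|x, 0|>); rewrite -innerDr !addr0. Qed.
Lemma innerZr k x y : <|x, k *: y|> = k *: <|x, y|>.
Proof. by rewrite -[k *: y]addr0 (hinner_linr H) inner0r addr0. Qed.
Lemma innerNr x y : <|x, - y|> = - <|x, y|>.
Proof. by rewrite -(scaleN1r y) innerZr scaleN1r. Qed.
Lemma innerBr x y z : <|x, y - z|> = <|x, y|> - <|x, z|>.
Proof. by rewrite innerDr innerNr. Qed.
Lemma innerDl x y z : <|x + y, z|> = <|x, z|> + <|y, z|>.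
Proof. by rewrite -!(hinner_adj H z) innerDr cadjD. Qed.
Lemma innerZl k x y : <|k *: x, y|> = k^* *: <|x, y|>.
Proof. by rewrite -!(hinner_adj H y) innerZr cadjZ. Qed.
Lemma innerNl x y : <|- x, y|> = - <|x, y|>.
Proof. by rewrite -!(hinner_adj H y) innerNr cadjN. Qed.
Lemma innerBl x y z : <|x - y, z|> = <|x, z|> - <|y, z|>.
Proof. by rewrite innerDl innerNl. Qed.
Lemma inner0l x : <|0, x|> = 0.
Proof. by rewrite -(hinner_adj H) inner0r cadj0. Qed.
Lemma inner_actl x y a : <|x · a, y|> = cmul cA (cadj cA a) <|x, y|>.
Proof. by rewrite -(hinner_adj H) (hinner_act H) cadjM (hinner_adj H). Qed.

Lemma inner_ext x y : (forall z, <|z, x|> = <|z, y|>) -> x = y.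
Proof.
move=> h; apply/eqP; rewrite -subr_eq0; apply/eqP/(hinner_def H).
by rewrite innerBr h subrr.
Qed.

Lemma inner_extl x y : (forall z, <|x, z|> = <|y, z|>) -> x = y.
Proof. by move=> h; apply: inner_ext => z; rewrite -!(hinner_adj H _ z) h. Qed.

Lemma mnorm_ge0 x : 0 <= mnorm D x.
Proof. exact: sqrtr_ge0. Qed.

Lemma mnorm_sq x : mnorm D x ^+ 2 = rnorm <|x, x|>.
Proof. by rewrite sqr_sqrtr// rnorm_ge0. Qed.

Lemma mnorm_sqE x (r : R) : 0 <= r -> rnorm <|x, x|> = r ^+ 2 -> mnorm D x = r.
Proof. by move=> r0 h; rewrite /mnorm -/(rnorm _) h sqrtr_sqr ger0_norm. Qed.

Lemma mnorm_le x (r : R) : 0 <= r -> rnorm <|x, x|> <= r ^+ 2 -> mnorm D x <= r.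
Proof.
move=> r0; rewrite -mnorm_sq => h.
by rewrite -(ler_pXn2r (_ : 0 < 2)%N)// nnegrE ?mnorm_ge0.
Qed.

Lemma mnormZ k x : mnorm D (k *: x) = complex.Re `|k| * mnorm D x.
Proof.
have k0 : 0 <= complex.Re `|k| by rewrite -ler0c RRe_real ?normr_ge0// ger0_real.
apply: mnorm_sqE; first by rewrite mulr_ge0// mnorm_ge0.
rewrite innerZl innerZr !rnormZ exprMn mnorm_sq norm_conjC expr2; ring.
Qed.

Lemma mnormN x : mnorm D (- x) = mnorm D x.
Proof. by rewrite /mnorm innerNl innerNr opprK. Qed.

Lemma mdistC x y : mnorm D (x - y) = mnorm D (y - x).
Proof. by rewrite -mnormN opprB. Qed.

Lemma mnorm0 : mnorm D 0 = 0.
Proof. by apply: mnorm_sqE => //; rewrite inner0r rnorm0 expr0n. Qed.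

Lemma mnorm_eq0 x : mnorm D x = 0 -> x = 0.
Proof.
by move=> h; apply/(hinner_def H)/rnorm_eq0; rewrite -mnorm_sq h expr0n.
Qed.

Lemma mnorm_small x : (forall e : R, 0 < e -> mnorm D x <= e) -> x = 0.
Proof.
move=> h; apply: mnorm_eq0; apply/eqP; rewrite eq_le mnorm_ge0 andbT.
by apply/ler_addgt0Pr => e e0; rewrite add0r h.
Qed.

Lemma mnorm_act x a : mnorm D (x · a) <= mnorm D x * rnorm a.
Proof.
apply: mnorm_le; first by rewrite mulr_ge0 ?mnorm_ge0 ?rnorm_ge0.
rewrite inner_actl (hinner_act H) exprMn mnorm_sq.
have h1 := rnormM cA (cadj cA a) (cmul cA <|x, x|> a).
have h2 := rnormM cA <|x, x|> a; rewrite rnorm_adj in h1.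
have a0 := rnorm_ge0 a; have := ler_wpM2l a0 h2; rewrite expr2; lra.
Qed.

Hypothesis CS : cauchy_schwarz D.

Lemma mnormD x y : mnorm D (x + y) <= mnorm D x + mnorm D y.
Proof.
apply: mnorm_le; first by rewrite addr_ge0 ?mnorm_ge0.
rewrite innerDr !innerDl.
have h1 := rnormD (<|x, x|> + <|y, x|>) (<|x, y|> + <|y, y|>).
have h2 := rnormD <|x, x|> <|y, x|>; have h3 := rnormD <|x, y|> <|y, y|>.
have := CS x y; have := CS y x; rewrite sqrrD !mnorm_sq; lra.
Qed.

Lemma mnormB x y : mnorm D (x - y) <= mnorm D x + mnorm D y.
Proof. by rewrite -(mnormN y) mnormD. Qed.

Lemma mnorm_dist3 x y z : mnorm D (x - z) <= mnorm D (x - y) + mnorm D (y - z).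
Proof. by rewrite -(subrKA y) mnormD. Qed.

Lemma op_bound_opnorm (T : X -> X) (M : R) : op_bound D T M -> op_bound D T (opnorm D T).
Proof.
move=> TM x; have [x0|x0] := eqVneq (mnorm D x) 0.
  by apply: le_trans (TM x) _; rewrite x0 !mulr0.
have xp : 0 < mnorm D x by rewrite lt_def x0 mnorm_ge0.
rewrite -ler_pdivrMr//; apply: lb_le_inf.
  exists `|M|; split => // y; apply: le_trans (TM y) _.
  by rewrite ler_wpM2r ?mnorm_ge0// ler_norm.
by move=> N [N0 TN]; rewrite ler_pdivrMr.
Qed.

Lemma opnorm_le (T : X -> X) (M : R) : 0 <= M -> op_bound D T M -> opnorm D T <= M.
Proof. by move=> M0 TM; apply: ge_inf => //; exists 0 => N []. Qed.

Lemma opnorm_ge0 (T : X -> X) : 0 <= opnorm D T.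
Proof.
have [[M TM]|h] := pselect (exists M, 0 <= M /\ op_bound D T M).
  by apply: lb_le_inf; [exists M|move=> N []].
(* Without a bound the infimum is taken over the empty set and equals 0. *)
rewrite /opnorm (_ : [set M | _] = set0) ?inf0//.
by apply/seteqP; split => // M ?; apply: h; exists M.
Qed.

Lemma op_bound_ge0 (T : X -> X) (M : R) : op_bound D T M -> op_bound D T `|M|.
Proof.
by move=> TM y; apply: le_trans (TM y) _; rewrite ler_wpM2r ?mnorm_ge0// ler_norm.
Qed.

Definition adjoint_pair (T S : X -> X) := forall x y, <|T x, y|> = <|x, S y|>.

Lemma adjoint_pair_sym T S : adjoint_pair T S -> adjoint_pair S T.
Proof. by move=> TS x y; rewrite -(hinner_adj H) -TS (hinner_adj H). Qed.

(** Cauchy-Schwarz in |S x|^2 = |<T S x, x>|, divided by |S x|. *)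
Lemma adjoint_pair_bound T S M : 0 <= M -> adjoint_pair T S -> op_bound D T M -> op_bound D S M.
Proof.
move=> M0 TS TM x; have [->|Sx] := eqVneq (mnorm D (S x)) 0.
  by rewrite mulr_ge0// mnorm_ge0.
have Sp : 0 < mnorm D (S x) by rewrite lt_def Sx mnorm_ge0.
rewrite -(ler_pM2r Sp) -expr2 mnorm_sq -TS; apply: le_trans (CS _ _) _.
by rewrite mulrAC ler_wpM2r ?mnorm_ge0.
Qed.

Lemma adjoint_lin T S : adjoint_pair T S -> linear T.
Proof.
move=> TS k x y; apply: inner_extl => z.
by rewrite TS !innerDl !innerZl !TS.
Qed.

Lemma adjoint_act T S x a : adjoint_pair T S -> T (x · a) = T x · a.
Proof. by move=> TS; apply: inner_extl => z; rewrite TS !inner_actl TS. Qed.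

Lemma adjoint_norm_sq T S M : 0 <= M -> adjoint_pair T S -> op_bound D (S \o T) M ->
  op_bound D T (Num.sqrt M).
Proof.
move=> M0 TS STM x; apply: mnorm_le; first by rewrite mulr_ge0 ?sqrtr_ge0 ?mnorm_ge0.
rewrite TS exprMn sqr_sqrtr// expr2 mulrA; apply: le_trans (CS _ _) _.
by rewrite mulrC ler_wpM2r ?mnorm_ge0//; exact: STM.
Qed.

End HmodTheory.

Arguments adjoint_pair {R A X} D T S.
Arguments mnorm_ge0 {R A X} D x.
Arguments opnorm_ge0 {R A X} D T.

Section Adjointable.
Context {R : realType} {A : completeNormedModType R[i]} {cA : cstar A}.
Context {X : lmodType R[i]} {D : moduleData A X}.

Definition adj_pred : pred (X -> X) := fun T =>
  `[< exists S M, adjoint_pair D T S /\ op_bound D T M >].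

(** The hypotheses are parameters so that the instances declared on the type can depend on them. *)
Record adjt (H : hmod cA D) (CS : cauchy_schwarz D) (HC : mcomplete D) :=
  Adjt { afun : X -> X; _ : afun \in adj_pred }.

Context (H : hmod cA D) (CS : cauchy_schwarz D) (HC : mcomplete D).
Notation T := (adjt H CS HC).

Lemma adj_predP (f : X -> X) :
  reflect (exists S M, adjoint_pair D f S /\ op_bound D f M) (f \in adj_pred).
Proof. exact: asboolP. Qed.

Lemma adj_pred_closed : subsemimod_closed adj_pred.
Proof.
split; [split|].
- apply/adj_predP; exists 0, 0; split => [x y|x].
    by rewrite (inner0l H) (inner0r H).
  by rewrite mul0r (mnorm0 H).
- move=> f g /adj_predP[S [M [fS fM]]] /adj_predP[S' [M' [gS gM]]].
  apply/adj_predP; exists (S + S'), (M + M'); split => [x y|x].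
    by rewrite (innerDl H) fS gS (innerDr H).
  by apply: le_trans (mnormD H CS _ _) _; rewrite mulrDl lerD.
- move=> k f /adj_predP[S [M [fS fM]]].
  apply/adj_predP; exists (k^* *: S), (complex.Re `|k| * M); split => [x y|x].
    by rewrite (innerZl H) fS (innerZr H).
  rewrite (mnormZ H) -mulrA ler_wpM2l//.
  by rewrite -ler0c RRe_real ?normr_ge0// ger0_real.
Qed.
HB.instance Definition _ := GRing.isSubmodClosed.Build _ _ adj_pred adj_pred_closed.

HB.instance Definition _ := [isSub for @afun H CS HC].
HB.instance Definition _ := [Choice of T by <:].
HB.instance Definition _ := [SubChoice_isSubLmodule of T by <:].

Definition adj_norm (f : T) : R[i] := (opnorm D (afun f))%:C%C.

Lemma afunP (f : T) : exists S M, adjoint_pair D (afun f) S /\ op_bound D (afun f) M.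
Proof. by apply/adj_predP; case: f. Qed.

Lemma afun_bound (f : T) : op_bound D (afun f) (opnorm D (afun f)).
Proof. by have [S [M [_ fM]]] := afunP f; exact: op_bound_opnorm fM. Qed.

Lemma adj_normD f g : adj_norm (f + g) <= adj_norm f + adj_norm g.
Proof.
rewrite /adj_norm -rmorphD lecR; apply: opnorm_le.
  by rewrite addr_ge0 ?opnorm_ge0.
move=> x; apply: le_trans (mnormD H CS _ _) _; rewrite mulrDl.
by apply: lerD; exact: afun_bound.
Qed.

Lemma adj_normZ (l : R[i]) f : adj_norm (l *: f) = `|l| * adj_norm f.
Proof.
have ln0 (k : R[i]) : 0 <= complex.Re `|k|.
  by rewrite -ler0c RRe_real ?normr_ge0// ger0_real.
have le k g : opnorm D (afun (k *: g)) <= complex.Re `|k| * opnorm D (afun g).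
  apply: opnorm_le => [|x]; first by rewrite mulr_ge0 ?opnorm_ge0.
  by rewrite (mnormZ H) -mulrA ler_wpM2l//; exact: afun_bound.
have lE (k : R[i]) : `|k| = (complex.Re `|k|)%:C%C by rewrite RRe_real// ger0_real.
rewrite /adj_norm (lE l) -rmorphM; congr (_%:C%C); apply/eqP; rewrite eq_le le andTb.
have [->|l0] := eqVneq l 0; first by rewrite normr0 mul0r opnorm_ge0.
have := le l^-1 (l *: f); rewrite scalerA mulVf// scale1r.
have lp : 0 < complex.Re `|l| by rewrite -ltcR -lE normr_gt0.
have -> : complex.Re `|l^-1| = (complex.Re `|l|)^-1.
  by apply: complexI; rewrite -lE normfV (lE l) fmorphV.
by rewrite mulrC ler_pdivlMr// mulrC.
Qed.

Lemma adj_norm_eq0 f : adj_norm f = 0 -> f = 0.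
Proof.
move=> /complexI f0; apply: val_inj; apply/funext => x.
apply: (mnorm_eq0 H); apply/eqP; rewrite eq_le mnorm_ge0 andbT.
by have := afun_bound f x; rewrite f0 mul0r.
Qed.

HB.instance Definition _ := @Lmodule_isNormed.Build R[i] T
  adj_norm adj_normD adj_normZ adj_norm_eq0.

(** The operators and their adjoints converge pointwise with the same modulus, and the two limits
    are adjoint to each other. *)
Lemma adj_complete (F : set_system T) : ProperFilter F -> cauchy F -> cvg F.
Proof.
apply: complete_of_seq => u d d0 ud.
have {}ud n m : (n <= m)%N -> opnorm D (afun (u n - u m)) <= d n by exact: ud.
have dge n : 0 <= d n by apply: le_trans (ud n n _) => //; exact: opnorm_ge0.
have udx n m x : (n <= m)%N ->
    mnorm D (afun (u n) x - afun (u m) x) <= d n * mnorm D x.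
  move=> nm; apply: le_trans (afun_bound (u n - u m) x) _.
  by rewrite ler_wpM2r ?mnorm_ge0// ud.
have dn (C : R) : 0 <= C -> null_seq (fun n => d n * C).
  move=> C0 e e0; have C1 : 0 < C + 1 by lra.
  have [n dn] := d0 _ (divr_gt0 e0 C1); exists n.
  move: dn; rewrite ltr_pdivlMr//; have := dge n; nra.
have [f fP] := choice (fun x => HC (dn _ (mnorm_ge0 D x)) (fun n m => @udx n m x)).
have [v vP] := choice (fun n => afunP (u n)).
have va n : adjoint_pair D (afun (u n)) (v n) by have [M []] := vP n.
have vdx n m x : (n <= m)%N -> mnorm D (v n x - v m x) <= d n * mnorm D x.
  move=> nm; have bnd : op_bound D (afun (u n - u m)) (d n).
    by move=> y; apply: udx.
  have adj : adjoint_pair D (afun (u n - u m)) (v n - v m).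
    by move=> y z; rewrite (innerBl H) !va (innerBr H).
  exact: (adjoint_pair_bound CS (dge n) adj bnd x).
have [g gP] := choice (fun x => HC (dn _ (mnorm_ge0 D x)) (fun n m => @vdx n m x)).
have fg : adjoint_pair D f g.
  move=> x y; apply/eqP; rewrite -subr_eq0; apply/eqP.
  apply: (null_seq_small (C := 2 * (mnorm D x * mnorm D y)) d0) => [|n].
    by rewrite !mulr_ge0 ?mnorm_ge0.
  have -> : inner D (f x) y - inner D x (g y) =
      inner D x (v n y - g y) - inner D (afun (u n) x - f x) y.
    by rewrite (innerBl H) (innerBr H) va; zmod.
  apply: le_trans (rnormB _ _) _.
  have h1 := CS x (v n y - g y); have h2 := CS (afun (u n) x - f x) y.
  have h3 := ler_wpM2l (mnorm_ge0 D x) (gP y n).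
  have h4 := ler_wpM2r (mnorm_ge0 D y) (fP x n).
  lra.
have fd n : op_bound D (afun (u n) - f) (d n) by move=> x; exact: fP.
have fin : f \in adj_pred.
  apply/adj_predP; exists g, (opnorm D (afun (u 0%N)) + d 0%N); split => // x.
  have -> : f x = afun (u 0%N) x - (afun (u 0%N) x - f x) by zmod.
  apply: le_trans (mnormB H CS _ _) _; rewrite mulrDl.
  by apply: lerD; [exact: afun_bound|exact: fP].
exists (Adjt H CS HC fin) => n; exact: opnorm_le (fd n).
Qed.
HB.instance Definition _ := Uniform_isComplete.Build T adj_complete.

Lemma rnorm_adjt (f : T) : rnorm f = opnorm D (afun f).
Proof. by []. Qed.

Definition adjt_of (f S : X -> X) (M : R) (fS : adjoint_pair D f S)
    (fM : op_bound D f M) : T :=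
  Adjt H CS HC (introT (adj_predP f) (ex_intro _ S (ex_intro _ M (conj fS fM)))).

Lemma adj_star_ex (f : T) : exists g : T, adjoint_pair D (afun f) (afun g).
Proof.
have [S [M [fS fM]]] := afunP f.
have SM := adjoint_pair_bound CS (normr_ge0 M) fS (op_bound_ge0 fM).
by exists (adjt_of (adjoint_pair_sym H fS) SM).
Qed.

Definition adj_star (f : T) : T := projT1 (cid (adj_star_ex f)).
Lemma adj_starP (f : T) : adjoint_pair D (afun f) (afun (adj_star f)).
Proof. exact: projT2 (cid (adj_star_ex f)). Qed.

Lemma adj_star_eq (f g : T) : adjoint_pair D (afun f) (afun g) -> adj_star f = g.
Proof.
move=> fg; apply: val_inj; apply/funext => x; apply: (inner_ext H) => y.
by rewrite -adj_starP fg.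
Qed.

Lemma adj_comp_in (f g : T) : (afun f \o afun g) \in adj_pred.
Proof.
apply/adj_predP; exists (afun (adj_star g) \o afun (adj_star f)).
exists (opnorm D (afun f) * opnorm D (afun g)); split => [x y|x] /=.
  by rewrite !adj_starP.
apply: le_trans (afun_bound _ _) _; rewrite -mulrA ler_wpM2l ?opnorm_ge0//.
exact: afun_bound.
Qed.
Definition adj_comp (f g : T) : T := Adjt H CS HC (adj_comp_in f g).

Lemma afun_lin (f : T) : linear (afun f).
Proof. exact: (adjoint_lin H (adj_starP f)). Qed.

Lemma adj_normM (f g : T) : rnorm (adj_comp f g) <= rnorm f * rnorm g.
Proof.
rewrite !rnorm_adjt; apply: opnorm_le => [|x]; first by rewrite mulr_ge0 ?opnorm_ge0.
apply: le_trans (afun_bound f (afun g x)) _; rewrite -mulrA ler_wpM2l ?opnorm_ge0//.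
exact: afun_bound.
Qed.

Lemma adj_norm_star (f : T) : rnorm (adj_star f) <= rnorm f.
Proof.
rewrite !rnorm_adjt; apply: opnorm_le; first exact: opnorm_ge0.
exact: (adjoint_pair_bound CS (opnorm_ge0 D _) (adj_starP f) (afun_bound f)).
Qed.

Definition adjt_cstar : cstar T.
Proof.
refine (@CStar R T adj_comp adj_star _ _ _ _ _ _ _ _).
- by move=> a b c; apply: val_inj.
- by move=> k a b c; apply: val_inj.
- by move=> k a b c; apply: val_inj; apply/funext => x /=; rewrite afun_lin.
- move=> k a b; apply: adj_star_eq => x y.
  by rewrite (innerDl H) (innerZl H) !adj_starP (innerDr H) (innerZr H).
- by move=> a b; apply: adj_star_eq => x y /=; rewrite !adj_starP.
- by move=> a; apply: adj_star_eq; apply: (adjoint_pair_sym H); exact: adj_starP.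
- by move=> a b; rewrite -!rnormE -rmorphM lecR; exact: adj_normM.
- move=> a; rewrite -!rnormE -rmorphXn; congr (_%:C%C); apply/eqP; rewrite eq_le.
  apply/andP; split.
    apply: le_trans (adj_normM _ _) _; rewrite expr2 ler_wpM2r ?rnorm_ge0//.
    exact: adj_norm_star.
  (* The other half of the C*-identity: |a x|^2 <= |a^* a| |x|^2. *)
  have n0 := rnorm_ge0 (adj_comp (adj_star a) a).
  have := adjoint_norm_sq CS n0 (adj_starP a) (@afun_bound (adj_comp (adj_star a) a)).
  move=> /(opnorm_le (sqrtr_ge0 _)) h.
  by rewrite -(sqr_sqrtr n0) ler_pXn2r ?nnegrE ?sqrtr_ge0 ?rnorm_ge0.
Defined.

Lemma adj_id_in : (id : X -> X) \in adj_pred.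
Proof. by apply/adj_predP; exists id, 1; split => // x; rewrite mul1r. Qed.
Definition adj_id : T := Adjt H CS HC adj_id_in.

Lemma adj_id_unit : cunit adjt_cstar adj_id.
Proof. by split => a; apply: val_inj. Qed.

End Adjointable.

Section Multiplier.
Context {R : realType} {A : completeNormedModType R[i]} (cA : cstar A).
Notation "a ∙ b" := (cmul cA a b) (at level 40, left associativity).
Notation "a ^†" := (cadj cA a) (at level 2, format "a ^†").
Implicit Types a b c h : A.

Definition selfmod : moduleData A A := ModuleData (cmul cA) (fun a b => a^† ∙ b).

Lemma selfmod_mnorm a : mnorm selfmod a = rnorm a.
Proof. by apply: mnorm_sqE; [exact: rnorm_ge0|rewrite rnorm_adjM]. Qed.

Lemma selfmod_hmod : hmod cA selfmod.
Proof.
constructor => /=.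
- by move=> *; rewrite cmulA.
- by move=> *; rewrite cmul_linl.
- by move=> *; rewrite cmul_linr.
- by move=> *; rewrite cmul_linr.
- by move=> *; rewrite cmulA.
- by move=> *; rewrite cadjM cadjK.
- by move=> x; exists x.
- move=> x h; apply: rnorm_eq0; have := rnorm_adjM cA x.
  by rewrite h rnorm0 => /esym/eqP; rewrite expf_eq0 => /eqP.
Qed.

Lemma selfmod_complete : mcomplete selfmod.
Proof.
move=> u d d0 ud; have [n m nm|l ul] := @rnorm_complete _ _ u d d0.
  by rewrite -selfmod_mnorm ud.
by exists l => n; rewrite selfmod_mnorm; exact: ul.
Qed.

Lemma selfmod_CS : cauchy_schwarz selfmod.
Proof. by move=> a b; rewrite !selfmod_mnorm -(rnorm_adj cA a) rnormM. Qed.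

Definition mult_alg := ualg (adj_id_unit selfmod_hmod selfmod_CS selfmod_complete).
Notation U := mult_alg.
Notation st := (@st _ _ _ _ (adj_id_unit selfmod_hmod selfmod_CS selfmod_complete)).
Notation pos := (@pos _ _ _ _ (adj_id_unit selfmod_hmod selfmod_CS selfmod_complete)).
Notation "r %:U" := (r%:C%C *: (1 : U)) (at level 2, format "r %:U").

Definition uapp (u : U) : A -> A := afun u.

Lemma uapp_bound (u : U) a : rnorm (uapp u a) <= rnorm u * rnorm a.
Proof. by have := afun_bound u a; rewrite !selfmod_mnorm. Qed.

Lemma rnorm_mult_le (u : U) (M : R) : 0 <= M ->
  (forall a, rnorm (uapp u a) <= M * rnorm a) -> rnorm u <= M.
Proof. by move=> M0 h; apply: opnorm_le => // a; rewrite !selfmod_mnorm; exact: h. Qed.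

Lemma mult_ext (u v : U) : uapp u =1 uapp v -> u = v.
Proof. by move=> uv; apply: val_inj; apply/funext. Qed.

Lemma iota_adj a : adjoint_pair selfmod (cmul cA a) (cmul cA a^†).
Proof. by move=> x y /=; rewrite cadjM cmulA. Qed.

Lemma iota_bound a : op_bound selfmod (cmul cA a) (rnorm a).
Proof. by move=> x; rewrite !selfmod_mnorm rnormM. Qed.

Definition iota_mult a : U := adjt_of selfmod_hmod selfmod_CS selfmod_complete (@iota_adj a) (@iota_bound a).
Notation iota := iota_mult.

Lemma iotaD a b : iota (a + b) = iota a + iota b.
Proof. by apply: mult_ext => x; exact: cmulDl. Qed.
Lemma iotaZ k a : iota (k *: a) = k *: iota a.
Proof. by apply: mult_ext => x; exact: cmulZl. Qed.
Lemma iotaN a : iota (- a) = - iota a.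
Proof. by apply: mult_ext => x; exact: cmulNl. Qed.
Lemma iotaB a b : iota (a - b) = iota a - iota b.
Proof. by rewrite iotaD iotaN. Qed.
Lemma iotaM a b : iota (a ∙ b) = iota a * iota b.
Proof. by apply: mult_ext => x; rewrite /uapp /= cmulA. Qed.
Lemma iotaS a : iota a^† = st (iota a).
Proof. by symmetry; apply: adj_star_eq; exact: iota_adj. Qed.

Lemma rnorm_iota a : rnorm (iota a) = rnorm a.
Proof.
apply/eqP; rewrite eq_le; apply/andP; split.
  by apply: rnorm_mult_le; [exact: rnorm_ge0|move=> b; exact: rnormM].
(* Evaluation at a^* gives a a^*, of norm |a|^2. *)
have := uapp_bound (iota a) a^†; rewrite {1}/uapp /=.
have := rnorm_adjM cA a^†; rewrite cadjK rnorm_adj => -> h.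
have := rnorm_ge0 a; have := rnorm_ge0 (iota a); nra.
Qed.

Lemma iota_inj : injective iota.
Proof.
move=> a b ab; apply/eqP; rewrite -subr_eq0; apply/eqP/rnorm_eq0.
by rewrite -rnorm_iota iotaB ab subrr rnorm0.
Qed.

(** The image of A is a left ideal of the multipliers, which keeps the approximants of
    [pos_iota_sqrt] in A. *)
Lemma mult_iota (u : U) a : u * iota a = iota (uapp u a).
Proof.
apply: mult_ext => x; rewrite /uapp /=.
by have := adjoint_act selfmod_hmod a x (adj_starP u).
Qed.

Lemma iota_limit (u : U) :
  (forall e : R, 0 < e -> exists a, rnorm (u - iota a) <= e) -> exists a, u = iota a.
Proof.
move=> h; pose d n : R := 2^-1 ^+ n.
have d0 n : 0 < d n by rewrite exprn_gt0// invr_gt0 ltr0n.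
have [a au] := choice (fun n => h _ (d0 n)).
have dn : null_seq (fun n => d n * 2).
  move=> e e0; have [|n dn] := @exp2_small _ (e / 2); first by rewrite divr_gt0.
  by exists n; rewrite -ltr_pdivlMr.
have [n m nm|l al] := @rnorm_complete _ _ a _ dn.
  rewrite -rnorm_iota iotaB; apply: le_trans (rnorm_dist3 _ u _) _.
  rewrite rdistC; have := au n; have := au m; have : d m <= d n by exact: exp2_le.
  lra.
exists l; apply/eqP; rewrite -subr_eq0; apply/eqP.
apply: (null_seq_small (C := 2) dn) => // n.
apply: le_trans (rnorm_dist3 _ (iota (a n)) _) _.
rewrite -iotaB rnorm_iota; have := au n; have := al n; have := d0 n; lra.
Qed.

Lemma pos_iota_sq a : pos (iota (a^† ∙ a)).
Proof. by rewrite iotaM iotaS; exact: pos_stM. Qed.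

(** By the C*-identity the square is the norm of j^2 (1 - j^2)^(2n), so [norm_mul_pow_le] applies to
    h = j^2. *)
Lemma rnorm_pow_sub_mul (j : A) n : j^† = j -> rnorm j <= 1 ->
  n%:R * rnorm (iota j * (1 - iota (j ∙ j)) ^+ n) ^+ 2 <= 1.
Proof.
move=> js j1; set r : U := 1 - iota (j ∙ j); have rs : st r = r.
  by rewrite /r stB st1 -iotaS cadjM js.
have jr : iota j * r = r * iota j.
  by rewrite /r mulrBr mulrBl mulr1 mul1r iotaM mulrA.
have -> : rnorm (iota j * r ^+ n) ^+ 2 = rnorm (iota (j ∙ j) * r ^+ (n + n)).
  rewrite -normU_stM stM stX rs -iotaS js iotaM exprD !mulrA.
  have /esym c : iota j * r ^+ n = r ^+ n * iota j by apply: commrX.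
  by rewrite c -!mulrA; congr rnorm; congr (_ * _ : U); rewrite mulrA c mulrA.
have pj : pos (iota (j ∙ j)) by rewrite -{1}js; exact: pos_iota_sq.
have := @norm_mul_pow_le _ _ _ _ _ _ (n + n) pj; rewrite rnorm_iota natrD -/r.
have h : rnorm (j ∙ j) <= 1.
  by rewrite -{1}js rnorm_adjM expr_le1// rnorm_ge0.
move=> /(_ h) h2; apply: le_trans h2; rewrite mulrDl lerDl mulr_ge0 ?ler0n//.
exact: rnorm_ge0.
Qed.

(* The square root k taken among the multipliers lies in [iota A]: for a small multiple g of h,
   [k (1 - g)^n] tends to 0 and [k - k (1 - g)^n] is in [iota A]. *)
Lemma pos_iota_sqrt h : pos (iota h) -> exists2 c, c^† = c & h = c ∙ c.
Proof.
move=> [k ks hk].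
suff [c kc] : exists c, k = iota c.
  exists c; first by apply: iota_inj; rewrite iotaS -kc.
  by apply: iota_inj; rewrite iotaM hk kc.
apply: iota_limit => e e0.
pose s : R := rnorm h + 1; have s0 : 0 < s by rewrite ltr_wpDl// rnorm_ge0.
pose g : A := (s^-1)%:C%C *: h.
have pg : pos (iota g) by rewrite iotaZ; apply: posZ; [rewrite invr_ge0 ltW|exists k].
have g1 : rnorm (iota g) <= 1.
  rewrite rnorm_iota rnormZr ?invr_ge0 ?(ltW s0)// mulrC ler_pdivrMr// mul1r lerDl.
  by [].
set r : U := 1 - iota g.
have rs : st r = r by rewrite /r stB st1 (pos_st pg).
have kh : k * iota h = iota h * k by rewrite hk mulrA.
have kr : k * r = r * k.
  by rewrite /r mulrBr mulrBl mulr1 mul1r iotaZ scalAl scalAr kh.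
(* Each step adds k r^n g, a multiplier times an element of A. *)
have krn n : exists a, k - k * r ^+ n = iota a.
  elim: n => [|n [a ka]]; first by exists 0; rewrite expr0 mulr1 subrr; apply/esym/(mult_ext (v := 0)) => x; exact: cmul0l.
  exists (a + uapp (k * r ^+ n) g).
  rewrite iotaD -ka -mult_iota exprSr mulrA {2}/r mulrBr mulr1; zmod.
have kn n : rnorm (k * r ^+ n) ^+ 2 * n%:R <= s.
  rewrite -normU_stM stM stX rs ks.
  have /esym c : k * r ^+ n = r ^+ n * k by apply: commrX.
  have -> : r ^+ n * k * (k * r ^+ n) = s%:C%C *: (iota g * r ^+ (n + n)).
    rewrite -scalAl -iotaZ /g scal_real divff ?gt_eqF// scale1r hk exprD c.
    by rewrite -!mulrA; congr (_ * _); rewrite mulrA c -mulrA.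
  rewrite rnormZr ?(ltW s0)// -mulrA ler_piMr ?(ltW s0)//.
  have := @norm_mul_pow_le _ _ _ _ _ _ (n + n) pg g1; rewrite natrD -/r.
  by have := rnorm_ge0 (iota g * r ^+ (n + n)); have := ler0n R n; nra.
(* From |k r^n|^2 n <= s, any n above s / e^2 brings the error below e. *)
pose n := Num.bound (s / e ^+ 2).
have [a ka] := krn n; exists a; rewrite -ka.
have -> : k - (k - k * r ^+ n) = k * r ^+ n by zmod.
have nb : s / e ^+ 2 < n%:R.
  by apply: archi_boundP; rewrite divr_ge0 ?(ltW s0)// sqr_ge0.
rewrite ltr_pdivrMr ?exprn_gt0// in nb.
have n0 : 0 < n%:R :> R.
  rewrite lt_def ler0n andbT; apply/eqP => n0; move: nb; rewrite n0 mul0r => /(lt_trans s0); by rewrite ltxx.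
apply: ler_of_sqr (ltW e0) _.
rewrite -(ler_pM2r n0); apply: le_trans (kn n) _; by rewrite mulrC ltW.
Qed.

(* The bound says [|t - h| <= t] in the multiplier algebra, that is, h is positive there. *)
Lemma sq_norm_bound a (t : R) : rnorm (a^† ∙ a) <= t ->
  forall b, rnorm (t%:C%C *: b - (a^† ∙ a) ∙ b) <= t * rnorm b.
Proof.
move=> at_ b; have := norm_of_pos (pos_iota_sq a); rewrite rnorm_iota => /(_ t at_) h.
apply: le_trans (uapp_bound (t%:U - iota (a^† ∙ a)) b) _.
by rewrite ler_wpM2r// rnorm_ge0.
Qed.

(** The bound involves only norms in the given algebra, so it can be proved in a larger algebra and
    the root still found in the smaller one. *)
Lemma sqrt_of_norm_bound h (t : R) : h^† = h -> 0 <= t ->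
  (forall b, rnorm (t%:C%C *: b - h ∙ b) <= t * rnorm b) ->
  exists2 c, c^† = c & h = c ∙ c.
Proof.
move=> hs t0 hb; apply: pos_iota_sqrt; apply: (@pos_of_norm _ _ _ _ _ _ t) => //.
  by rewrite -iotaS hs.
exact: rnorm_mult_le.
Qed.

Lemma sum_sq a b : exists c, a^† ∙ a + b^† ∙ b = c^† ∙ c.
Proof.
have [|c cs h] := @pos_iota_sqrt (a^† ∙ a + b^† ∙ b).
  by rewrite iotaD; apply: posD; exact: pos_iota_sq.
by exists c; rewrite h cs.
Qed.

Lemma sq_norm_mono a b : rnorm (a^† ∙ a) <= rnorm (a^† ∙ a + b^† ∙ b).
Proof.
rewrite -[leLHS]rnorm_iota -[leRHS]rnorm_iota; apply: pos_mono; first exact: pos_iota_sq.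
rewrite iotaD; have -> : forall x y : U, x + y - x = y by move=> x y; zmod.
exact: pos_iota_sq.
Qed.

Section Module.
Context {X : lmodType R[i]} {D : moduleData A X}.
Hypothesis H : hmod cA D.

(** With a = <x,y> and s = |<x,x>|, add <x a - s y, x a - s y> to a^* (s - <x,x>) a: both are
    positive and the sum is s (s <y,y> - a^* a). *)
Lemma hmod_CS : cauchy_schwarz D.
Proof.
move=> x y; pose s := rnorm (inner D x x).
have s0 : 0 <= s := rnorm_ge0 _.
have [sz|sn] := eqVneq s 0.
  have -> : x = 0 by apply/(hinner_def H)/rnorm_eq0.
  by rewrite (inner0l H) rnorm0 mulr_ge0 ?mnorm_ge0.
have sp : 0 < s by rewrite lt_def sn.
pose a := inner D x y; have [w hw] := hinner_pos H (act D x a - s%:C%C *: y).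
have [v hv] := hinner_pos H x.
have px : pos (s%:U - iota (inner D x x)).
  by rewrite /s -rnorm_iota; apply: pos_sub_norm; rewrite hv; exact: pos_iota_sq.
have pax : pos (iota a^† * (s%:U - iota (inner D x x)) * iota a).
  have [k ks ->] := px.
  have -> : iota a^† * (k * k) * iota a = st (k * iota a) * (k * iota a).
    by rewrite stM ks -iotaS !mulrA.
  exact: pos_stM.
have pw : pos (iota (w^† ∙ w)) := pos_iota_sq w.
have : pos (s%:C%C *: (s%:C%C *: iota (inner D y y) - iota (a^† ∙ a))).
  have -> : s%:C%C *: (s%:C%C *: iota (inner D y y) - iota (a^† ∙ a)) =
      iota a^† * (s%:U - iota (inner D x x)) * iota a + iota (w^† ∙ w).
    rewrite -hw !(innerBl H, innerBr H, innerZl H, innerZr H, inner_actl H, hinner_act H).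
    rewrite -(hinner_adj H x y) -/a.
    rewrite !conj_real !(iotaB, iotaZ, iotaM) !(mulrBr, mulrBl, scalAl, scalAr, mulr1, scalerBr).
    by rewrite !mulrA; zmod.
  exact: posD.
move=> /(@posZ _ _ _ _ _ (s^-1) _ (_ : 0 <= s^-1)); rewrite invr_ge0 => /(_ s0).
rewrite scal_real mulVf// scale1r => /(pos_mono (pos_iota_sq a)).
rewrite rnormZr// !rnorm_iota rnorm_adjM => h.
apply: ler_of_sqr; first by rewrite mulr_ge0 ?mnorm_ge0.
by rewrite exprMn !mnorm_sq.
Qed.

(* The vectors [x (1 - h)^n], where [h] is a small multiple of [i^2], differ from [x] by
   elements of [X i] and satisfy
   [|x (1 - h)^n|^2 = |(1 - h)^n <x,x> (1 - h)^n| <= |<x,x> + i| + |i (1 - h)^n|]. *)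
Lemma quot_approx (S : X -> Prop) (x : X) (i : A) (e : R) :
  (forall k y z, S y -> S z -> S (k *: y + z)) ->
  (forall y a, S y -> S (act D y a)) -> S x -> i^† = i -> 0 < e ->
  exists2 y, S y & mnorm D (x - act D y i) ^+ 2 <= rnorm (inner D x x + i) + e.
Proof.
move=> Sl Sa Sx si e0.
pose c : R := (rnorm i + 1)^-1; have c0 : 0 < c by rewrite invr_gt0 ltr_wpDl// rnorm_ge0.
pose j : A := c%:C%C *: i; have js : j^† = j by rewrite cadjZr si.
have j1 : rnorm j <= 1.
  rewrite rnormZr ?(ltW c0)// mulrC ler_pdivrMr ?mul1r ?lerDl//.
  by rewrite ltr_wpDl// rnorm_ge0.
pose h := j ∙ j; pose r : U := 1 - iota h.
have rs : st r = r by rewrite /r stB st1 -iotaS cadjM js.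
have pj : pos (iota h) by rewrite /h -{1}js; exact: pos_iota_sq.
have h1 : rnorm (iota h) <= 1.
  by rewrite rnorm_iota /h -{1}js rnorm_adjM expr_le1// rnorm_ge0.
have r1 : rnorm r <= 1 by have := norm_of_pos pj h1; rewrite scale1r.
pose xs := fix xs n := if n is m.+1 then xs m - act D (xs m) h else x.
have xS n : S (xs n).
  by elim: n => //= n IH; rewrite addrC -scaleN1r; apply: Sl => //; exact: Sa.
(* Each step subtracts a multiple of h = c^2 i^2, hence an element of X i. *)
have xn n : exists2 y, S y & x - xs n = act D y i.
  elim: n => [|n [y Sy xy]].
    exists (-1 *: x + x); first exact: Sl.
    by rewrite /= scaleN1r addNr (act0l H) subrr.
  exists (1 *: y + act D (xs n) ((c * c)%:C%C *: i)); first by apply: Sl => //; exact: Sa.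
  rewrite scale1r (actDl H) -xy -(hact_cmul H) cmulZl /=.
  have -> : (c * c)%:C%C *: (i ∙ i) = h by rewrite /h /j cmulZl cmulZr scal_real.
  by zmod.
have hs : h^† = h by rewrite /h cadjM js.
have gn n : iota (inner D (xs n) (xs n)) = r ^+ n * iota (inner D x x) * r ^+ n.
  elim: n => [|n IH]; first by rewrite expr0 mulr1 mul1r.
  rewrite /= (innerBl H) !(innerBr H) !(inner_actl H) !(hinner_act H).
  rewrite {1}exprS exprSr -!mulrA.
  have -> : r * (r ^+ n * (iota (inner D x x) * (r ^+ n * r))) =
            r * (iota (inner D (xs n) (xs n))) * r by rewrite IH !mulrA.
  rewrite hs /r /h !(iotaB, iotaM) !(mulrBr, mulrBl, mul1r, mulr1) !mulrA.
  by zmod.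
pose n := Num.bound ((c * e) ^- 2).
have [y Sy xy] := xn n; exists y => //; rewrite -xy.
have -> : x - (x - xs n) = xs n by zmod.
rewrite mnorm_sq -rnorm_iota gn.
(* Splitting <x,x> as (<x,x> + i) - i, the contraction r leaves the first norm as bound and the
   second term tends to 0. *)
have -> : r ^+ n * iota (inner D x x) * r ^+ n =
    r ^+ n * iota (inner D x x + i) * r ^+ n - r ^+ n * (iota i * r ^+ n).
  by rewrite iotaD mulrDr mulrDl !mulrA; zmod.
apply: le_trans (rnormB _ _) _; apply: lerD.
  rewrite -rnorm_iota; set g := iota _.
  have := normUM (r ^+ n * g) (r ^+ n); have := normUM (r ^+ n) g.
  have := normUX1 n r1; have := rnorm_ge0 g; have := rnorm_ge0 (r ^+ n).
  have := rnorm_ge0 (r ^+ n * g); nra.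
apply: (@le_trans _ _ (rnorm (iota i * r ^+ n))).
  have := normUM (r ^+ n) (iota i * r ^+ n); have := normUX1 n r1.
  have := rnorm_ge0 (iota i * r ^+ n); have := rnorm_ge0 (r ^+ n); nra.
have := rnorm_pow_sub_mul n js j1; rewrite -/h -/r {1}/j iotaZ scalAl rnormZr ?(ltW c0)//.
set z := rnorm _; have z0 : 0 <= z := rnorm_ge0 _ => hz.
have ce0 : 0 < (c * e) ^+ 2 by rewrite exprn_gt0// mulr_gt0.
have nb : (c * e) ^- 2 < n%:R by apply: archi_boundP; rewrite invr_ge0 ltW.
have nb1 : 1 < n%:R * (c * e) ^+ 2 by rewrite -ltr_pdivrMr// div1r.
rewrite leNgt; apply/negP => ez.
have : (c * e) ^+ 2 <= (c * z) ^+ 2.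
  by rewrite ler_pXn2r ?nnegrE ?mulr_ge0 ?(ltW c0) ?(ltW e0)// ler_pM2l// ltW.
by move=> /(ler_wpM2l (ler0n R n)); lra.
Qed.

End Module.
End Multiplier.

(** * Quotients by ideals *)

(** For i = - <x,x> the main term of [quot_approx] vanishes. The resulting x ~ y <x,x> with y in S
    replaces an exact factorization. *)
Lemma approx_unit (R : realType) (A : completeNormedModType R[i]) (cA : cstar A)
    (X : lmodType R[i]) (D : moduleData A X) (H : hmod cA D) (S : X -> Prop)
    (x : X) (e : R) :
  (forall k y z, S y -> S z -> S (k *: y + z)) ->
  (forall y a, S y -> S (act D y a)) -> S x -> 0 < e ->
  exists2 y, S y & mnorm D (x - act D y (inner D x x)) <= e.
Proof.
move=> Sl Sa Sx e0.
have ia : cadj cA (- inner D x x) = - inner D x x by rewrite cadjN (hinner_adj H).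
have [y Sy h] := quot_approx H Sl Sa Sx ia (exprn_gt0 2 e0).
(* This is - y, written with the only closure property of S at hand. *)
exists (-1 *: y + (-1 *: y + y)); first by apply: (Sl) => //; exact: Sl.
rewrite scaleN1r addNr addr0 (actNl H) -(actNr H); apply: ler_of_sqr (ltW e0) _.
by move: h; rewrite subrr rnorm0 add0r.
Qed.

Lemma approx_unit0 (R : realType) (A : completeNormedModType R[i]) (cA : cstar A)
    (X : lmodType R[i]) (D : moduleData A X) (H : hmod cA D) (x : X) (e : R) :
  0 < e -> exists y, mnorm D (x - act D y (inner D x x)) <= e.
Proof.
move=> e0; have [y _ h] := @approx_unit _ _ _ _ _ H (fun=> True) x e
  (fun _ _ _ _ _ => Logic.I) (fun _ _ _ => Logic.I) Logic.I e0.
by exists y.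
Qed.

Lemma half_double (R : realType) (V : lmodType R[i]) (z : V) :
  (2^-1)%:C%C *: (z *+ 2) = z.
Proof.
have h : (2^-1 : R)%:C%C + (2^-1 : R)%:C%C = 1 :> R[i].
  by rewrite -rmorphD -[RHS]/((1 : R)%:C%C); congr (_%:C%C); field.
by rewrite mulr2n scalerDr -scalerDl h scale1r.
Qed.

Section QuotientNorm.
Context {R : realType} {V : completeNormedModType R[i]} (I : closedSubspace V).

Lemma rnorm_qpi (x : V) : rnorm (qpi I x) <= rnorm x.
Proof. by rewrite -lecR !rnormE; exact: quotient_norm_le. Qed.

Lemma qpi_lift (u : quotient_type I) (e : R) : 0 < e ->
  exists2 x, qpi I x = u & rnorm x <= rnorm u + e.
Proof.
move=> e0; have : quotient_norm u < (rnorm u + e)%:C%C.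
  by rewrite -[quotient_norm u]/(`|u|) -rnormE ltcR ltrDl.
by move=> /quotient_norm_lt[x xu xe]; exists x => //; rewrite ltW// -ltcR rnormE.
Qed.

End QuotientNorm.

Section Ideal.
Context {R : realType} {A : completeNormedModType R[i]} (cA : cstar A).
Variables (I : closedSubspace A) (hI : two_sided_ideal cA I).
Notation "a ∙ b" := (cmul cA a b) (at level 40, left associativity).
Notation "a ^†" := (cadj cA a) (at level 2, format "a ^†").

(** x^* is a limit of products y x x^*, which lie in I. *)
Lemma ideal_adj x : I x -> I x^†.
Proof.
move=> Ix; apply: cs_limit => e e0.
have [y h] := approx_unit0 (selfmod_hmod cA) x^† e0.
exists (y ∙ (x ∙ x^†)); first exact: (hI _ (hI _ Ix).2).1.
by rewrite -(selfmod_mnorm cA); move: h; rewrite /= cadjK.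
Qed.

Definition qmul (u v : quotient_type I) := qpi I (qrepr u ∙ qrepr v).
Definition qadj (u : quotient_type I) := qpi I (qrepr u)^†.

Lemma qreprP (a : A) : I (qrepr (qpi I a) - a).
Proof. by apply/qpi_eq; rewrite qreprK. Qed.

Lemma qmulE a b : qmul (qpi I a) (qpi I b) = qpi I (a ∙ b).
Proof.
apply/qpi_eq; set a' := qrepr _; set b' := qrepr _.
have -> : a' ∙ b' - a ∙ b = (a' - a) ∙ b' + a ∙ (b' - b).
  by rewrite cmulBl cmulBr; zmod.
by apply: csD; [apply: (hI _ _).2|apply: (hI _ _).1]; exact: qreprP.
Qed.

Lemma qadjE a : qadj (qpi I a) = qpi I a^†.
Proof. by apply/qpi_eq; rewrite -cadjB; apply: ideal_adj; exact: qreprP. Qed.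

Lemma qmul_norm u v : rnorm (qmul u v) <= rnorm u * rnorm v.
Proof.
have u0 := rnorm_ge0 u; have v0 := rnorm_ge0 v.
(* For d = e / M one has d <= 1, so (|u| + d)(|v| + d) exceeds |u| |v| by at most d M = e. *)
apply/ler_addgt0Pr => e e0; pose M := rnorm u + rnorm v + 1 + e.
have M0 : 0 < M by rewrite /M; lra.
pose d := e / M; have d0 : 0 < d by rewrite divr_gt0.
have dM : d * M = e by rewrite /d divfK// gt_eqF.
have [a au ad] := qpi_lift u d0; have [b bv bd] := qpi_lift v d0.
rewrite -{1}au -{1}bv qmulE; apply: le_trans (rnorm_qpi _ _) _; apply: le_trans (rnormM _ _ _) _.
have d1 : d <= 1 by rewrite /d ler_pdivrMr// mul1r /M; lra.
have := rnorm_ge0 a; have := rnorm_ge0 b.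
set x := rnorm a in ad *; set y := rnorm b in bd *; move=> y0 x0.
have : x * y <= (rnorm u + d) * (rnorm v + d) by apply: ler_pM.
by rewrite /M in dM; nra.
Qed.

Lemma qadj_norm (u : quotient_type I) : rnorm (qadj u) <= rnorm u.
Proof.
apply/ler_addgt0Pr => e e0; have [a au ad] := qpi_lift u e0.
by rewrite -{1}au qadjE; apply: le_trans (rnorm_qpi _ _) _; rewrite rnorm_adj.
Qed.

(** Lift the class of <x,x> to b of nearly minimal norm. The self-adjoint part i of b - <x,x> lies
    in I, and <x,x> + i is the self-adjoint part of b, of norm at most |b|. *)
Lemma quot_inner_approx (X : lmodType R[i]) (D : moduleData A X) (H : hmod cA D)
    (x : X) (e : R) : 0 < e -> exists y i, I i /\
  mnorm D (x - act D y i) ^+ 2 <= rnorm (qpi I (inner D x x)) + e.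
Proof.
move=> e0; have e20 : 0 < e / 2 by lra.
set a := inner D x x; have as_ : a^† = a by rewrite (hinner_adj H).
have [b ba bn] := qpi_lift (qpi I a) e20.
have Ib : I (b - a) by apply/qpi_eq.
pose i := (2^-1)%:C%C *: ((b - a) + (b - a)^†).
have ia : i^† = i by rewrite /i cadjZr cadjD cadjK addrC.
have Ii : I i by apply/csZ/csD => //; exact: ideal_adj.
have [y _] := @quot_approx _ _ _ _ _ H (fun=> True) x i _
  (fun _ _ _ _ _ => Logic.I) (fun _ _ _ => Logic.I) Logic.I ia e20.
have -> : inner D x x + i = (2^-1)%:C%C *: (b + b^†).
  rewrite -/a /i cadjB as_ -{1}(half_double a) -scalerDr.
  by congr (_ *: _); zmod.
rewrite rnormZr ?invr_ge0// => h; exists y, i; split=> //.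
have := rnormD b b^†; rewrite rnorm_adj; lra.
Qed.

Lemma qadj_normM u : rnorm (qmul (qadj u) u) = rnorm u ^+ 2.
Proof.
apply/eqP; rewrite eq_le; apply/andP; split.
  apply: le_trans (qmul_norm _ _) _; rewrite expr2 ler_wpM2r ?rnorm_ge0//.
  exact: qadj_norm.
apply/ler_addgt0Pr => e e0.
have [a au] : exists a, qpi I a = u by exists (qrepr u); exact: qreprK.
(* A is regarded as a module over itself; y i lies in I, so it does not change the class of a. *)
have [y [i [Ii]]] := quot_inner_approx (selfmod_hmod cA) a e0.
rewrite selfmod_mnorm -au qadjE qmulE; apply: le_trans.
rewrite ler_pXn2r ?nnegrE ?rnorm_ge0//.
have -> : qpi I a = qpi I (a - act (selfmod cA) y i); last exact: rnorm_qpi.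
by apply/qpi_eq; rewrite opprB addrC subrK; exact: (hI _ Ii).1.
Qed.

Definition quot_cstar : cstar (quotient_type I).
Proof.
refine (@CStar R (quotient_type I) qmul qadj _ _ _ _ _ _ _ _).
- by move=> a b c; rewrite -(qreprK a) -(qreprK b) -(qreprK c) !qmulE cmulA.
- move=> k a b c; rewrite -(qreprK a) -(qreprK b) -(qreprK c).
  by rewrite -qpi_linear !qmulE cmul_linl qpi_linear.
- move=> k a b c; rewrite -(qreprK a) -(qreprK b) -(qreprK c).
  by rewrite -qpi_linear !qmulE cmul_linr qpi_linear.
- move=> k a b; rewrite -(qreprK a) -(qreprK b).
  by rewrite -qpi_linear !qadjE cadj_lin qpi_linear.
- by move=> a b; rewrite -(qreprK a) -(qreprK b) !(qadjE, qmulE) cadjM.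
- by move=> a; rewrite -(qreprK a) !qadjE cadjK.
- by move=> a b; rewrite -!rnormE -rmorphM lecR; exact: qmul_norm.
- by move=> a; rewrite -!rnormE -rmorphXn; congr (_%:C%C); exact: qadj_normM.
Defined.

Lemma quot_cmul a b : cmul quot_cstar (qpi I a) (qpi I b) = qpi I (a ∙ b).
Proof. exact: qmulE. Qed.

Lemma quot_cadj a : cadj quot_cstar (qpi I a) = qpi I a^†.
Proof. exact: qadjE. Qed.

Lemma quot_star_morphism : star_morphism cA quot_cstar (qpi I).
Proof.
split; [exact: qpi_linear| |] => *; apply/esym; [exact: qmulE|exact: qadjE].
Qed.

End Ideal.

Section SubAlgebra.
Context {R : realType} {A : completeNormedModType R[i]} (cA : cstar A).
Variable S : closedSubspace A.
Hypothesis Smul : forall a b, S a -> S b -> S (cmul cA a b).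
Hypothesis Sadj : forall a, S a -> S (cadj cA a).

Lemma svS (a : subspace_type S) : S (sv a).
Proof. by apply/cs_predP; case: a. Qed.

Definition mk_sub (a : A) (Sa : S a) : subspace_type S :=
  Subspace (introT (cs_predP S a) Sa).

Definition sub_mul (a b : subspace_type S) := mk_sub (Smul (svS a) (svS b)).
Definition sub_adj (a : subspace_type S) := mk_sub (Sadj (svS a)).

Definition sub_cstar : cstar (subspace_type S).
Proof.
refine (@CStar R _ sub_mul sub_adj _ _ _ _ _ _ _ _).
- by move=> a b c; apply/val_inj; exact: cmulA.
- by move=> k a b c; apply/val_inj; exact: cmul_linl.
- by move=> k a b c; apply/val_inj; exact: cmul_linr.
- by move=> k a b; apply/val_inj; exact: cadj_lin.
- by move=> a b; apply/val_inj; exact: cadjM.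
- by move=> a; apply/val_inj; exact: cadjK.
- by move=> a b; exact: (cnormM cA).
- by move=> a; exact: (cnorm_adjM cA).
Defined.

End SubAlgebra.

Lemma closed_span_map (R : realType) (V W : completeNormedModType R[i]) (f : V -> W)
    (M : R) (S : set V) (T : closedSubspace W) :
  linear f -> (forall x, rnorm (f x) <= M * rnorm x) -> (forall s, S s -> T (f s)) ->
  forall x, closed_span S x -> T (f x).
Proof.
move=> fl fM ST x Sx; apply: cs_limit => e e0.
have M0 : 0 < `|M| + 1 by rewrite ltr_wpDl.
have [y Sy xy] := span_approx Sx (divr_gt0 e0 M0).
exists (f y).
  apply: (@lspan_ind _ _ _ (fun y => T (f y)) _ _ _ _ Sy) => [|k a b Ta Tb|s Ss]; last exact: ST.
    have -> : f 0 = 0 by have := fl (-1) 0 0; rewrite scaler0 addr0 scaleN1r addNr.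
    exact: cs_set0.
  by rewrite fl; exact: cs_lin.
have -> : f x - f y = f (x - y).
  by have := fl (-1) y x; rewrite !scaleN1r ![- _ + _]addrC => ->.
apply: le_trans (fM _) _; rewrite ler_pdivlMr// in xy.
have := ler_norm M; have := rnorm_ge0 (x - y); nra.
Qed.

(** * Hilbert modules: reduction, direct sum and quotient *)

Section HilbertModule.
Context {R : realType} {A : completeNormedModType R[i]} {cA : cstar A}.
Context {X : completeNormedModType R[i]} (H : hilbertModule cA X).

Lemma hilb_mnorm x : mnorm H x = rnorm x.
Proof.
apply: mnorm_sqE; first exact: rnorm_ge0.
by apply: complexI; rewrite rmorphXn /= !rnormE (inner_norm H).
Qed.

Lemma hilb_hmod : hmod cA H.
Proof.
constructor.
- exact: act_cmul.
- exact: act_linl.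
- exact: act_linr.
- exact: inner_linr.
- exact: inner_act.
- exact: inner_adj.
- exact: inner_pos.
- move=> x x0; apply: rnorm_eq0; rewrite -hilb_mnorm /mnorm x0 normr0 /=.
  by rewrite sqrtr0.
Qed.

Lemma hilb_complete : mcomplete H.
Proof.
move=> u d d0 ud; have [n m nm|l ul] := @rnorm_complete _ _ u d d0.
  by rewrite -hilb_mnorm ud.
by exists l => n; rewrite hilb_mnorm; exact: ul.
Qed.

Lemma hilb_inner_norm x : rnorm (inner H x x) = rnorm x ^+ 2.
Proof. by rewrite -hilb_mnorm mnorm_sq. Qed.

Lemma hilb_act_norm x a : rnorm (act H x a) <= rnorm x * rnorm a.
Proof. by rewrite -!hilb_mnorm; exact: (mnorm_act hilb_hmod). Qed.

Lemma hilb_CS x y : rnorm (inner H x y) <= rnorm x * rnorm y.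
Proof. by rewrite -!hilb_mnorm; exact: (hmod_CS hilb_hmod). Qed.

Lemma hilb_approx x (e : R) : 0 < e -> exists y, rnorm (x - act H y (inner H x x)) <= e.
Proof.
by move=> e0; have [y h] := approx_unit0 hilb_hmod x e0; exists y; rewrite -hilb_mnorm.
Qed.

End HilbertModule.

Section ReducedModule.
Context {R : realType} {B : completeNormedModType R[i]} {cB : cstar B}.
Context {E : completeNormedModType R[i]} (H : hilbertModule cB E).

(** The root a of <x,x> may lie outside B_E; the norm bound it implies restricts to B_E and yields a
    root there. *)
Lemma reduced_inner_pos x :
  exists a, inner (reduced H) x x = cmul (BE_cstar H) (cadj (BE_cstar H) a) a.
Proof.
have [a ha] := inner_pos H x; set h := inner (reduced H) x x.
have hs : cadj (BE_cstar H) h = h by apply: val_inj; exact: (inner_adj H).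
have [|c cs hc] := @sqrt_of_norm_bound _ _ (BE_cstar H) h (rnorm h) hs (rnorm_ge0 _).
  move=> b; have := @sq_norm_bound _ _ cB a (rnorm h) _ (sv b).
  rewrite -ha; apply; exact: lexx.
by exists c; rewrite cs.
Qed.

Definition reduced_hilbert : hilbertModule (BE_cstar H) E.
Proof.
refine (@HilbertModule R (BE H) (BE_cstar H) E (reduced H) _ _ _ _ _ _ _ _).
- by move=> x a b; exact: act_cmul.
- by move=> k x y a; exact: act_linl.
- by move=> k x a b; exact: act_linr.
- by move=> k x y z; apply: val_inj; exact: inner_linr.
- by move=> x y a; apply: val_inj; exact: inner_act.
- by move=> x y; apply: val_inj; exact: inner_adj.
- exact: reduced_inner_pos.
- by move=> x; exact: (inner_norm H).
Defined.

Lemma reduced_full : full (reduced H).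
Proof.
move=> a; apply: cs_limit => e e0.
have [y Sy ay] := span_approx (Defs.svP (a := a)) e0.
have [b [by_ Sb]] : exists b : BE H, sv b = y /\
    lspan [set inner (reduced H) x y | x in setT & y in setT] b.
  apply: (@lspan_ind _ _ _ (fun y => exists b : BE H, sv b = y /\
      lspan [set inner (reduced H) x y | x in setT & y in setT] b) _ _ _ _ Sy).
  - by exists 0; split; [by []|exact: lspan0].
  - move=> k x z [b [<- Sb]] [c [<- Sc]]; exists (k *: b + c); split=> //.
    exact: lspan_lin.
  - move=> _ [x _ [z _ <-]]; exists (inner (reduced H) x z); split=> //.
    by apply: sub_lspan; exists x => //; exists z.
exists b; first exact: subset_closure.
by move: ay; rewrite -by_.
Qed.

End ReducedModule.

Section DirectSum.
Context {R : realType} {A : completeNormedModType R[i]} {cA : cstar A}.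
Context {X : lmodType R[i]} {D : moduleData A X} (H : hmod cA D).
Notation F := (dirsum cA D).

(** Adding the positive term <u.2, u.2> cannot decrease the norm of a square. *)
Lemma dirsum_inner_ge1 (u : A * X) : rnorm u.1 <= mnorm F u.
Proof.
apply: ler_of_sqr; first exact: mnorm_ge0.
have [b hb] := hinner_pos H u.2.
by rewrite mnorm_sq /= hb -(rnorm_adjM cA); exact: sq_norm_mono.
Qed.

Lemma dirsum_inner_ge2 (u : A * X) : mnorm D u.2 <= mnorm F u.
Proof.
apply: ler_of_sqr; first exact: mnorm_ge0.
have [b hb] := hinner_pos H u.2.
by rewrite !mnorm_sq /= hb addrC; exact: sq_norm_mono.
Qed.

Lemma dirsum_mnorm_le (u : A * X) : mnorm F u <= rnorm u.1 + mnorm D u.2.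
Proof.
have h1 := rnorm_ge0 u.1; have h2 := mnorm_ge0 D u.2.
apply: mnorm_le; first lra.
rewrite /=; apply: le_trans (rnormD _ _) _; rewrite rnorm_adjM -mnorm_sq; nra.
Qed.

Lemma dirsum_hmod : hmod cA F.
Proof.
have cs : cauchy_schwarz D := hmod_CS H.
constructor.
- by move=> u a b; rewrite /= cmulA (hact_cmul H).
- by move=> k u v a; rewrite /= cmul_linl (hact_linl H).
- by move=> k u a b; rewrite /= cmul_linr (hact_linr H).
- by move=> k u v w; rewrite /= cmul_linr (hinner_linr H) scalerDr; zmod.
- by move=> u v a; rewrite /= cmulDl cmulA (hinner_act H).
- by move=> u v; rewrite /= cadjD cadjM cadjK (hinner_adj H).
- by move=> u; have [b hb] := hinner_pos H u.2; rewrite /= hb; exact: sum_sq.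
- move=> [a x] u0; have m0 : mnorm F (a, x) = 0 by rewrite /mnorm u0 normr0 /= sqrtr0.
  have := dirsum_inner_ge1 (a, x); have := dirsum_inner_ge2 (a, x); rewrite m0 /=.
  move=> h1 h2; congr (_, _).
    by apply: rnorm_eq0; apply/eqP; rewrite eq_le h2 rnorm_ge0.
  by apply: (mnorm_eq0 H); apply/eqP; rewrite eq_le h1 mnorm_ge0.
Qed.

Lemma dirsum_complete : mcomplete D -> mcomplete F.
Proof.
move=> HC u d d0 ud; have HF := dirsum_hmod; have CS := hmod_CS HF.
have [n m nm|a au] := @rnorm_complete _ _ (fst \o u) d d0.
  exact: le_trans (dirsum_inner_ge1 (u n - u m)) (ud _ _ nm).
have [n m nm|x xu] := HC (snd \o u) d d0.
  exact: le_trans (dirsum_inner_ge2 (u n - u m)) (ud _ _ nm).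
exists (a, x) => n; apply/ler_addgt0Pr => e e0.
(* Coordinatewise limits alone would double the modulus. Passing through a late term m costs only 4
   [d k] < e. *)
have [k dk] := d0 _ (divr_gt0 e0 (ltr0n R 4)).
pose m := maxn n k; have km : (k <= m)%N by rewrite leq_maxr.
apply: le_trans (mnorm_dist3 HF CS _ (u m) _) _.
apply: lerD; first by apply: ud; rewrite leq_maxl.
apply: (@le_trans _ _ (rnorm ((u m).1 - a) + mnorm D ((u m).2 - x))).
  exact: dirsum_mnorm_le.
have h1 := rnorm_dist3 (u m).1 (u k).1 a.
have h2 := mnorm_dist3 H (hmod_CS H) (u m).2 (u k).2 x.
have h3 : rnorm ((u k).1 - (u m).1) <= d k := le_trans (dirsum_inner_ge1 (u k - u m)) (ud _ _ km).
have h4 : mnorm D ((u k).2 - (u m).2) <= d k := le_trans (dirsum_inner_ge2 (u k - u m)) (ud _ _ km).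
rewrite [rnorm (_ - (u k).1)]rdistC in h1; rewrite (mdistC H (u m).2 (u k).2) in h2.
have h5 : rnorm ((u k).1 - a) <= d k := au k.
have h6 : mnorm D ((u k).2 - x) <= d k := xu k.
lra.
Qed.

End DirectSum.

Section QuotientModule.
Context {R : realType} {A : completeNormedModType R[i]} {cA : cstar A}.
Context {X : completeNormedModType R[i]} (H : hilbertModule cA X).
Variables (K : closedSubspace X) (hK : ternary_ideal H K).
Notation HX := (hilb_hmod H).
Notation BK := (inner_span H (cs_set K)).

(** From k ~ y <k,k> follows k a ~ y <k, k a>, a ternary product with k in the middle. *)
Lemma ternary_ideal_act k a : K k -> K (act H k a).
Proof.
move=> Kk; apply: cs_limit => e e0.
have a1 : 0 < rnorm a + 1 by rewrite ltr_wpDl// rnorm_ge0.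
have [y h] := hilb_approx H k (divr_gt0 e0 a1).
exists (act H y (inner H k (act H k a))); first exact: hK.
rewrite (hinner_act HX) (hact_cmul HX) -(actBl HX).
apply: le_trans (hilb_act_norm H _ _) _; rewrite ler_pdivlMr// in h.
have := rnorm_ge0 (k - act H y (inner H k k)); lra.
Qed.

Lemma inner_span_sub k l : K k -> K l -> BK (inner H k l).
Proof. by move=> Kk Kl; apply: sub_closed_span; exists k => //; exists l. Qed.

Lemma act_inner_span x b : BK b -> K (act H x b).
Proof.
apply: (closed_span_map (M := rnorm x)) => [k a c|a|].
- exact: (hact_linr HX).
- exact: hilb_act_norm.
- by move=> _ [k Kk [l _ <-]]; exact: hK.
Qed.

(** From k ~ y <k,k> follows <x,k> ~ <x,y> <k,k> = <k <y,x>, k>, with both entries in K. *)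
Lemma inner_inner_span x k : K k -> BK (inner H x k).
Proof.
move=> Kk; apply: cs_limit => e e0.
have x1 : 0 < rnorm x + 1 by rewrite ltr_wpDl// rnorm_ge0.
have [y h] := hilb_approx H k (divr_gt0 e0 x1).
exists (inner H (act H k (inner H y x)) k).
  by apply: inner_span_sub => //; exact: ternary_ideal_act.
rewrite (inner_actl HX) (hinner_adj HX) -(hinner_act HX) -(innerBr HX).
apply: le_trans (hilb_CS H _ _) _; rewrite ler_pdivlMr// in h.
have := rnorm_ge0 (k - act H y (inner H k k)); lra.
Qed.

Lemma inner_span_adj b : BK b -> BK (cadj cA b).
Proof.
move=> Sb; apply: cs_limit => e e0; have [y Sy by_] := span_approx Sb e0.
exists (cadj cA y); last by rewrite -cadjB rnorm_adj.
apply: (@lspan_ind _ _ _ (fun y => BK (cadj cA y)) _ _ _ _ Sy).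
- by rewrite cadj0; exact: cs_set0.
- by move=> k a c Ka Kc; rewrite cadj_lin; exact: cs_lin.
- by move=> _ [k Kk [l Kl <-]]; rewrite (hinner_adj HX); exact: inner_span_sub.
Qed.

Lemma inner_inner_span_l x k : K k -> BK (inner H k x).
Proof.
by move=> Kk; rewrite -(hinner_adj HX); apply: inner_span_adj; exact: inner_inner_span.
Qed.

Lemma inner_span_ideal : two_sided_ideal cA BK.
Proof.
have r S T : BK T -> BK (cmul cA T S).
  apply: (closed_span_map (f := fun a => cmul cA a S) (M := rnorm S)) => [k a c|a|].
  - exact: cmul_linl.
  - by rewrite mulrC; exact: rnormM.
  move=> _ [k Kk [l Kl <-]]; rewrite -(hinner_act HX); apply: inner_span_sub => //.
  exact: ternary_ideal_act.
move=> S T BT; split; last exact: r.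
by rewrite -[cmul _ _ _](cadjK cA) cadjM; apply: inner_span_adj; apply: r; exact: inner_span_adj.
Qed.

Notation cQ := (quot_cstar inner_span_ideal).
Notation p := (qpi BK).
Notation q := (qpi K).

Definition quot_act (u : quotient_type K) (b : quotient_type BK) : quotient_type K :=
  q (act H (qrepr u) (qrepr b)).
Definition quot_inner (u v : quotient_type K) : quotient_type BK :=
  p (inner H (qrepr u) (qrepr v)).

Lemma quot_actE x b : quot_act (q x) (p b) = q (act H x b).
Proof.
apply/qpi_eq; set x' := qrepr _; set b' := qrepr _.
have -> : act H x' b' - act H x b = act H (x' - x) b' + act H x (b' - b).
  by rewrite (actBl HX) (actBr HX); zmod.
by apply: csD; [apply: ternary_ideal_act|apply: act_inner_span]; exact: qreprP.
Qed.

Lemma quot_innerE x y : quot_inner (q x) (q y) = p (inner H x y).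
Proof.
apply/qpi_eq; set x' := qrepr _; set y' := qrepr _.
have -> : inner H x' y' - inner H x y = inner H (x' - x) y' + inner H x (y' - y).
  by rewrite (innerBl HX) (innerBr HX); zmod.
by apply: csD; [apply: inner_inner_span_l|apply: inner_inner_span]; exact: qreprP.
Qed.

(** One inequality moves a representative by y i in K as in [quot_inner_approx]; the other lifts u
    with nearly minimal norm. *)
Lemma quot_inner_norm u : rnorm u ^+ 2 = rnorm (quot_inner u u).
Proof.
have [x xu] : exists x, q x = u by exists (qrepr u); exact: qreprK.
apply/eqP; rewrite eq_le; apply/andP; split.
  apply/ler_addgt0Pr => e e0.
  have [y [i [Ii]]] := quot_inner_approx inner_span_ideal HX x e0.
  rewrite hilb_mnorm -xu quot_innerE; apply: le_trans.
  rewrite ler_pXn2r ?nnegrE ?rnorm_ge0//.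
  have -> : q x = q (x - act H y i); last exact: rnorm_qpi.
  by apply/qpi_eq; rewrite opprB addrC subrK; exact: act_inner_span.
rewrite -[leLHS]sqr_sqrtr ?rnorm_ge0// ler_pXn2r ?nnegrE ?rnorm_ge0 ?sqrtr_ge0//.
apply/ler_addgt0Pr => e e0; have [y yu yn] := qpi_lift u e0.
apply: ler_of_sqr; first by rewrite addr_ge0 ?rnorm_ge0// ltW.
rewrite sqr_sqrtr ?rnorm_ge0// -{1 2}yu quot_innerE; apply: le_trans (rnorm_qpi _ _) _.
by rewrite hilb_inner_norm ler_pXn2r ?nnegrE ?rnorm_ge0 ?addr_ge0 ?rnorm_ge0 ?(ltW e0).
Qed.

Definition quot_hilbert : hilbertModule cQ (quotient_type K).
Proof.
refine (@HilbertModule R _ cQ _ (ModuleData quot_act quot_inner) _ _ _ _ _ _ _ _) => /=.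
- move=> x a b; rewrite -(qreprK x) -(qreprK a) -(qreprK b).
  by rewrite (qmulE inner_span_ideal) !quot_actE (hact_cmul HX).
- move=> k x y a; rewrite -(qreprK x) -(qreprK y) -(qreprK a).
  by rewrite -qpi_linear !quot_actE (hact_linl HX) qpi_linear.
- move=> k x a b; rewrite -(qreprK x) -(qreprK a) -(qreprK b).
  by rewrite -qpi_linear !quot_actE (hact_linr HX) qpi_linear.
- move=> k x y z; rewrite -(qreprK x) -(qreprK y) -(qreprK z).
  by rewrite -qpi_linear !quot_innerE (hinner_linr HX) qpi_linear.
- move=> x y a; rewrite -(qreprK x) -(qreprK y) -(qreprK a).
  by rewrite quot_actE !quot_innerE (qmulE inner_span_ideal) (hinner_act HX).
- move=> x y; rewrite -(qreprK x) -(qreprK y).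
  by rewrite !quot_innerE (qadjE inner_span_ideal) (hinner_adj HX).
- move=> x; rewrite -(qreprK x) quot_innerE; have [a ->] := hinner_pos HX (qrepr x).
  by exists (p a); rewrite (qadjE inner_span_ideal) (qmulE inner_span_ideal).
- by move=> x; rewrite -!rnormE -rmorphXn quot_inner_norm.
Defined.

Lemma quot_full : full H -> full quot_hilbert.
Proof.
move=> fH u; rewrite -(qreprK u); move: (qrepr u) (fH (qrepr u)).
apply: (closed_span_map (f := p) (M := 1)) => [|b|].
- exact: qpi_linear.
- by rewrite mul1r; exact: rnorm_qpi.
- move=> _ [x _ [y _ <-]]; rewrite -quot_innerE; apply: sub_closed_span.
  by exists (q x) => //; exists (q y).
Qed.

End QuotientModule.

(** * Compact operators *)

Section FiniteRank.
Context {R : realType} {A : completeNormedModType R[i]} {cA : cstar A}.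
Context {X : lmodType R[i]} {D : moduleData A X} (H : hmod cA D).
Notation CS := (hmod_CS H).

Definition finite_rank (K : set X) : set (X -> X) :=
  lspan [set rank1 D x y | x in K & y in K].

Lemma rank1_adj x y : adjoint_pair D (rank1 D x y) (rank1 D y x).
Proof. by move=> u v; rewrite /rank1 (inner_actl H) (hinner_act H) (hinner_adj H). Qed.

Lemma rank1_bound x y : op_bound D (rank1 D x y) (mnorm D x * mnorm D y).
Proof.
move=> u; apply: le_trans (mnorm_act H _ _) _; rewrite -mulrA ler_wpM2l ?mnorm_ge0//.
exact: CS.
Qed.

Lemma op_boundD (S T : X -> X) M N : op_bound D S M -> op_bound D T N ->
  op_bound D (S + T) (M + N).
Proof.
by move=> SM TN x; apply: le_trans (mnormD H CS _ _) _; rewrite mulrDl lerD.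
Qed.

Lemma op_boundN (S : X -> X) M : op_bound D S M -> op_bound D (- S) M.
Proof. by move=> SM x; rewrite (mnormN H). Qed.

Lemma op_bound_dist (S T U : X -> X) M N : op_bound D (S - T) M -> op_bound D (T - U) N ->
  op_bound D (S - U) (M + N).
Proof. by move=> SM TN; rewrite -(subrKA T); exact: op_boundD. Qed.

Lemma op_bound_distC (S T : X -> X) M : op_bound D (S - T) M -> op_bound D (T - S) M.
Proof. by rewrite -opprB => /op_boundN; rewrite opprK. Qed.

Lemma op_boundZ k (S : X -> X) M : op_bound D S M -> op_bound D (k *: S) (complex.Re `|k| * M).
Proof.
move=> SM x; rewrite (mnormZ H) -mulrA ler_wpM2l//.
by rewrite -ler0c RRe_real ?normr_ge0// ger0_real.
Qed.

Lemma op_bound_le (S : X -> X) M N : M <= N -> op_bound D S M -> op_bound D S N.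
Proof. by move=> MN SM x; apply: le_trans (SM x) _; rewrite ler_wpM2r ?mnorm_ge0. Qed.

Lemma op_bound_comp (S T : X -> X) M N : 0 <= M -> op_bound D S M -> op_bound D T N ->
  op_bound D (S \o T) (M * N).
Proof.
by move=> M0 SM TN x; apply: le_trans (SM _) _; rewrite -mulrA ler_wpM2l.
Qed.

Lemma op_bound_eq (S T : X -> X) :
  (forall e : R, 0 < e -> op_bound D (S - T) e) -> S = T.
Proof.
move=> h; apply/funext => x; apply/eqP; rewrite -subr_eq0; apply/eqP.
apply: (mnorm_small H) => e e0; have x1 : 0 < mnorm D x + 1 by rewrite ltr_wpDl ?mnorm_ge0.
apply: le_trans (h _ (divr_gt0 e0 x1) x) _.
by rewrite mulrAC ler_pdivrMr// ler_wpM2l ?(ltW e0)// lerDl.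
Qed.

Lemma finite_rank_adj (K : set X) f : finite_rank K f ->
  exists2 g, adjoint_pair D f g & finite_rank K g.
Proof.
apply: (@lspan_ind _ _ _ (fun f => exists2 g, adjoint_pair D f g & finite_rank K g)).
- by exists 0; [move=> x y; rewrite (inner0l H) (inner0r H)|exact: lspan0].
- move=> k f1 f2 [g1 h1 K1] [g2 h2 K2]; exists (k^* *: g1 + g2); last exact: lspan_lin.
  move=> x y; rewrite (innerDl H) (innerZl H) h1 h2.
  by rewrite (innerDr H) (innerZr H).
- move=> _ [x Kx [y Ky <-]]; exists (rank1 D y x); first exact: rank1_adj.
  by apply: sub_lspan; exists y => //; exists x.
Qed.

Lemma finite_rank_bound (K : set X) f : finite_rank K f -> exists M, op_bound D f M.
Proof.
apply: (@lspan_ind _ _ _ (fun f => exists M, op_bound D f M)).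
- by exists 0 => x; rewrite mul0r (mnorm0 H).
- by move=> k f1 f2 [M h1] [N h2]; eexists; apply: op_boundD h2; exact: op_boundZ h1.
- by move=> _ [x _ [y _ <-]]; eexists; exact: rank1_bound.
Qed.

Lemma finite_rank_compl (K K' : set X) T S f : adjoint_pair D T S ->
  (forall x, K x -> K' (T x)) -> (forall x, K x -> K' x) ->
  finite_rank K f -> finite_rank K' (T \o f).
Proof.
move=> TS KT KK'; have Tl := adjoint_lin H TS.
apply: (@lspan_ind _ _ _ (fun f => finite_rank K' (T \o f))).
- have -> : T \o (0 : X -> X) = 0; last exact: lspan0.
  by apply/funext => x /=; have := Tl (-1) 0 0; rewrite scaler0 addr0 scaleN1r addNr.
- move=> k f1 f2 h1 h2.
  have -> : T \o (k *: f1 + f2) = k *: (T \o f1) + (T \o f2); last exact: lspan_lin.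
  by apply/funext => x; exact: Tl.
- move=> _ [x Kx [y Ky <-]]; have -> : T \o rank1 D x y = rank1 D (T x) y.
    by apply/funext => u; rewrite /rank1 /= (adjoint_act H _ _ TS).
  by apply: sub_lspan; exists (T x); [exact: KT|exists y => //; exact: KK'].
Qed.

Lemma compact_span_sub (K : set X) f : finite_rank K f -> compact_span D K f.
Proof.
by move=> Kf e e0; exists f => //; rewrite subrr => x; rewrite (mnorm0 H) mulr_ge0 ?(ltW e0) ?mnorm_ge0.
Qed.

Lemma compact_span_limit (K : set X) f :
  (forall e : R, 0 < e -> exists2 g, compact_span D K g & op_bound D (f - g) e) ->
  compact_span D K f.
Proof.
move=> h e e0; have e20 : 0 < e / 2 by lra.
have [g Kg fg] := h _ e20; have [k Kk gk] := Kg _ e20.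
by exists k => //; apply: op_bound_le (op_bound_dist fg gk); lra.
Qed.

Lemma compact_span_lin (K : set X) k f g : compact_span D K f -> compact_span D K g ->
  compact_span D K (k *: f + g).
Proof.
move=> Kf Kg e e0; have e20 : 0 < e / 2 by lra.
pose m := complex.Re `|k|; have m0 : 0 <= m.
  by rewrite -ler0c RRe_real ?normr_ge0// ger0_real.
have m1 : 0 < m + 1 by lra.
have [f' Kf' ff] := Kf _ (divr_gt0 e20 m1); have [g' Kg' gg] := Kg _ e20.
exists (k *: f' + g'); first exact: lspan_lin.
have -> : k *: f + g - (k *: f' + g') = k *: (f - f') + (g - g').
  by rewrite scalerBr; zmod.
apply: op_bound_le (op_boundD (op_boundZ k ff) gg).
rewrite -/m -lerBrDr.
have -> : e - e / 2 = e / 2 by field.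
by rewrite mulrA ler_pdivrMr// mulrC ler_wpM2l ?(ltW e20)// lerDl.
Qed.

Lemma compact_spanD (K : set X) f g : compact_span D K f -> compact_span D K g ->
  compact_span D K (f + g).
Proof. by move=> Kf Kg; rewrite -[f]scale1r; exact: compact_span_lin. Qed.

(** An isometric image of a complete space is closed, so finite-rank operators in the range bring
    all their limits with them. *)
Lemma compact_span_complete (V : completeNormedModType R[i]) (rho : V -> X -> X) :
  linear rho -> (forall v, op_bound D (rho v) (rnorm v)) ->
  (forall v M, 0 <= M -> op_bound D (rho v) M -> rnorm v <= M) ->
  (forall f, finite_rank setT f -> exists v, rho v = f) ->
  forall f, compact_span D setT f -> exists v, rho v = f.
Proof.
move=> rl rb rn rf f Kf; pose d n : R := 2^-1 ^+ n.
have rB v w : rho (v - w) = rho v - rho w.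
  by have := rl (-1) w v; rewrite !scaleN1r ![- _ + _]addrC => ->.
have d0 n : 0 < d n by rewrite exprn_gt0// invr_gt0 ltr0n.
have /choice[v vP] n : exists v, op_bound D (f - rho v) (d n).
  by have [g Kg fg] := Kf _ (d0 n); have [v vg] := rf g Kg; exists v; rewrite vg.
have dn : null_seq (fun n => d n * 2).
  move=> e e0; have [|n dn] := @exp2_small _ (e / 2); first by rewrite divr_gt0.
  by exists n; rewrite -ltr_pdivlMr.
have [n m nm|l vl] := @rnorm_complete _ _ v _ dn.
  apply: rn; first by rewrite mulr_ge0// ltW.
  rewrite rB; apply: op_bound_le (op_bound_dist (op_bound_distC (vP n)) (vP m)).
  by have : d m <= d n := exp2_le nm; have := d0 n; lra.
exists l; apply: op_bound_eq => e e0.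
have [|n dn3] := @exp2_small _ (e / 3); first by rewrite divr_gt0.
have h := op_bound_dist (op_bound_distC (vP n)) (vP n).
have h2 : op_bound D (rho l - rho (v n)) (d n * 2).
  by rewrite -rB; apply: op_bound_le (rb _); rewrite rdistC.
apply: op_bound_le (op_bound_dist h2 (op_bound_distC (vP n))).
move: dn3; rewrite -/(d n); lra.
Qed.

End FiniteRank.

Arguments finite_rank {R A X} D K.

Section CompactsExist.
Context {R : realType} {A : completeNormedModType R[i]} {cA : cstar A}.
Context {X : lmodType R[i]} {D : moduleData A X} (H : hmod cA D) (HC : mcomplete D).
Notation T := (adjt H (hmod_CS H) HC).

Definition compact_adjt (f : T) : Prop := compact_span D setT (afun f).

Lemma compact_adjt_lin k (f g : T) :
  compact_adjt f -> compact_adjt g -> compact_adjt (k *: f + g).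
Proof. exact: (compact_span_lin H). Qed.

Lemma compact_adjt0 : compact_adjt 0.
Proof. by apply: (compact_span_sub H); exact: lspan0. Qed.

Lemma afun_rnorm (f : T) : op_bound D (afun f) (rnorm f).
Proof. exact: afun_bound. Qed.

Lemma compact_adjt_closed : closed (compact_adjt : set T).
Proof.
apply: limit_closed => f h; apply: (compact_span_limit H) => e e0.
have [g Kg fg] := h e e0; exists (afun g) => //.
exact: op_bound_le fg (afun_rnorm (f - g)).
Qed.

Definition compact_adjt_cs : closedSubspace T :=
  ClosedSubspace compact_adjt0 compact_adjt_lin compact_adjt_closed.

Lemma compact_adjt_mul (f g : T) : compact_adjt_cs f -> compact_adjt_cs g ->
  compact_adjt_cs (cmul (adjt_cstar H (hmod_CS H) HC) f g).
Proof.
move=> _ Kg e e0; have f1 : 0 < rnorm f + 1 by rewrite ltr_wpDl// rnorm_ge0.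
have [k Kk gk] := Kg _ (divr_gt0 e0 f1); exists (afun f \o k).
  exact: (finite_rank_compl H (adj_starP f) _ _ Kk).
have -> : afun (adj_comp f g) - (afun f \o k) = afun f \o (afun g - k).
  apply/funext => x /=; have := afun_lin f (-1) (k x) (afun g x).
  by rewrite !scaleN1r ![- _ + _]addrC => ->.
apply: op_bound_le (op_bound_comp (rnorm_ge0 f) (afun_rnorm f) gk).
by rewrite mulrA ler_pdivrMr// mulrC ler_wpM2l ?(ltW e0)// lerDl.
Qed.

Lemma compact_adjt_adj (f : T) : compact_adjt_cs f ->
  compact_adjt_cs (cadj (adjt_cstar H (hmod_CS H) HC) f).
Proof.
move=> Kf e e0; have [k Kk fk] := Kf e e0.
have [g kg Kg] := finite_rank_adj H Kk; exists g => //.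
apply: (adjoint_pair_bound (hmod_CS H) (ltW e0) _ fk) => x y.
by rewrite (innerBl H) kg adj_starP -(innerBr H).
Qed.

Lemma compacts_exist : exists (L : completeNormedModType R[i]) (cL : cstar L)
  (lam : L -> X -> X), is_compacts D cL lam.
Proof.
exists (subspace_type compact_adjt_cs : completeNormedModType R[i]).
exists (sub_cstar compact_adjt_mul compact_adjt_adj), (fun f => afun (sv f)).
split => //.
- by move=> f g fg; apply: val_inj; apply: val_inj.
- by move=> f x y; have := adj_starP (adj_star (sv f)) x y => ->; congr inner; congr afun; exact: (cadjK (adjt_cstar H (hmod_CS H) HC)).
- apply/seteqP; split=> [_ [f _ <-]|f Kf]; first exact: (svS f).
  have [v vf] : exists v : T, afun v = f.
    apply: (compact_span_complete H) Kf => //.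
    + exact: afun_rnorm.
    + by move=> v M M0 vM; exact: opnorm_le.
    + move=> g Kg; have [g' gg' _] := finite_rank_adj H Kg.
      by have [M gM] := finite_rank_bound H Kg; exists (adjt_of H (hmod_CS H) HC gg' gM).
  have cv : compact_adjt_cs v by rewrite /= /compact_adjt vf.
  by exists (mk_sub cv).
Qed.

End CompactsExist.

(** * Injective representations are isometric *)

Section Representation.
Context {R : realType} {A : completeNormedModType R[i]} {cA : cstar A}.
Context {X : lmodType R[i]} {D : moduleData A X} (H : hmod cA D).
Context {Q : completeNormedModType R[i]} {cQ : cstar Q} {rho : Q -> X -> X}.
Hypothesis rho_lin : linear rho.
Hypothesis rho_mul : forall S T, rho (cmul cQ S T) = rho S \o rho T.
Hypothesis rho_adj : forall T x y, inner D (rho (cadj cQ T) x) y = inner D x (rho T y).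

Lemma rep_adj T : adjoint_pair D (rho T) (rho (cadj cQ T)).
Proof. by move=> x y; rewrite -rho_adj cadjK. Qed.

Lemma repB S T : rho (S - T) = rho S - rho T.
Proof. by have := rho_lin (-1) T S; rewrite !scaleN1r ![- _ + _]addrC. Qed.

Lemma repD S T : rho (S + T) = rho S + rho T.
Proof. by have := rho_lin 1 S T; rewrite !scale1r. Qed.

Lemma rep0 : rho 0 = 0.
Proof. by rewrite -(subrr 0) repB subrr. Qed.

Lemma repZ k S : rho (k *: S) = k *: rho S.
Proof. by have := rho_lin k S 0; rewrite rep0 !addr0. Qed.

Lemma rep_linear T : linear (rho T).
Proof. exact: (adjoint_lin H (@rep_adj T)). Qed.

Lemma rep_act T x a : rho T (act D x a) = act D (rho T x) a.
Proof. exact: (adjoint_act H _ _ (@rep_adj T)). Qed.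

Hypothesis HC : mcomplete D.
Hypothesis rho_inj : injective rho.
Hypothesis rho_bound : forall T, op_bound D (rho T) (rnorm T).
Hypothesis rho_dense : forall T (e : R), 0 < e ->
  exists2 S, finite_rank D setT (rho S) & rnorm (T - S) <= e.
Hypothesis rho_finite : forall f, finite_rank D setT f -> exists T, rho T = f.

(* The square root r is taken in the C*-algebra of adjointable operators. *)
Lemma op_complement T (c : R) : op_bound D (rho T) c -> 0 <= c ->
  exists r, adjoint_pair D r r /\
    forall x, r (r x) = (c ^+ 2)%:C%C *: x - rho (cadj cQ T) (rho T x).
Proof.
move=> Tc c0; pose M := adjt_cstar H (hmod_CS H) HC.
pose a := adjt_of H (hmod_CS H) HC (@rep_adj T) Tc.
have aE : afun (adj_star a) = rho (cadj cQ T).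
  by rewrite (@adj_star_eq _ _ _ _ _ _ _ _ a (adjt_of H (hmod_CS H) HC (adjoint_pair_sym H (@rep_adj T))
    (adjoint_pair_bound (hmod_CS H) c0 (@rep_adj T) Tc)))//; exact: rep_adj.
have an : rnorm a <= c by exact: opnorm_le.
pose e := adj_id H (hmod_CS H) HC; have [e1 e2] := adj_id_unit H (hmod_CS H) HC.
pose h := (c ^+ 2)%:C%C *: e - cmul M (cadj M a) a.
have es : cadj M e = e by have := cadjM M e (cadj M e); rewrite e1 cadjK e1.
have hs : cadj M h = h by rewrite /h cadjB cadjZr cadjM cadjK es.
have [b|r rs hr] := sqrt_of_norm_bound (t := c ^+ 2) hs (sqr_ge0 c).
  rewrite /h cmulBl cmulZl e1; set z := cmul _ (cmul _ _ _) b.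
  have -> : (c ^+ 2)%:C%C *: b - ((c ^+ 2)%:C%C *: b - z) = z by zmod.
  apply: le_trans (rnormM _ _ _) _; rewrite ler_wpM2r ?rnorm_ge0// rnorm_adjM.
  by rewrite ler_pXn2r ?nnegrE ?rnorm_ge0.
exists (afun r); split.
  by have := adj_starP r; rewrite -[adj_star r]/(cadj M r) rs.
move=> x; have := congr1 (fun f => afun f x) hr => /= <-.
by rewrite -aE.
Qed.

Lemma rep_norm_mul T S (c : R) : op_bound D (rho T) c -> 0 <= c ->
  finite_rank D setT (rho S) -> rnorm (cmul cQ T S) <= c * rnorm S.
Proof.
move=> Tc c0 Sf; have [r [rr rT]] := op_complement Tc c0.
have [W hW] : exists W, rho W = r \o rho S.
  by apply: rho_finite; exact: (finite_rank_compl H rr _ _ Sf).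
have hWs : rho (cadj cQ W) = rho (cadj cQ S) \o r.
  apply/funext => x; apply: (inner_ext H) => y.
  by rewrite -rep_adj hW /= rr rep_adj.
(* Among operators this reads S^* (T^* T + r^2) S = c^2 S^* S; injectivity of [rho] brings it back
   to Q, where [sq_norm_mono] applies to the norm of Q. *)
have key : cmul cQ (cadj cQ (cmul cQ T S)) (cmul cQ T S) + cmul cQ (cadj cQ W) W =
    (c ^+ 2)%:C%C *: cmul cQ (cadj cQ S) S.
  apply: rho_inj; rewrite repD repZ cadjM !rho_mul hW hWs.
  apply/funext => x; rewrite /= -[LHS]/(_ + _) /=.
  set y := rho S x; have l := @rep_linear (cadj cQ S).
  have := l 1 (rho (cadj cQ T) (rho T y)) (r (r y)); rewrite !scale1r => <-.
  rewrite rT; have -> : forall u v : X, u + (v - u) = v by move=> u v; zmod.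
  have := l (c ^+ 2)%:C%C y 0; rewrite !addr0 => ->.
  by have := l (-1) 0 0; rewrite scaler0 addr0 scaleN1r addNr => ->; rewrite addr0.
have := sq_norm_mono cQ (cmul cQ T S) W.
rewrite key rnorm_adjM rnormZr ?sqr_ge0// rnorm_adjM -exprMn => h.
by apply: ler_of_sqr h; rewrite mulr_ge0// rnorm_ge0.
Qed.

(* Apply [rep_norm_mul] to finite-rank approximations S of T^*, using |T T^* | = |T|^2. *)
Lemma rep_norm_le T (c : R) : 0 <= c -> op_bound D (rho T) c -> rnorm T <= c.
Proof.
move=> c0 Tc; have [T0|Tn] := eqVneq (rnorm T) 0; first by rewrite T0.
have Tp : 0 < rnorm T by rewrite lt_def Tn rnorm_ge0.
rewrite -(ler_pM2r Tp) -expr2; apply/ler_addgt0Pr => e e0.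
(* The error enters once with factor c, through |S|, and once with factor |T|. *)
have M0 : 0 < c + rnorm T by lra.
have [S Sf TS] := rho_dense (cadj cQ T) (divr_gt0 e0 M0).
have := rnorm_adjM cQ (cadj cQ T); rewrite cadjK rnorm_adj => <-.
have -> : cmul cQ T (cadj cQ T) = cmul cQ T S + cmul cQ T (cadj cQ T - S).
  by rewrite cmulBr; zmod.
apply: le_trans (rnormD _ _) _.
have h1 := rep_norm_mul Tc c0 Sf; have h2 := rnormM cQ T (cadj cQ T - S).
have h3 : rnorm S <= rnorm T + e / (c + rnorm T).
  have -> : S = cadj cQ T - (cadj cQ T - S) by zmod.
  rewrite -{1}(rnorm_adj cQ T).
  by apply: le_trans (rnormB _ _) _; rewrite lerD2l.
have h4 := ler_wpM2l c0 h3; have h5 := ler_wpM2l (ltW Tp) TS.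
have h6 : (c + rnorm T) * (e / (c + rnorm T)) = e by rewrite mulrCA divff ?mulr1// gt_eqF.
set d := e / _ in h4 h5 h6; nra.
Qed.

Lemma is_compacts_of_rep : is_compacts D cQ rho.
Proof.
split => //.
- move=> T; rewrite -rnormE; congr (_%:C%C); apply/eqP; rewrite eq_le.
  rewrite (opnorm_le (rnorm_ge0 T) (@rho_bound T)) andbT.
  apply: rep_norm_le; first exact: opnorm_ge0.
  exact: (op_bound_opnorm (@rho_bound T)).
- apply/seteqP; split=> [_ [T _ <-]|f Kf].
    move=> e e0; have [S Sf TS] := rho_dense T e0; exists (rho S) => //.
    by rewrite -repB; exact: op_bound_le (@rho_bound _).
  have [v vf] := compact_span_complete H rho_lin rho_bound rep_norm_le rho_finite Kf.
  by exists v.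
Qed.

End Representation.

Section Compacts.
Context {R : realType} {A : completeNormedModType R[i]} {cA : cstar A}.
Context {X : lmodType R[i]} {D : moduleData A X} (H : hmod cA D).
Context {L : completeNormedModType R[i]} {cL : cstar L} {lam : L -> X -> X}.
Hypothesis hL : is_compacts D cL lam.

Lemma compacts_compact T : compact_span D setT (lam T).
Proof. by rewrite -(compacts_range hL); exists T. Qed.

Lemma compacts_ex f : compact_span D setT f -> exists T, lam T = f.
Proof. by rewrite -(compacts_range hL) => -[T _ <-]; exists T. Qed.

Lemma compacts_bound T : op_bound D (lam T) (rnorm T).
Proof.
have -> : rnorm T = opnorm D (lam T) by apply: complexI; rewrite rnormE (compacts_norm hL).
(* The operator norm is informative only for bounded operators; boundedness comes from a finite-rank
   operator at distance 1. *)
have [S Sf TS] := @compacts_compact T 1 ltr01.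
have [M SM] := finite_rank_bound H Sf.
by have := op_bound_opnorm (op_boundD H TS SM); rewrite subrK.
Qed.

Lemma compacts_norm_le T (c : R) : 0 <= c -> op_bound D (lam T) c -> rnorm T <= c.
Proof.
move=> c0 Tc; have -> : rnorm T = opnorm D (lam T).
  by apply: complexI; rewrite rnormE (compacts_norm hL).
exact: opnorm_le.
Qed.

Lemma compacts_dense T (e : R) : 0 < e ->
  exists2 S, finite_rank D setT (lam S) & rnorm (T - S) <= e.
Proof.
move=> e0; have [f Sf Tf] := compacts_compact T e0.
have [S lS] := compacts_ex (compact_span_sub H Sf).
exists S; first by rewrite lS.
apply: compacts_norm_le (ltW e0) _.
by rewrite (repB (compacts_lin hL)) lS.
Qed.

End Compacts.

(** * Linking algebras *)

(** |a|^4 = |a^4| <= |a| |a^3|, divided by |a|. Applied to a = <y,y>, it bounds |y <y,y>| below by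
    |y|^3. *)
Lemma rnorm_cube (R : realType) (A : completeNormedModType R[i]) (cA : cstar A) (a : A) :
  cadj cA a = a -> rnorm a ^+ 3 <= rnorm (cmul cA a (cmul cA a a)).
Proof.
move=> sa; have [->|an] := eqVneq (rnorm a) 0; first by rewrite expr0n rnorm_ge0.
have ap : 0 < rnorm a by rewrite lt_def an rnorm_ge0.
rewrite -(ler_pM2l ap) -exprS; have e1 : rnorm (cmul cA a a) = rnorm a ^+ 2.
  by rewrite -{1}sa rnorm_adjM.
have e2 : rnorm (cmul cA (cmul cA a a) (cmul cA a a)) = rnorm a ^+ 4.
  by have := rnorm_adjM cA (cmul cA a a); rewrite cadjM sa e1 -exprM.
by rewrite -e2 -cmulA; exact: rnormM.
Qed.

Section Block.
Context {R : realType} {A : completeNormedModType R[i]} {cA : cstar A}.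
Context {X : completeNormedModType R[i]} (H : hilbertModule cA X).
Notation HX := (hilb_hmod H).
Notation F := (dirsum cA H).
Notation HF := (dirsum_hmod HX).
Notation blk := (block cA H).

Lemma norm_fst (u : A * X) : rnorm u.1 <= mnorm F u.
Proof. exact: (dirsum_inner_ge1 HX). Qed.

Lemma norm_snd (u : A * X) : rnorm u.2 <= mnorm F u.
Proof. by rewrite -(hilb_mnorm H u.2); exact: (dirsum_inner_ge2 HX). Qed.

Lemma dirsum_norm_le (u : A * X) : mnorm F u <= rnorm u.1 + rnorm u.2.
Proof. by rewrite -(hilb_mnorm H u.2); exact: dirsum_mnorm_le. Qed.

Lemma mnorm_left a : mnorm F (a, 0) = rnorm a.
Proof.
by apply: mnorm_sqE; [exact: rnorm_ge0|rewrite /= (inner0r HX) addr0 rnorm_adjM].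
Qed.

Lemma mnorm_right x : mnorm F (0, x) = rnorm x.
Proof.
apply: mnorm_sqE; first exact: rnorm_ge0.
by rewrite /= cmul0r add0r hilb_inner_norm.
Qed.

Lemma blockD b x y t b' x' y' t' :
  blk b x y t + blk b' x' y' t' = blk (b + b') (x + x') (y + y') (t + t').
Proof.
apply/funext => u; rewrite /block -[LHS]/(_ + _) /=; congr (_, _) => /=.
  by rewrite cmulDl (innerDl HX); zmod.
by rewrite (actDl HX) -[(t + t') _]/(t _ + t' _); zmod.
Qed.

Lemma blockZ k b x y t :
  k *: blk b x y t = blk (k *: b) (k^* *: x) (k *: y) (k *: t).
Proof.
apply/funext => u; rewrite /block -[LHS]/(_ *: _) /=; congr (_, _) => /=.
  by rewrite cmulZl (innerZl HX) conjCK scalerDr.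
by rewrite (actZl HX) -[(k *: t) _]/(k *: t _) scalerDr.
Qed.

Lemma blockB b x y t b' x' y' t' :
  blk b x y t - blk b' x' y' t' = blk (b - b') (x - x') (y - y') (t - t').
Proof. by rewrite -[- blk _ _ _ _]scaleN1r blockZ blockD rmorphN1 !scaleN1r. Qed.

Lemma block_bound b x y t M : 0 <= M -> op_bound H t M ->
  op_bound F (blk b x y t) (rnorm b + rnorm x + rnorm y + M).
Proof.
move=> M0 tM u; apply: le_trans (dirsum_norm_le _) _.
rewrite /block /=; have h1 := norm_fst u; have h2 := norm_snd u.
have e1 := rnormD (cmul cA b u.1) (inner H x u.2).
have e2 := rnormD (act H y u.1) (t u.2).
have e3 := rnormM cA b u.1; have e4 := hilb_CS H x u.2.
have e5 := hilb_act_norm H y u.1; have e6 := tM u.2; rewrite !(hilb_mnorm H) in e6.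
have := ler_wpM2l (rnorm_ge0 b) h1; have := ler_wpM2l (rnorm_ge0 x) h2.
have := ler_wpM2l (rnorm_ge0 y) h1; have := ler_wpM2l M0 h2.
rewrite !mulrDl; lra.
Qed.

(** The entries are tested on the vectors (b^*, 0), (0, x), (<y,y>, 0) and (0, v). *)
Lemma block_bound_inv b x y t M : t 0 = 0 -> 0 <= M -> op_bound F (blk b x y t) M ->
  [/\ rnorm b <= M, rnorm x <= M, rnorm y <= M & op_bound H t M].
Proof.
move=> t0 M0 fM.
have sq (r : R) : 0 <= r -> r ^+ 2 <= M * r -> r <= M.
  by move=> r0 h; have [->//|rn] := eqVneq r 0; have rp : 0 < r; [rewrite lt_def rn|nra].
split.
- apply: sq; first exact: rnorm_ge0.
  have := fM (cadj cA b, 0); rewrite mnorm_left rnorm_adj; apply: le_trans.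
  apply: le_trans (norm_fst _); rewrite /= (inner0r HX) addr0.
  by have := rnorm_adjM cA (cadj cA b); rewrite cadjK rnorm_adj => ->.
- apply: sq; first exact: rnorm_ge0.
  have := fM (0, x); rewrite mnorm_right; apply: le_trans.
  by apply: le_trans (norm_fst _); rewrite /= cmul0r add0r hilb_inner_norm.
- have [->//|yn] := eqVneq (rnorm y) 0.
  have yp : 0 < rnorm y by rewrite lt_def yn rnorm_ge0.
  have := fM (inner H y y, 0); rewrite mnorm_left hilb_inner_norm => h.
  have h2 : rnorm y ^+ 3 <= M * rnorm y ^+ 2.
    apply: le_trans h; apply: le_trans (norm_snd _); rewrite /= t0 addr0.
    apply: ler_of_sqr; first exact: rnorm_ge0.
    rewrite -(hilb_inner_norm H) (hinner_act HX) (inner_actl HX) (hinner_adj HX) -cmulA.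
    rewrite -exprM (exprM _ 2 3) -(hilb_inner_norm H); apply: rnorm_cube.
    exact: (hinner_adj HX).
  by move: h2; rewrite [X in X <= _]exprS ler_pM2r ?exprn_gt0.
- move=> v; have := fM (0, v); rewrite mnorm_right -(hilb_mnorm H v); apply: le_trans.
  rewrite (hilb_mnorm H); apply: le_trans (norm_snd _).
  by rewrite /= (act0r HX) add0r.
Qed.

End Block.

Section BlockIdeal.
Context {R : realType} {A : completeNormedModType R[i]} {cA : cstar A}.
Context {X : completeNormedModType R[i]} (H : hilbertModule cA X).
Variables (K : closedSubspace X) (hK : ternary_ideal H K).
Notation HX := (hilb_hmod H).
Notation F := (dirsum cA H).
Notation HF := (dirsum_hmod HX).
Notation blk := (block cA H).
Notation BK := (inner_span H (cs_set K)).
Notation J := (block_ideal cA H (cs_set K)).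

(* The submodule [F B_K] of [F = A (+) X]. *)
Definition ideal_sub : set (A * X) := [set u | BK u.1 /\ K u.2].

Lemma ideal_sub_limit u :
  (forall e : R, 0 < e -> exists2 v, ideal_sub v & mnorm F (u - v) <= e) -> ideal_sub u.
Proof.
move=> h; split; apply: cs_limit => e e0; have [v [v1 v2] uv] := h e e0.
  by exists v.1 => //; apply: le_trans uv; exact: (norm_fst H (u - v)).
by exists v.2 => //; apply: le_trans uv; exact: (norm_snd H (u - v)).
Qed.

Lemma ideal_subB u v : ideal_sub u -> ideal_sub v -> ideal_sub (u - v).
Proof. by move=> [u1 u2] [v1 v2]; split; exact: csB. Qed.

Lemma ideal_sub_lin k u v : ideal_sub u -> ideal_sub v -> ideal_sub (k *: u + v).
Proof. by move=> [u1 u2] [v1 v2]; split; exact: cs_lin. Qed.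

Lemma ideal_sub_act u b : BK b -> ideal_sub (act F u b).
Proof.
move=> Bb; split => /=; first exact: (inner_span_ideal hK _ Bb).1.
exact: (act_inner_span hK).
Qed.

Lemma ideal_sub_inner u : ideal_sub u -> BK (inner F u u).
Proof.
move=> [u1 u2]; apply: csD; first exact: (inner_span_ideal hK _ u1).1.
exact: (inner_span_sub (K := K)).
Qed.

(** From u ~ v <u,u> and the module linearity of T follows T u ~ (T v) <u,u>, with <u,u> in B_K. *)
Lemma ideal_sub_bounded T S M u : adjoint_pair F T S -> op_bound F T M ->
  ideal_sub u -> ideal_sub (T u).
Proof.
move=> TS TM Ku; apply: ideal_sub_limit => e e0.
have Tl := adjoint_lin HF TS.
have M1 : 0 < `|M| + 1 by rewrite ltr_wpDl.
have [v uv] := approx_unit0 HF u (divr_gt0 e0 M1).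
exists (T (act F v (inner F u u))).
  rewrite (adjoint_act HF _ _ TS); apply: ideal_sub_act; exact: ideal_sub_inner.
have -> : T u - T (act F v (inner F u u)) = T (u - act F v (inner F u u)).
  by have := Tl (-1) (act F v (inner F u u)) u; rewrite !scaleN1r ![- _ + _]addrC => ->.
apply: le_trans (TM _) _; rewrite ler_pdivlMr// in uv.
have := ler_norm M; have := mnorm_ge0 F (u - act F v (inner F u u)); nra.
Qed.

Lemma block_ideal_lin k f g : J f -> J g -> J (k *: f + g).
Proof.
move=> [b [x [y [t [Bb Kx Ky Kt ->]]]]] [b' [x' [y' [t' [Bb' Kx' Ky' Kt' ->]]]]].
exists (k *: b + b'), (k^* *: x + x'), (k *: y + y'), (k *: t + t'); split.
- exact: cs_lin.
- exact: cs_lin.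
- exact: cs_lin.
- exact: (compact_span_lin HX).
- by rewrite blockZ blockD.
Qed.

Lemma finite_rank_block f : finite_rank F ideal_sub f -> J f.
Proof.
apply: (@lspan_ind _ _ _ J).
- exists 0, 0, 0, 0; split; try exact: cs_set0.
    by apply: (compact_span_sub HX); exact: lspan0.
  apply/funext => u; rewrite /block (inner0l HX) (act0l HX) cmul0l.
  by rewrite -[(0 : X -> X) _]/(0 : X) !addr0.
- exact: block_ideal_lin.
- move=> _ [u [u1 u2] [v [v1 v2] <-]].
  exists (cmul cA u.1 (cadj cA v.1)), (act H v.2 (cadj cA u.1)).
  exists (act H u.2 (cadj cA v.1)), (rank1 H u.2 v.2); split.
  + exact: (inner_span_ideal hK _ u1).2.
  + exact: (ternary_ideal_act hK).
  + exact: (ternary_ideal_act hK).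
  + by apply/(compact_span_sub HX)/sub_lspan; exists u.2 => //; exists v.2.
  + apply/funext => w; rewrite /block /rank1 /=; congr (_, _).
      by rewrite cmulDr cmulA (inner_actl HX) cadjK.
    by rewrite (actDr HX) (hact_cmul HX).
Qed.

Lemma compact_span0 t : compact_span H (cs_set K) t -> t 0 = 0.
Proof.
move=> Kt; apply: (mnorm_small HX) => e e0; have [k Kk tk] := Kt e e0.
have [g kg _] := finite_rank_adj HX Kk.
have k0 : k 0 = 0.
  by have := adjoint_lin HX kg (-1) 0 0; rewrite scaler0 addr0 scaleN1r addNr.
have := tk 0; rewrite (mnorm0 HX) mulr0 -[(t - k) 0]/(t 0 - k 0) k0 subr0.
by move=> /le_trans; apply; exact: ltW.
Qed.

(** By [block_bound_inv] the entries of approximating blocks are Cauchy, and each corner is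
    closed. *)
Lemma block_ideal_limit f :
  (forall e : R, 0 < e -> exists2 g, J g & op_bound F (f - g) e) -> J f.
Proof.
move=> h; pose d n : R := 2^-1 ^+ n.
have d0 n : 0 < d n by rewrite exprn_gt0// invr_gt0 ltr0n.
have [g gP] := choice (fun n => let: ex_intro2 g Jg fg := h _ (d0 n) in
   ex_intro (fun g => J g /\ op_bound F (f - g) (d n)) g (conj Jg fg)).
have fg n : op_bound F (f - g n) (d n) by have [] := gP n.
have [b bP] := choice (fun n => (gP n).1).
have [x xP] := choice bP; have [y yP] := choice xP; have [t tP] := choice yP.
have {}gP n : g n = blk (b n) (x n) (y n) (t n) by have [] := tP n.
have t0 n : t n 0 = 0 by apply: compact_span0; have [] := tP n.
have dn : null_seq (fun n => d n * 2).
  move=> e e0; have [|n dn] := @exp2_small _ (e / 2); first by rewrite divr_gt0.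
  by exists n; rewrite -ltr_pdivlMr.
have gg n m : (n <= m)%N -> [/\ rnorm (b n - b m) <= d n * 2, rnorm (x n - x m) <= d n * 2,
    rnorm (y n - y m) <= d n * 2 & op_bound H (t n - t m) (d n * 2)].
  move=> nm; apply: block_bound_inv.
  - by rewrite -[(_ - _) 0]/(t n 0 - t m 0) !t0 subrr.
  - by rewrite mulr_ge0// ltW.
  rewrite -blockB -!gP; apply: op_bound_le (op_bound_dist HF (op_bound_distC HF (fg n)) (fg m)).
  by have : d m <= d n := exp2_le nm; lra.
have [n m nm|b' bl] := @rnorm_complete _ _ b _ dn; first by have [] := gg n m nm.
have [n m nm|x' xl] := @rnorm_complete _ _ x _ dn; first by have [] := gg n m nm.
have [n m nm|y' yl] := @rnorm_complete _ _ y _ dn; first by have [] := gg n m nm.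
(* The operator entry is read off from f; the other three are limits in complete spaces. *)
pose t' v := (f (0, v)).2.
have tl n : op_bound H (t' - t n) (d n).
  move=> v; have := fg n (0, v); rewrite mnorm_right -(hilb_mnorm H v); apply: le_trans.
  rewrite (hilb_mnorm H); apply: le_trans (norm_snd H _).
  by rewrite gP /= (act0r HX) add0r.
have small e : 0 < e -> exists n, d n * 2 <= e.
  by move=> e0; have [n h1] := dn e e0; exists n; rewrite ltW.
exists b', x', y', t'; split.
- apply: cs_limit => e /small[n de]; exists (b n); first by have [] := tP n.
  by rewrite rdistC; exact: le_trans (bl n) de.
- apply: cs_limit => e /small[n de]; exists (x n); first by have [] := tP n.
  by rewrite rdistC; exact: le_trans (xl n) de.
- apply: cs_limit => e /small[n de]; exists (y n); first by have [] := tP n.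
  by rewrite rdistC; exact: le_trans (yl n) de.
- apply: (compact_span_limit HX) => e /small[n de]; exists (t n); first by have [] := tP n.
  by apply: op_bound_le (tl n); have := d0 n; lra.
(* The errors add up to 8 [d n]: 2 for each of the three limits, 1 for the operator entry, 1 for
   f. *)
apply: (op_bound_eq HF) => e e0; have [n dn4] := small _ (divr_gt0 e0 (ltr0n R 4)).
have h2 : op_bound F (g n - blk b' x' y' t') (d n * 2 + d n * 2 + d n * 2 + d n).
  rewrite gP blockB; have h3 := block_bound (b n - b') (x n - x') (y n - y') (ltW (d0 n))
    (op_bound_distC HX (tl n)).
  apply: op_bound_le h3; have := bl n; have := xl n; have := yl n; lra.
apply: op_bound_le (op_bound_dist HF (fg n) h2); lra.
Qed.

Lemma block_ideal_maps f u : J f -> ideal_sub (f u).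
Proof.
move=> [b [x [y [t [Bb Kx Ky Kt ->]]]]]; split.
  rewrite -[X in BK X]/(cmul cA b u.1 + inner H x u.2).
  apply: csD; first exact: (inner_span_ideal hK _ Bb).2.
  exact: (inner_inner_span_l hK).
rewrite -[X in cs_set K X]/(act H y u.1 + t u.2).
apply: csD; first exact: (ternary_ideal_act hK).
apply: cs_limit => e e0; have u1 : 0 < rnorm u.2 + 1 by rewrite ltr_wpDl// rnorm_ge0.
have [k Kk tk] := Kt _ (divr_gt0 e0 u1); exists (k u.2).
  apply: (@lspan_ind _ _ _ (fun k => K (k u.2)) _ _ _ _ Kk).
  - exact: cs_set0.
  - by move=> c f1 f2 h1 h2; exact: cs_lin.
  - by move=> _ [x1 Kx1 [y1 _ <-]]; exact: (ternary_ideal_act hK).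
have := tk u.2; rewrite !(hilb_mnorm H) => /le_trans; apply.
by rewrite mulrAC ler_pdivrMr// ler_wpM2l ?(ltW e0)// lerDl.
Qed.

End BlockIdeal.

Section BlockCompact.
Context {R : realType} {A : completeNormedModType R[i]} {cA : cstar A}.
Context {X : completeNormedModType R[i]} (H : hilbertModule cA X).
Notation HX := (hilb_hmod H).
Notation F := (dirsum cA H).
Notation HF := (dirsum_hmod HX).
Notation blk := (block cA H).

Lemma op_bound0 : op_bound H 0 0.
Proof. by move=> x; rewrite mul0r (mnorm0 HX). Qed.

Lemma compact_span_approx f :
  (forall e : R, 0 < e -> exists u v, op_bound F (f - rank1 F u v) e) ->
  compact_span F setT f.
Proof.
move=> h e e0; have [u [v fe]] := h e e0; exists (rank1 F u v) => //.
by apply: sub_lspan; exists u => //; exists v.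
Qed.

(** A rank-one operator on F has products as entries; b ~ y b^* b is such a product up to e, and the
    off-diagonal corners are treated in the same way. *)
Lemma compact_block11 b : compact_span F setT (blk b 0 0 0).
Proof.
apply: compact_span_approx => e e0.
have [y h] := approx_unit0 (selfmod_hmod cA) b e0; rewrite selfmod_mnorm /= in h.
exists (cmul cA y (cadj cA b), 0), (cadj cA b, 0).
have -> : rank1 F (cmul cA y (cadj cA b), 0) (cadj cA b, 0) =
    blk (cmul cA y (cmul cA (cadj cA b) b)) 0 0 0.
  apply/funext => w; rewrite /block /rank1 /= !(inner0l HX) !(act0l HX) !addr0 cadjK.
  by rewrite !cmulA.
rewrite blockB !subrr; apply: op_bound_le (block_bound _ _ _ (lexx 0) op_bound0).
by rewrite !rnorm0 !addr0.
Qed.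

Lemma compact_block21 y : compact_span F setT (blk 0 0 y 0).
Proof.
apply: compact_span_approx => e e0; have [z h] := hilb_approx H y e0.
exists (0, z), (inner H y y, 0).
have -> : rank1 F (0, z) (inner H y y, 0) = blk 0 0 (act H z (inner H y y)) 0.
  apply/funext => w; rewrite /block /rank1 /= !(inner0l HX) !cmul0l !addr0.
  by rewrite (hinner_adj HX) (hact_cmul HX).
rewrite blockB !subrr; apply: op_bound_le (block_bound _ _ _ (lexx 0) op_bound0).
by rewrite !rnorm0 !addr0 !add0r.
Qed.

Lemma compact_block12 x : compact_span F setT (blk 0 x 0 0).
Proof.
apply: compact_span_approx => e e0; have [z h] := hilb_approx H x e0.
exists (inner H x x, 0), (0, z).
have -> : rank1 F (inner H x x, 0) (0, z) = blk 0 (act H z (inner H x x)) 0 0.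
  apply/funext => w; rewrite /block /rank1 /= cadj0 !cmul0l !add0r !(act0l HX).
  by rewrite (inner_actl HX) (hinner_adj HX) add0r.
rewrite blockB !subrr; apply: op_bound_le (block_bound _ _ _ (lexx 0) op_bound0).
by rewrite !rnorm0 !addr0 !add0r.
Qed.

Lemma compact_block22 (K : set X) t : compact_span H K t -> compact_span F setT (blk 0 0 0 t).
Proof.
move=> Kt; apply: (compact_span_limit HF) => e e0; have [k Kk tk] := Kt e e0.
exists (blk 0 0 0 k); last first.
  rewrite blockB !subrr; apply: op_bound_le (block_bound _ _ _ (ltW e0) tk).
  by rewrite !rnorm0 !add0r.
apply: (compact_span_sub HF); have k0 : blk 0 0 0 0 = 0.
  apply/funext => u; rewrite /block (inner0l HX) (act0l HX) cmul0l.
  by rewrite -[(0 : X -> X) _]/(0 : X) !addr0.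
apply: (@lspan_ind _ _ _ (fun k => finite_rank F setT (blk 0 0 0 k)) _ _ _ _ Kk).
- by rewrite k0; exact: lspan0.
- move=> c f g Kf Kg; have -> : blk 0 0 0 (c *: f + g) = c *: blk 0 0 0 f + blk 0 0 0 g.
    by rewrite blockZ blockD !scaler0 !addr0.
  exact: lspan_lin.
- move=> _ [x _ [y _ <-]]; apply: sub_lspan; exists (0, x) => //; exists (0, y) => //.
  apply/funext => w; rewrite /block /rank1 /= cadj0 !cmul0l !add0r (inner0l HX).
  by rewrite (act0l HX) add0r.
Qed.

Lemma compact_block (K : set X) b x y t : compact_span H K t ->
  compact_span F setT (blk b x y t).
Proof.
move=> Kt; have -> : blk b x y t =
    blk b 0 0 0 + (blk 0 x 0 0 + (blk 0 0 y 0 + blk 0 0 0 t)).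
  by rewrite !blockD !(addr0, add0r).
apply: (compact_spanD HF); first exact: compact_block11.
apply: (compact_spanD HF); first exact: compact_block12.
apply: (compact_spanD HF); first exact: compact_block21.
exact: compact_block22 Kt.
Qed.

Lemma op21E y : op21 H y = blk 0 0 y 0.
Proof.
apply/funext => u; rewrite /block /op21 cmul0l (inner0l HX).
by rewrite -[(0 : X -> X) _]/(0 : X) !addr0.
Qed.

Lemma compact_op21 y : compact_span F setT (op21 H y).
Proof. by rewrite op21E; exact: compact_block21. Qed.

Lemma full_closed : closed (setT : set X). Proof. exact: closedT. Qed.
Definition full_cs : closedSubspace X :=
  @ClosedSubspace R X setT Logic.I (fun _ _ _ _ _ => Logic.I) full_closed.

(** For K = X and a full module the ideal is everything, so [block_ideal_limit] gives f a block
    form; the corner condition leaves only the entry y. *)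
Lemma compact_in_corner21 f : full H -> compact_span F setT f -> f 0 = 0 ->
  in_corner21 f -> exists y, f = op21 H y.
Proof.
move=> fH Ff f0 fc; have hT : ternary_ideal H full_cs by [].
have [b [x [y [t [_ _ _ _ fE]]]]] : block_ideal cA H (cs_set full_cs) f.
  apply: block_ideal_limit => e e0; have [g Fg fg] := Ff e e0.
  exists g => //; apply: (finite_rank_block hT).
  apply: (@lspan_ind _ _ _ (finite_rank F (ideal_sub H full_cs)) _ _ _ _ Fg).
  - exact: lspan0.
  - by move=> *; exact: lspan_lin.
  - by move=> _ [u _ [v _ <-]]; apply: sub_lspan; exists u; [|exists v] => //; split.
have t0 : t 0 = 0.
  have : (f 0).2 = 0 by rewrite f0.
  by rewrite fE /block /= (act0r HX) add0r.
exists y; apply/funext => -[a v]; rewrite fc {1}fE /block /op21 /=.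
by rewrite t0 addr0.
Qed.

End BlockCompact.

Section LinkingIdeal.
Context {R : realType} {A : completeNormedModType R[i]} {cA : cstar A}.
Context {X : completeNormedModType R[i]} (H : hilbertModule cA X).
Variables (K : closedSubspace X) (hK : ternary_ideal H K).
Notation HX := (hilb_hmod H).
Notation F := (dirsum cA H).
Notation HF := (dirsum_hmod HX).
Notation FK := (ideal_sub H K).
Context {L : completeNormedModType R[i]} {cL : cstar L} {lam : L -> A * X -> A * X}.
Hypothesis hL : is_compacts F cL lam.
Notation lamB := (repB (compacts_lin hL)).
Notation lamP := (rep_adj (compacts_adj hL)).

(** With ranges instead of blocks, the ideal property and the kernel of the quotient representation
    are immediate; [linking_idealE] recovers the blocks. *)
Definition linking_set : set L := [set T | forall u, FK (lam T u)].

Lemma linking_set0 : linking_set 0.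
Proof.
by move=> u; rewrite (rep0 (compacts_lin hL)); split; exact: cs_set0.
Qed.

Lemma linking_set_lin k S T : linking_set S -> linking_set T -> linking_set (k *: S + T).
Proof. by move=> hS hT u; rewrite (compacts_lin hL); apply: ideal_sub_lin. Qed.

Lemma linking_set_closed : closed linking_set.
Proof.
apply: limit_closed => T h u; apply: ideal_sub_limit => e e0.
have u1 : 0 < mnorm F u + 1 by rewrite ltr_wpDl ?mnorm_ge0.
have [S hS TS] := h _ (divr_gt0 e0 u1); exists (lam S u); first exact: hS.
have := compacts_bound HF hL (T - S) u; rewrite lamB => /le_trans; apply.
apply: le_trans (ler_wpM2r (mnorm_ge0 F u) TS) _.
by rewrite mulrAC ler_pdivrMr// ler_wpM2l ?(ltW e0)// lerDl.
Qed.

Definition linking_ideal : closedSubspace L :=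
  ClosedSubspace linking_set0 linking_set_lin linking_set_closed.

Lemma linking_maps T u : FK u -> FK (lam T u).
Proof. exact: (ideal_sub_bounded hK (lamP T) (compacts_bound HF hL T)). Qed.

Lemma linking_ideal_ideal : two_sided_ideal cL linking_ideal.
Proof.
by move=> S T IT; split=> u; rewrite (compacts_mul hL) /=; [exact: linking_maps|exact: IT].
Qed.

(* [T] in the ideal is close to [T T^* Y^*] with [Y] in the ideal, hence to [T S Y^*] with [S] of
   finite rank, and [T (x y^* ) Y^* = (T x) (Y y)^*]. *)
Lemma linking_ideal_block T : linking_ideal T -> block_ideal cA H (cs_set K) (lam T).
Proof.
move=> IT; apply: block_ideal_limit => e e0; have e20 : 0 < e / 2 by lra.
(* Applied to T^* in the algebra over itself: T^* ~ Y T T^* with Y in the ideal, so T ~ T T^*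
   Y^*. *)
have [Y IY] := @approx_unit _ _ _ _ _ (selfmod_hmod cL) (cs_set linking_ideal)
  (cadj cL T) _ (@cs_lin _ _ linking_ideal)
  (fun y a Iy => (linking_ideal_ideal a Iy).2) (ideal_adj linking_ideal_ideal IT) e20.
rewrite selfmod_mnorm /= cadjK => TY.
have M1 : 0 < rnorm T * rnorm Y + 1 by rewrite ltr_wpDl// mulr_ge0 ?rnorm_ge0.
have [S fS TS] := compacts_dense HF hL (cadj cL T) (divr_gt0 e20 M1).
pose Z := cmul cL (cmul cL T S) (cadj cL Y).
exists (lam Z).
  apply: (finite_rank_block hK); rewrite /Z !(compacts_mul hL).
  apply: (@lspan_ind _ _ _ (fun f => finite_rank F FK (lam T \o f \o lam (cadj cL Y)))
    _ _ _ _ fS).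
  - have -> : lam T \o 0 \o lam (cadj cL Y) = 0; last exact: lspan0.
    apply/funext => u /=; rewrite -[(0 : A * X -> A * X) _]/(0 : (A * X)%type).
    have := rep_linear HF (compacts_adj hL) T (-1) 0 0.
    by rewrite scaler0 addr0 scaleN1r addNr.
  - move=> k f g h1 h2.
    have -> : lam T \o (k *: f + g) \o lam (cadj cL Y) =
      k *: (lam T \o f \o lam (cadj cL Y)) + (lam T \o g \o lam (cadj cL Y)).
      by apply/funext => u; exact: (rep_linear HF (compacts_adj hL)).
    exact: lspan_lin.
  - move=> _ [x _ [y _ <-]]; apply: sub_lspan.
    exists (lam T x); first exact: IT.
    exists (lam Y y); first exact: IY.
    apply/funext => u; rewrite /rank1 (lamP Y y u); apply: esym.
    exact: (rep_act HF (compacts_adj hL)).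
rewrite -lamB; apply: op_bound_le (compacts_bound HF hL _).
have -> : T - Z = (T - cmul cL (cmul cL T (cadj cL T)) (cadj cL Y))
    + cmul cL (cmul cL T (cadj cL T - S)) (cadj cL Y).
  by rewrite /Z cmulBr cmulBl; zmod.
apply: le_trans (rnormD _ _) _.
have h1 : rnorm (T - cmul cL (cmul cL T (cadj cL T)) (cadj cL Y)) <= e / 2.
  by rewrite -(rnorm_adj cL) cadjB !cadjM !cadjK.
have h2 := rnormM cL (cmul cL T (cadj cL T - S)) (cadj cL Y).
have h3 := rnormM cL T (cadj cL T - S); rewrite rnorm_adj in h2.
rewrite ler_pdivlMr// in TS.
have h4 := ler_wpM2r (rnorm_ge0 Y) h3; have := rnorm_ge0 (cadj cL T - S).
lra.
Qed.

Lemma linking_idealE : lam @` cs_set linking_ideal = block_ideal cA H (cs_set K).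
Proof.
apply/seteqP; split=> [_ [T IT <-]|f Jf]; first exact: linking_ideal_block.
have [T lT] : exists T, lam T = f.
  apply: (compacts_ex hL); have [b [x [y [t [_ _ _ Kt ->]]]]] := Jf.
  exact: compact_block Kt.
by exists T => // u; rewrite lT; exact: (block_ideal_maps hK).
Qed.

End LinkingIdeal.

Section QuotientLinking.
Context {R : realType} {A : completeNormedModType R[i]} {cA : cstar A}.
Context {X : completeNormedModType R[i]} (H : hilbertModule cA X).
Variables (K : closedSubspace X) (hK : ternary_ideal H K).
Notation HX := (hilb_hmod H).
Notation F := (dirsum cA H).
Notation HF := (dirsum_hmod HX).
Notation FK := (ideal_sub H K).
Notation BK := (inner_span H (cs_set K)).
Notation cQ := (quot_cstar (inner_span_ideal hK)).
Notation HQ := (quot_hilbert hK).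
Notation FQ := (dirsum cQ HQ).
Notation HFQ := (dirsum_hmod (hilb_hmod HQ)).

Definition qpair (u : A * X) : quotient_type BK * quotient_type K :=
  (qpi BK u.1, qpi K u.2).

Lemma qpair_lin : linear qpair.
Proof. by move=> k u v; rewrite /qpair /= !qpi_linear. Qed.

Lemma qpair_surj w : exists u, qpair u = w.
Proof. by case: w => b x; exists (qrepr b, qrepr x); rewrite /qpair /= !qreprK. Qed.

Lemma qpair_eq u v : qpair u = qpair v <-> FK (u - v).
Proof.
split=> [[/qpi_eq h1 /qpi_eq h2] //|[h1 h2]].
by congr (_, _); apply/qpi_eq.
Qed.

Lemma qpair_inner u v : inner FQ (qpair u) (qpair v) = qpi BK (inner F u v).
Proof.
by rewrite /= (qadjE (inner_span_ideal hK)) (qmulE (inner_span_ideal hK)) (quot_innerE hK) -qpiD.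
Qed.

Lemma qpair_act u a : act FQ (qpair u) (qpi BK a) = qpair (act F u a).
Proof. by rewrite /= (qmulE (inner_span_ideal hK)) (quot_actE hK). Qed.

Lemma qpair_mnorm u : mnorm FQ (qpair u) <= mnorm F u.
Proof.
apply: mnorm_le; first exact: mnorm_ge0.
by rewrite qpair_inner mnorm_sq; exact: rnorm_qpi.
Qed.

(** [quot_inner_approx] is applied to F itself: lifting the coordinates separately would not control
    the norm of the pair. *)
Lemma qpair_lift w (e : R) : 0 < e -> exists2 u, qpair u = w & mnorm F u <= mnorm FQ w + e.
Proof.
move=> e0; have [u uw] := qpair_surj w.
have [y [i [Bi]]] := quot_inner_approx (inner_span_ideal hK) HF u (exprn_gt0 2 e0).
rewrite -qpair_inner uw -mnorm_sq => h; exists (u - act F y i).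
  rewrite -uw; apply/qpair_eq; have -> : u - act F y i - u = - act F y i by zmod.
  rewrite -sub0r; apply: ideal_subB; last exact: ideal_sub_act.
  by split; exact: cs_set0.
have m0 := mnorm_ge0 FQ w; apply: ler_of_sqr; first by rewrite addr_ge0// ltW.
by apply: le_trans h _; rewrite sqrrD lerD2r lerDl mulrn_wge0// mulr_ge0// ltW.
Qed.

Lemma qpair_finite_rank f : finite_rank F setT f ->
  exists2 g, finite_rank FQ setT g & forall u, g (qpair u) = qpair (f u).
Proof.
apply: (@lspan_ind _ _ _ (fun f => exists2 g, finite_rank FQ setT g &
  forall u, g (qpair u) = qpair (f u))).
- exists 0 => [|u]; first exact: lspan0.
  by rewrite /qpair !linear0.
- move=> k f1 f2 [g1 G1 h1] [g2 G2 h2]; exists (k *: g1 + g2); first exact: lspan_lin.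
  by move=> u; rewrite -[LHS]/(k *: g1 (qpair u) + g2 (qpair u)) h1 h2 -qpair_lin.
- move=> _ [x _ [y _ <-]]; exists (rank1 FQ (qpair x) (qpair y)).
    by apply: sub_lspan; exists (qpair x) => //; exists (qpair y).
  by move=> u; rewrite /rank1 qpair_inner qpair_act.
Qed.

Lemma qpair_finite_rank_lift g : finite_rank FQ setT g ->
  exists2 f, finite_rank F setT f & forall u, g (qpair u) = qpair (f u).
Proof.
apply: (@lspan_ind _ _ _ (fun g => exists2 f, finite_rank F setT f &
  forall u, g (qpair u) = qpair (f u))).
- exists 0 => [|u]; first exact: lspan0.
  by rewrite /qpair !linear0.
- move=> k f1 f2 [g1 G1 h1] [g2 G2 h2]; exists (k *: g1 + g2); first exact: lspan_lin.
  by move=> u; rewrite -[LHS]/(k *: f1 (qpair u) + f2 (qpair u)) h1 h2 -qpair_lin.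
- move=> _ [x' _ [y' _ <-]]; have [x <-] := qpair_surj x'; have [y <-] := qpair_surj y'.
  exists (rank1 F x y); first by apply: sub_lspan; exists x => //; exists y.
  by move=> u; rewrite /rank1 qpair_inner qpair_act.
Qed.

Context {L : completeNormedModType R[i]} {cL : cstar L} {lam : L -> A * X -> A * X}.
Hypothesis hL : is_compacts F cL lam.
Notation I := (linking_ideal K hL).
Notation hI := (linking_ideal_ideal hK (hL := hL)).
Notation cLI := (quot_cstar hI).

Definition quot_rep (T : quotient_type I) (w : quotient_type BK * quotient_type K) :
  quotient_type BK * quotient_type K := qpair (lam (qrepr T) (qrepr w.1, qrepr w.2)).

(** Independence of representatives: the ideal maps F into F B_K, and every T preserves F B_K. *)
Lemma quot_repE T u : quot_rep (qpi I T) (qpair u) = qpair (lam T u).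
Proof.
apply/qpair_eq; pose T' := qrepr (qpi I T).
pose u' := (qrepr (qpi BK u.1), qrepr (qpi K u.2)); rewrite -/T' -/u'.
have Iu : FK (u' - u).
  by split; [exact: (qreprP BK u.1)|exact: (qreprP K u.2)].
have -> : lam T' u' - lam T u = 1 *: lam (T' - T) u + lam T' (u' - u).
  have := rep_linear HF (compacts_adj hL) T' (-1) u u'.
  rewrite !scaleN1r ![- _ + _]addrC => ->.
  by rewrite (repB (compacts_lin hL)) -[(_ - _) u]/(lam T' u - lam T u) scale1r; zmod.
apply: ideal_sub_lin; last exact: (linking_maps hK hL).
exact: (qreprP I T).
Qed.

Lemma quot_rep_ext (f g : quotient_type BK * quotient_type K -> quotient_type BK * quotient_type K) :
  (forall u, f (qpair u) = g (qpair u)) -> f = g.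
Proof. by move=> h; apply/funext => w; have [u <-] := qpair_surj w; exact: h. Qed.

Lemma quot_rep_lin : linear quot_rep.
Proof.
move=> k S T; rewrite -(qreprK S) -(qreprK T) -qpi_linear; apply: quot_rep_ext => u.
rewrite -[RHS]/(k *: quot_rep _ (qpair u) + quot_rep _ (qpair u)) !quot_repE.
by rewrite (compacts_lin hL) -qpair_lin.
Qed.

Lemma quot_rep_mul S T : quot_rep (cmul cLI S T) = quot_rep S \o quot_rep T.
Proof.
rewrite -(qreprK S) -(qreprK T) (quot_cmul hI); apply: quot_rep_ext => u.
by rewrite /= !quot_repE (compacts_mul hL).
Qed.

Lemma quot_rep_adj T x y :
  inner FQ (quot_rep (cadj cLI T) x) y = inner FQ x (quot_rep T y).
Proof.
have [u <-] := qpair_surj x; have [v <-] := qpair_surj y.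
rewrite -(qreprK T) (quot_cadj hI) !quot_repE !qpair_inner.
by rewrite (compacts_adj hL).
Qed.

Lemma quot_rep_inj : injective quot_rep.
Proof.
move=> S T; rewrite -(qreprK S) -(qreprK T) => h; apply/qpi_eq => u.
rewrite (repB (compacts_lin hL)); apply/qpair_eq.
by rewrite -!quot_repE h.
Qed.

Lemma quot_rep_bound T : op_bound FQ (quot_rep T) (rnorm T).
Proof.
move=> w; apply/ler_addgt0Pr => e e0.
have T0 := rnorm_ge0 T; have w0 := mnorm_ge0 FQ w.
pose M := rnorm T + mnorm FQ w + 1 + e.
have M0 : 0 < M by rewrite /M; lra.
pose d := e / M; have d0 : 0 < d by rewrite divr_gt0.
have dM : d * M = e by rewrite /d divfK// gt_eqF.
have d1 : d <= 1 by rewrite /d ler_pdivrMr// mul1r /M; lra.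
have [S ST Sd] := qpi_lift T d0; have [u uw ud] := qpair_lift w d0.
rewrite -{1}ST -{1}uw quot_repE; apply: le_trans (qpair_mnorm _) _.
apply: le_trans (compacts_bound HF hL S u) _.
have h : rnorm S * mnorm F u <= (rnorm T + d) * (mnorm FQ w + d).
  by apply: ler_pM => //; [exact: rnorm_ge0|exact: mnorm_ge0].
by rewrite /M in dM; nra.
Qed.

Lemma quot_rep_dense T (e : R) : 0 < e ->
  exists2 S, finite_rank FQ setT (quot_rep S) & rnorm (T - S) <= e.
Proof.
move=> e0; have [S Sf TS] := compacts_dense HF hL (qrepr T) e0.
exists (qpi I S); last first.
  by rewrite -(qreprK T) -qpiB; apply: le_trans (rnorm_qpi _ _) _.
have [g Fg gE] := qpair_finite_rank Sf.
suff -> : quot_rep (qpi I S) = g by [].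
by apply: quot_rep_ext => u; rewrite quot_repE gE.
Qed.

Lemma quot_rep_finite f : finite_rank FQ setT f -> exists T, quot_rep T = f.
Proof.
move=> /qpair_finite_rank_lift[g Fg fE].
have [T lT] := compacts_ex hL (compact_span_sub HF Fg).
by exists (qpi I T); apply: quot_rep_ext => u; rewrite quot_repE lT fE.
Qed.

Lemma quot_rep_compacts : is_compacts FQ cLI quot_rep.
Proof.
apply: (is_compacts_of_rep HFQ).
- exact: quot_rep_lin.
- exact: quot_rep_mul.
- exact: quot_rep_adj.
- exact: (dirsum_complete (hilb_hmod HQ) (hilb_complete (H := HQ))).
- exact: quot_rep_inj.
- exact: quot_rep_bound.
- exact: quot_rep_dense.
- exact: quot_rep_finite.
Qed.

End QuotientLinking.

Section Corner.
Context {R : realType} {A : completeNormedModType R[i]} {cA : cstar A}.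
Context {X : completeNormedModType R[i]} (H : hilbertModule cA X).
Notation HX := (hilb_hmod H).
Notation F := (dirsum cA H).
Notation HF := (dirsum_hmod HX).
Context {L : completeNormedModType R[i]} {cL : cstar L} {lam : L -> A * X -> A * X}.
Hypothesis hL : is_compacts F cL lam.

(** For z = x - y, evaluation at <z,z> gives z <z,z> = 0, so <z,z>^3 = 0 and [rnorm_cube] yields z =
    0. *)
Lemma op21_inj : injective (op21 H).
Proof.
move=> x y xy; apply/eqP; rewrite -subr_eq0; apply/eqP/(hinner_def HX).
set z := x - y; have : act H z (inner H z z) = 0.
  have := congr1 (fun f => (f (inner H z z, 0)).2) xy; rewrite /op21 /= => h.
  by rewrite {1}/z (actBl HX) h subrr.
move=> z0; apply: rnorm_eq0; apply/eqP.
have := rnorm_cube (hinner_adj HX z z).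
have -> : cmul cA (inner H z z) (cmul cA (inner H z z) (inner H z z)) =
    inner H (act H z (inner H z z)) (act H z (inner H z z)).
  by rewrite (inner_actl HX) (hinner_act HX) (hinner_adj HX).
rewrite z0 (inner0l HX) rnorm0 => h.
have := rnorm_ge0 (inner H z z) => n0.
by have : rnorm (inner H z z) ^+ 3 = 0; [apply/eqP; rewrite eq_le h exprn_ge0|move/eqP; rewrite expf_eq0].
Qed.

Lemma corner_ex x : exists T, lam T = op21 H x.
Proof. exact: (compacts_ex hL (compact_op21 H x)). Qed.

Definition corner (x : X) : L := projT1 (cid (corner_ex x)).

Lemma cornerE x : lam (corner x) = op21 H x.
Proof. exact: projT2 (cid (corner_ex x)). Qed.

Lemma corner_lin : linear corner.
Proof.
move=> k x y; apply: (compacts_inj hL); rewrite (compacts_lin hL) !cornerE.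
rewrite !op21E blockZ blockD; congr (block _ _ _ _ _ _).
- by rewrite scaler0 addr0.
- by rewrite scaler0 addr0.
- by rewrite scaler0 addr0.
Qed.

Lemma corner_norm x : rnorm (corner x) = rnorm x.
Proof.
apply/eqP; rewrite eq_le; apply/andP; split.
  apply: (compacts_norm_le hL); first exact: rnorm_ge0.
  rewrite cornerE op21E; apply: op_bound_le (block_bound 0 0 x (lexx 0) (op_bound0 H)).
  by rewrite !rnorm0 !add0r addr0.
have := compacts_bound HF hL (corner x); rewrite cornerE op21E.
by move=> /block_bound_inv[]// ; exact: rnorm_ge0.
Qed.

Lemma corner_inj : injective corner.
Proof.
move=> x y xy; apply: op21_inj; by rewrite -!cornerE xy.
Qed.

Lemma corner_ternary x y z : corner (act H x (inner H y z)) =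
  cmul cL (cmul cL (corner x) (cadj cL (corner y))) (corner z).
Proof.
apply: (compacts_inj hL); rewrite !(compacts_mul hL) !cornerE.
(* The adjoint of the 21-corner entry y is the 12-corner entry y^*. *)
have -> : lam (cadj cL (corner y)) = block cA H 0 y 0 0.
  apply/funext => u; apply: (inner_ext HF) => v.
  have := rep_adj (compacts_adj hL) (corner y) v u => <-; rewrite cornerE.
  rewrite /op21 /block /= cadj0 !cmul0l !add0r (act0l HX).
  by rewrite (inner_actl HX) -[(0 : X -> X) _]/(0 : X) add0r (inner0r HX) addr0.
apply/funext => u; rewrite /op21 /block /=; congr (_, _).
by rewrite cmul0l add0r (hinner_act HX) (hact_cmul HX).
Qed.

Lemma corner_range : full H -> range corner = [set T | in_corner21 (lam T)].
Proof.
move=> fH; apply/seteqP; split=> [_ [x _ <-]|T hT] /=.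
  by rewrite cornerE => a v.
have [|y ly] := compact_in_corner21 fH (compacts_compact hL T) _ hT.
  have := rep_linear HF (compacts_adj hL) T (-1) 0 0.
  by rewrite scaler0 addr0 scaleN1r addNr.
by exists y => //; apply: (compacts_inj hL); rewrite cornerE ly.
Qed.

End Corner.

Theorem mainTheorem7 (R : realType) (B : completeNormedModType R[i])
    (cB : cstar B) (E : completeNormedModType R[i]) (H : hilbertModule cB E)
    (K : closedSubspace E) (hK : ternary_ideal H K) :
  let D := reduced H in
  let BK := inner_span D (cs_set K) in
  let p : BE H -> quotient_type BK := qpi BK in
  let q : E -> quotient_type K := qpi K in
  exists (t : quotient_type K -> quotient_type K -> quotient_type K ->
              quotient_type K)
         (cQ : cstar (quotient_type BK))
         (HQ : hilbertModule cQ (quotient_type K)),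
  (* E/K is a TRO under the inherited ternary product and the quotient norm *)
  (forall x y z, t (q x) (q y) (q z) = q (act H x (inner H y z))) /\
  is_TRO t /\
  (* E/K is a full Hilbert module over B_E/B_K *)
  two_sided_ideal (BE_cstar H) BK /\
  star_morphism (BE_cstar H) cQ p /\
  (forall x y, inner HQ (q x) (q y) = p (inner D x y)) /\
  (forall x b, act HQ (q x) (p b) = q (act D x b)) /\
  full HQ /\
  (* L is the reduced linking algebra K(B_E (+) E) of E *)
  (exists (L : completeNormedModType R[i]) (cL : cstar L)
          (lam : L -> BE H * E -> BE H * E),
     is_compacts (dirsum (BE_cstar H) D) cL lam) /\
  forall (L : completeNormedModType R[i]) (cL : cstar L)
         (lam : L -> BE H * E -> BE H * E),
    is_compacts (dirsum (BE_cstar H) D) cL lam ->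
  exists I : closedSubspace L,
  lam @` cs_set I = block_ideal (BE_cstar H) D (cs_set K) /\
  two_sided_ideal cL I /\
  (* L/I is the C*-algebra K(B_E/B_K (+) E/K), canonically *)
  exists (cLI : cstar (quotient_type I))
         (rho : quotient_type I -> quotient_type BK * quotient_type K ->
                quotient_type BK * quotient_type K),
  star_morphism cL cLI (qpi I) /\
  is_compacts (dirsum cQ HQ) cLI rho /\
  (forall T b x, rho (qpi I T) (p b, q x) =
     (p (lam T (b, x)).1, q (lam T (b, x)).2)) /\
  (* E/K is the 21-corner of L/I, as a TRO *)
  exists j : quotient_type K -> quotient_type I,
  [/\ linear j, injective j & forall v, `|j v| = `|v|] /\
  (forall u v w, j (t u v w) =
     cmul cLI (cmul cLI (j u) (cadj cLI (j v))) (j w)) /\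
  (forall x, exists2 T, lam T = op21 D x & j (q x) = qpi I T) /\
  (forall v, rho (j v) = op21 HQ v) /\
  range j = [set T | in_corner21 (rho T)].
Proof.
move=> D BK p q.
(* Reduction does not change the ternary product: an inner product in B_E acts through its value in
   B. *)
pose HR := reduced_hilbert H; have hK' : ternary_ideal HR K := hK.
pose cQ := quot_cstar (inner_span_ideal hK'); pose HQ := quot_hilbert hK'.
pose t u v w := act HQ u (inner HQ v w).
have fR : full HR by exact: reduced_full.
have fQ : full HQ by move=> u; exact: (quot_full hK' fR).
have HF := dirsum_hmod (hilb_hmod HR).
have linking := compacts_exist HF (dirsum_complete (hilb_hmod HR) (hilb_complete (H := HR))).
exists t, cQ, HQ.
split; first by move=> x y z; rewrite /t /= (quot_innerE hK') (quot_actE hK').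
split.
  have [L [cL [lam hL]]] := linking.
  have hrho := quot_rep_compacts hK' hL.
  exists (quotient_type (linking_ideal K hL)), (quot_cstar (linking_ideal_ideal hK' (hL := hL))).
  (* E/K embeds in L/I as the entries y of the 21-corner. *)
  exists (corner hrho); split.
  - exact: corner_lin.
  - exact: corner_inj.
  - by move=> v; rewrite -!rnormE corner_norm.
  - by move=> u v w; exact: corner_ternary.
split; first exact: (inner_span_ideal hK').
split; first exact: quot_star_morphism.
split; first exact: (quot_innerE hK').
split; first exact: (quot_actE hK').
split; first exact: fQ.
split; first exact: linking.
move=> L cL lam hL'; have hL : is_compacts (dirsum (BE_cstar H) HR) cL lam := hL'.
exists (linking_ideal K hL).
split; first exact: (linking_idealE hK').
split; first exact: (linking_ideal_ideal hK').
have hrho := quot_rep_compacts hK' hL.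
exists (quot_cstar (linking_ideal_ideal hK' (hL := hL))), (quot_rep (hL := hL)).
split; first exact: quot_star_morphism.
split; first exact: hrho.
split; first by move=> T b x; exact: (quot_repE hK' hL T (b, x)).
exists (corner hrho); split.
  split; [exact: corner_lin|exact: corner_inj|].
  by move=> v; rewrite -!rnormE corner_norm.
split; first by move=> u v w; exact: corner_ternary.
split.
  move=> x; have [T lT] := compacts_ex hL (compact_op21 HR x).
  (* The two elements of L/I are compared as operators on the quotient module. *)
  exists T => //; apply: (compacts_inj hrho); rewrite cornerE.
  apply: quot_rep_ext => u; rewrite (quot_repE hK') lT.
  by rewrite /op21 /qpair /= (quot_actE hK') linear0.
split; first by move=> v; exact: cornerE.
exact: (corner_range hrho fQ).
Qed.
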